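(* Let $M$ be a complex manifold of dimension $n$ and $\varphi\colon\mathbb{C}^*\times M\to M$ a holomorphic action of $\mathbb{C}^*$ with an isolated fixed point at $p\in M$, and suppose $p$ is of the dicritical type. Let $\psi\colon\mathbb{C}^*\times\mathbb{C}^n\to\mathbb{C}^n$ be the action by linear transformations defined by the derivative of $\varphi$ at $p$. Then there are a $\varphi$-invariant open set $A\ni p$ in $M$, a $\psi$-invariant open set $B\ni 0$ in $\mathbb{C}^n$ and a biholomorphism $T\colon A\to B$ such that $$\psi^z\circ T\equiv T\circ\varphi^z\quad\text{for each } z\in\mathbb{C}^*.$$
   Context: A holomorphic action of $\mathbb{C}^*$ on $M$ is a holomorphic map $\varphi\colon\mathbb{C}^*\times M\to M$ with $\varphi(1,x)=x$, $\varphi(zw,x)=\varphi(z,\varphi(w,x))$; write $\varphi^z=\varphi(z,\cdot)$. If $p$ is a fixed point and $\xi\colon W\ni p\to\mathbb{C}^n$ is a local chart, the action by linear transformations defined by the derivative of $\varphi$ at $p$ is $\psi(z,x)=\big[D\xi(p)\cdot D\varphi^z(p)\cdot (D\xi(p))^{-1}\big]\cdot x$ (any other chart gives a linearly conjugate action). This linear holomorphic $\mathbb{C}^*$-action is linearly conjugate to one of the form $\psi^{z}(x)=(z^{\lambda_1}x_1,\dots,z^{\lambda_n}x_n)$ with $\lambda_1,\dots,\lambda_n\in\mathbb{Z}$ (equivalently, writing $z=\exp(2\pi\sqrt{-1}t)$, the flow $(\exp(2\pi\sqrt{-1}\lambda_1 t)x_1,\dots,\exp(2\pi\sqrt{-1}\lambda_n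 t)x_n)$). The fixed point $p$ is said to be of the dicritical type if all $\lambda_j$ are nonzero and have the same sign. *)

(* Defs.v *)
From Stdlib Require Fin.
From Stdlib Require Import Reals ZArith.
From Coquelicot Require Import Coquelicot.
Open Scope R_scope.

Definition Cn (n : nat) := Fin.t n -> C.

Fixpoint fsumR (n : nat) : (Fin.t n -> R) -> R :=
  match n with
  | O => fun _ => 0
  | S m => fun f => f Fin.F1 + fsumR m (fun i => f (Fin.FS i))
  end.

Fixpoint fsumC (n : nat) : (Fin.t n -> C) -> C :=
  match n with
  | O => fun _ => RtoC 0
  | S m => fun f => Cplus (f Fin.F1) (fsumC m (fun i => f (Fin.FS i)))
  end.

Set Implicit Arguments.

(** l^1 norm on C^n (all norms are equivalent) *)
Definition vnorm {n} (v : Cn n) : R := fsumR n (fun i => Cmod (v i)).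
Definition vadd {n} (v w : Cn n) : Cn n := fun i => Cplus (v i) (w i).
Definition vsub {n} (v w : Cn n) : Cn n := fun i => Cminus (v i) (w i).

Definition Cmat (m n : nat) := Fin.t m -> Fin.t n -> C.
Definition matvec {m n} (A : Cmat m n) (v : Cn n) : Cn m :=
  fun i => fsumC n (fun j => Cmult (A i j) (v j)).
Definition matmul {m k n} (A : Cmat m k) (B : Cmat k n) : Cmat m n :=
  fun i j => fsumC k (fun l => Cmult (A i l) (B l j)).
Definition idmat {n : nat} : Cmat n n :=
  fun i j => if Fin.eqb i j then RtoC 1 else RtoC 0.
Definition diagmat {n} (d : Cn n) : Cmat n n :=
  fun i j => if Fin.eqb i j then d i else RtoC 0.

Definition Cpowz (z : C) (k : Z) : C :=
  match k with
  | Z0 => RtoC 1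
  | Zpos p => Cpow z (Pos.to_nat p)
  | Zneg p => Cinv (Cpow z (Pos.to_nat p))
  end.

Definition open_Cn {n} (U : Cn n -> Prop) : Prop :=
  forall x, U x -> exists e, 0 < e /\ forall y, vnorm (vsub y x) < e -> U y.

Definition has_jacobian {n m} (f : Cn n -> Cn m) (x : Cn n) (J : Cmat m n) : Prop :=
  forall eps, 0 < eps -> exists delta, 0 < delta /\
    forall h : Cn n, vnorm h < delta ->
      vnorm (vsub (vsub (f (vadd x h)) (f x)) (matvec J h)) <= eps * vnorm h.

(** holomorphic on a set U (used with U open) *)
Definition holo_on {n m} (U : Cn n -> Prop) (f : Cn n -> Cn m) : Prop :=
  forall x, U x -> exists J, has_jacobian f x J.

Record topology (M : Type) := {
  opn : (M -> Prop) -> Prop;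
  opn_full : opn (fun _ => True);
  opn_inter : forall U V, opn U -> opn V -> opn (fun x => U x /\ V x);
  opn_union : forall (I : Type) (F : I -> M -> Prop),
      (forall i, opn (F i)) -> opn (fun x => exists i, F i x)
}.

Definition hausdorff {M} (tau : topology M) : Prop :=
  forall x y, x <> y -> exists U V, opn tau U /\ opn tau V /\ U x /\ V y /\
    forall w, ~ (U w /\ V w).

Definition second_countable {M} (tau : topology M) : Prop :=
  exists Bs : nat -> M -> Prop, (forall k, opn tau (Bs k)) /\
    forall U x, opn tau U -> U x -> exists k, Bs k x /\ forall y, Bs k y -> U y.

Record chart (n : nat) (M : Type) := {
  cdom : M -> Prop;
  cmap : M -> Cn n;
  cinv : Cn n -> M
}.

Definition cimg {n M} (xi : chart n M) (u : Cn n) : Prop :=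
  exists x, cdom xi x /\ cmap xi x = u.

Definition is_chart {n M} (tau : topology M) (xi : chart n M) : Prop :=
  opn tau (cdom xi) /\ open_Cn (cimg xi) /\
  (forall x, cdom xi x -> cinv xi (cmap xi x) = x) /\
  (forall u, cimg xi u -> cdom xi (cinv xi u)) /\
  (forall u, cimg xi u -> cmap xi (cinv xi u) = u) /\
  (forall x, cdom xi x -> forall e, 0 < e -> exists W, opn tau W /\ W x /\
     forall y, W y -> cdom xi y -> vnorm (vsub (cmap xi y) (cmap xi x)) < e) /\
  (forall u, cimg xi u -> forall V, opn tau V -> V (cinv xi u) ->
     exists d, 0 < d /\ forall w, cimg xi w -> vnorm (vsub w u) < d -> V (cinv xi w)).

Definition complex_manifold (n : nat) (M : Type) (tau : topology M)
    (At : chart n M -> Prop) : Prop :=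
  hausdorff tau /\ second_countable tau /\
  (forall xi, At xi -> is_chart tau xi) /\
  (forall x, exists xi, At xi /\ cdom xi x) /\
  (forall xi eta, At xi -> At eta ->
     holo_on (fun u => cimg xi u /\ cdom eta (cinv xi u))
             (fun u => cmap eta (cinv xi u))).

Definition vhead {n} (w : Cn (S n)) : C := w Fin.F1.
Definition vtail {n} (w : Cn (S n)) : Cn n := fun i => w (Fin.FS i).

(** holomorphic action of C^* on M (values of phi at z = 0 are irrelevant) *)
Definition holo_Cstar_action (n : nat) (M : Type) (tau : topology M)
    (At : chart n M -> Prop) (phi : C -> M -> M) : Prop :=
  (forall x, phi (RtoC 1) x = x) /\
  (forall z w x, z <> RtoC 0 -> w <> RtoC 0 -> phi (Cmult z w) x = phi z (phi w x)) /\
  (forall z0 x0, z0 <> RtoC 0 -> forall V, opn tau V -> V (phi z0 x0) ->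
     exists d W, 0 < d /\ opn tau W /\ W x0 /\
       forall z x, z <> RtoC 0 -> Cmod (Cminus z z0) < d -> W x -> V (phi z x)) /\
  (forall xi eta, At xi -> At eta ->
     holo_on (fun w : Cn (S n) => vhead w <> RtoC 0 /\ cimg xi (vtail w) /\
                                   cdom eta (phi (vhead w) (cinv xi (vtail w))))
             (fun w => cmap eta (phi (vhead w) (cinv xi (vtail w))))).

Definition isolated_fixed_point {M} (tau : topology M) (phi : C -> M -> M) (p : M) : Prop :=
  (forall z, z <> RtoC 0 -> phi z p = p) /\
  exists W, opn tau W /\ W p /\
    forall x, W x -> (forall z, z <> RtoC 0 -> phi z x = x) -> x = p.

(** The linear action psi(z, x) = J z . x, where J z is the Jacobian of
    xi o phi^z o xi^{-1} at xi(p), i.e. D xi(p) . D phi^z(p) . (D xi(p))^{-1}. *)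
Definition derivative_action_matrices {n M} (xi : chart n M) (phi : C -> M -> M)
    (p : M) (J : C -> Cmat n n) : Prop :=
  forall z, z <> RtoC 0 ->
    has_jacobian (fun u => cmap xi (phi z (cinv xi u))) (cmap xi p) (J z).

Definition dicritical {n} (J : C -> Cmat n n) : Prop :=
  exists (P Pinv : Cmat n n) (lam : Fin.t n -> Z),
    matmul P Pinv = @idmat n /\ matmul Pinv P = @idmat n /\
    ((forall j, (0 < lam j)%Z) \/ (forall j, (lam j < 0)%Z)) /\
    forall z, z <> RtoC 0 ->
      J z = matmul Pinv (matmul (diagmat (fun j => Cpowz z (lam j))) P).

Definition biholomorphism {n M} (tau : topology M) (At : chart n M -> Prop)
    (A : M -> Prop) (B : Cn n -> Prop) (T : M -> Cn n) : Prop :=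
  (forall x, A x -> B (T x)) /\
  exists Tinv : Cn n -> M,
    (forall y, B y -> A (Tinv y)) /\
    (forall x, A x -> Tinv (T x) = x) /\
    (forall y, B y -> T (Tinv y) = y) /\
    (forall xi, At xi ->
       holo_on (fun u => cimg xi u /\ A (cinv xi u)) (fun u => T (cinv xi u))) /\
    (forall xi, At xi ->
       holo_on (fun y => B y /\ cdom xi (Tinv y)) (fun y => cmap xi (Tinv y))).

(* Main.v *)
Require Import Defs.
From Stdlib Require Import Reals ZArith.
From Coquelicot Require Import Coquelicot.
From Stdlib Require Import Lra Lia.
From Stdlib Require Import Classical ClassicalEpsilon FunctionalExtensionality PropExtensionality.
Open Scope R_scope.
Set Implicit Arguments.

(** Put [z = exp (±w)], with the sign of the weights, so that the action becomes a
    [2πi]-periodic additive flow [Phi_w] all of whose weights [m_j] are positive and which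
    contracts a neighbourhood of [p] to [p] as [Re w -> -∞]. In a centred chart that
    diagonalises the linear part, averaging over the circle,
      [T_j(v) = 1/(2π) ∫_0^{2π} exp(- i m_j t) (Phi_{it} v)_j dt],
    gives a map tangent to the identity. By Goursat the integral does not change when the
    segment [i[0, 2π]] is translated by any [w] with [Re w <= 0], which is exactly
    [T(Phi_w v) = exp(m w) T(v)]. Hence [T] is a local linearization; it extends by
    equivariance to the basin [A] of [p], and [T(A)] is all of [C^n] since it is an invariant
    neighbourhood of [0].

    The derivatives in the definitions are pointwise complex ones, so their continuity has to
    come from Cauchy's inequality, applied on complex lines; this yields the uniform quadratic
    Taylor estimate behind differentiation under the integral sign and the inverse function
    theorem. *)

(** The common sign of the weights enters through one fact: every point close to [p] stays in the
    chart for all times with Re w <= 0. Averaging over the circle alone would give a map that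
    commutes only with rotations; to commute with the whole flow, orbits must be followed in
    coordinates along complex times, and the half-plane is where this makes sense. That orbits stay
    there comes from the time -ln 4, which halves the norm near [p], and from compactness of one
    period of the strip -ln 4 <= Re w <= 0; periodicity and iteration cover the rest. The factor
    exp(- m_j w) cancels the linear part of the flow exactly, so the average has the identity as
    derivative, and resonances between the weights are no obstruction. The half-plane serves a
    second time in Cauchy's inequality: the exponential turns it into a punctured disc, so Goursat
    for rectangles is the only contour argument. *)

Notation CI := (is_RInt (V := C_R_NormedModule)).

(** Little-o form without a quotient, the same shape as [has_jacobian], so that restricting a
    Jacobian to a complex line needs no division. *)
Definition Cderiv (f : C -> C) (z l : C) : Prop :=
  forall eps, 0 < eps -> exists delta, 0 < delta /\
    forall h : C, Cmod h < delta ->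
      Cmod (Cminus (Cminus (f (Cplus z h)) (f z)) (Cmult l h)) <= eps * Cmod h.

(** * Elementary estimates for the complex modulus *)

Lemma Cmod_le_abs (z : C) : Cmod z <= Rabs (fst z) + Rabs (snd z).
Proof.
  replace z with (Cplus (fst z, 0) (0, snd z)) at 1
    by (destruct z; unfold Cplus; simpl; f_equal; ring).
  eapply Rle_trans; [apply Cmod_triangle|].
  assert (H1 : Cmod (fst z, 0) = Rabs (fst z)) by apply (Cmod_R (fst z)).
  assert (H2 : Cmod (0, snd z) = Rabs (snd z)).
  { unfold Cmod; simpl.
    replace (0 * (0 * 1) + snd z * (snd z * 1)) with (Rsqr (snd z)) by (unfold Rsqr; ring).
    apply sqrt_Rsqr_abs. }
  lra.
Qed.

Lemma Cabs_fst_le (z : C) : Rabs (fst z) <= Cmod z.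
Proof. eapply Rle_trans; [apply Rmax_l | apply Rmax_Cmod]. Qed.

Lemma Cabs_snd_le (z : C) : Rabs (snd z) <= Cmod z.
Proof. eapply Rle_trans; [apply Rmax_r | apply Rmax_Cmod]. Qed.

Lemma Cmod_minus_sym (a b : C) : Cmod (Cminus a b) = Cmod (Cminus b a).
Proof. rewrite <- Cmod_opp. f_equal. ring. Qed.

Lemma Cmod_tri_minus (a b : C) : Cmod (Cminus a b) <= Cmod a + Cmod b.
Proof.
  unfold Cminus. eapply Rle_trans; [apply Cmod_triangle|]. rewrite Cmod_opp. lra.
Qed.

Lemma Cmod_tri_rev (a b : C) : Cmod a <= Cmod b + Cmod (Cminus a b).
Proof.
  replace a with (Cplus b (Cminus a b)) at 1 by ring. apply Cmod_triangle.
Qed.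

(** If a and b differed, eps = |a - b| / (2 (|K| + 1)) would bound |a - b| by half of itself. [K]
    may have any sign. *)
Lemma Ceq_of_small (a b : C) (K : R) :
  (forall eps, 0 < eps -> Cmod (Cminus a b) <= K * eps) -> a = b.
Proof.
  intros H. apply Ceq_minus, Cmod_eq_0.
  destruct (Rle_lt_dec (Cmod (Cminus a b)) 0) as [H0|H0].
  - apply Rle_antisym; [exact H0 | apply Cmod_ge_0].
  - exfalso.
    assert (HK : 0 < Rabs K + 1) by (pose proof (Rabs_pos K); lra).
    assert (He : 0 < Cmod (Cminus a b) / (2 * (Rabs K + 1))) by (apply Rdiv_lt_0_compat; lra).
    specialize (H _ He).
    assert (K * (Cmod (Cminus a b) / (2 * (Rabs K + 1)))
            <= (Rabs K + 1) * (Cmod (Cminus a b) / (2 * (Rabs K + 1)))).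
    { apply Rmult_le_compat_r; [lra|]. pose proof (Rle_abs K); lra. }
    assert ((Rabs K + 1) * (Cmod (Cminus a b) / (2 * (Rabs K + 1))) = Cmod (Cminus a b) / 2)
      by (field; lra).
    lra.
Qed.

(** * Complex derivatives in one variable *)

Lemma Cderiv_cont f z l : Cderiv f z l ->
  forall eps, 0 < eps -> exists delta, 0 < delta /\
    forall h, Cmod h < delta -> Cmod (Cminus (f (Cplus z h)) (f z)) < eps.
Proof.
  intros H eps Heps.
  destruct (H 1 Rlt_0_1) as [d [Hd Hh]].
  pose proof (Cmod_ge_0 l) as Hl.
  exists (Rmin d (eps / (2 + Cmod l))). split.
  - apply Rmin_pos; [exact Hd | apply Rdiv_lt_0_compat; lra].
  - intros h Hm.
    assert (H1 : Cmod h < d) by (eapply Rlt_le_trans; [exact Hm | apply Rmin_l]).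
    assert (H2 : Cmod h < eps / (2 + Cmod l)) by (eapply Rlt_le_trans; [exact Hm | apply Rmin_r]).
    specialize (Hh h H1).
    pose proof (Cmod_tri_rev (Cminus (f (Cplus z h)) (f z)) (Cmult l h)) as H3.
    rewrite Cmod_mult in H3.
    assert (H4 : (2 + Cmod l) * Cmod h < eps).
    { replace eps with ((2 + Cmod l) * (eps / (2 + Cmod l))) by (field; lra).
      apply Rmult_lt_compat_l; lra. }
    pose proof (Cmod_ge_0 h). nra.
Qed.

Lemma Cderiv_const c z : Cderiv (fun _ => c) z (RtoC 0).
Proof.
  intros eps Heps. exists 1; split; [lra|]. intros h _.
  replace (Cminus (Cminus c c) (Cmult (RtoC 0) h)) with (RtoC 0) by ring.
  rewrite Cmod_0. pose proof (Cmod_ge_0 h); nra.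
Qed.

Lemma Cderiv_affine a b z : Cderiv (fun w => Cplus a (Cmult b w)) z b.
Proof.
  intros eps Heps. exists 1; split; [lra|]. intros h _.
  match goal with |- Cmod ?x <= _ => replace x with (RtoC 0) by ring end.
  rewrite Cmod_0. pose proof (Cmod_ge_0 h); nra.
Qed.

Lemma Cderiv_minus f g z l m :
  Cderiv f z l -> Cderiv g z m -> Cderiv (fun w => Cminus (f w) (g w)) z (Cminus l m).
Proof.
  intros Hf Hg eps Heps.
  destruct (Hf (eps / 2)) as [d1 [Hd1 H1]]; [lra|].
  destruct (Hg (eps / 2)) as [d2 [Hd2 H2]]; [lra|].
  exists (Rmin d1 d2). split; [apply Rmin_pos; assumption|].
  intros h Hm. pose proof (Rmin_l d1 d2). pose proof (Rmin_r d1 d2).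
  specialize (H1 h ltac:(lra)). specialize (H2 h ltac:(lra)).
  match goal with |- Cmod ?x <= _ =>
    replace x with (Cminus (Cminus (Cminus (f (Cplus z h)) (f z)) (Cmult l h))
                           (Cminus (Cminus (g (Cplus z h)) (g z)) (Cmult m h))) by ring end.
  eapply Rle_trans; [apply Cmod_tri_minus|]. lra.
Qed.

Lemma Cderiv_comp f g z l m :
  Cderiv f z l -> Cderiv g (f z) m -> Cderiv (fun w => g (f w)) z (Cmult m l).
Proof.
  intros Hf Hg eps Heps.
  pose proof (Cmod_ge_0 l) as Hl. pose proof (Cmod_ge_0 m) as Hmm.
  (* The bound 1 makes the increment of f at most (1 + |l|) |h|; the other bound pays for the error
     of f after multiplication by m. *)
  set (e1 := Rmin 1 (eps / (2 * (1 + Cmod m)))).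
  assert (He1 : 0 < e1) by (apply Rmin_pos; [lra | apply Rdiv_lt_0_compat; lra]).
  set (e2 := eps / (2 * (1 + Cmod l))).
  assert (He2 : 0 < e2) by (apply Rdiv_lt_0_compat; lra).
  destruct (Hf e1 He1) as [d1 [Hd1 H1]].
  destruct (Hg e2 He2) as [d2 [Hd2 H2]].
  destruct (Cderiv_cont Hf Hd2) as [d3 [Hd3 H3]].
  exists (Rmin d1 d3). split; [apply Rmin_pos; assumption|].
  intros h Hh. pose proof (Rmin_l d1 d3). pose proof (Rmin_r d1 d3).
  specialize (H1 h ltac:(lra)). specialize (H3 h ltac:(lra)).
  set (k := Cminus (f (Cplus z h)) (f z)) in *.
  specialize (H2 k H3).
  replace (Cplus (f z) k) with (f (Cplus z h)) in H2 by (unfold k; ring).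
  match goal with |- Cmod ?x <= _ =>
    replace x with (Cplus (Cminus (Cminus (g (f (Cplus z h))) (g (f z))) (Cmult m k))
                          (Cmult m (Cminus k (Cmult l h)))) by ring end.
  eapply Rle_trans; [apply Cmod_triangle|]. rewrite Cmod_mult.
  assert (Hk : Cmod k <= (1 + Cmod l) * Cmod h).
  { pose proof (Cmod_tri_rev k (Cmult l h)) as Q. rewrite Cmod_mult in Q.
    pose proof (Rmin_l 1 (eps / (2 * (1 + Cmod m)))). fold e1 in H4.
    pose proof (Cmod_ge_0 h). nra. }
  assert (A1 : e2 * Cmod k <= eps / 2 * Cmod h).
  { apply Rle_trans with (e2 * ((1 + Cmod l) * Cmod h)).
    - apply Rmult_le_compat_l; lra.
    - unfold e2. right. field. lra. }
  assert (A2 : Cmod m * Cmod (Cminus k (Cmult l h)) <= eps / 2 * Cmod h).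
  { apply Rle_trans with ((1 + Cmod m) * (e1 * Cmod h)).
    - apply Rmult_le_compat; try lra; apply Cmod_ge_0.
    - apply Rle_trans with ((1 + Cmod m) * ((eps / (2 * (1 + Cmod m))) * Cmod h)).
      + apply Rmult_le_compat_l; [lra|]. apply Rmult_le_compat_r; [apply Cmod_ge_0|]. apply Rmin_r.
      + right. field. lra. }
  lra.
Qed.

Lemma Cderiv_mult f g z l m :
  Cderiv f z l -> Cderiv g z m ->
  Cderiv (fun w => Cmult (f w) (g w)) z (Cplus (Cmult l (g z)) (Cmult (f z) m)).
Proof.
  intros Hf Hg eps Heps.
  set (A := 1 + Cmod (g z)). set (B := 1 + Cmod (f z)). set (D := 1 + Cmod l).
  pose proof (Cmod_ge_0 (g z)). pose proof (Cmod_ge_0 (f z)). pose proof (Cmod_ge_0 l).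
  assert (HA : 0 < A) by (unfold A; lra). assert (HB : 0 < B) by (unfold B; lra).
  assert (HD : 0 < D) by (unfold D; lra).
  set (e1 := eps / (3 * A)). set (e2 := eps / (3 * B)). set (e3 := eps / (3 * D)).
  assert (He1 : 0 < e1) by (apply Rdiv_lt_0_compat; lra).
  assert (He2 : 0 < e2) by (apply Rdiv_lt_0_compat; lra).
  assert (He3 : 0 < e3) by (apply Rdiv_lt_0_compat; lra).
  destruct (Hf e1 He1) as [d1 [Hd1 H1']].
  destruct (Hg e2 He2) as [d2 [Hd2 H2']].
  destruct (Cderiv_cont Hg (eps := Rmin 1 e3)) as [d3 [Hd3 H3']]; [apply Rmin_pos; lra|].
  exists (Rmin d1 (Rmin d2 d3)). split; [repeat apply Rmin_pos; assumption|].
  intros h Hh.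
  pose proof (Rmin_l d1 (Rmin d2 d3)). pose proof (Rmin_r d1 (Rmin d2 d3)).
  pose proof (Rmin_l d2 d3). pose proof (Rmin_r d2 d3).
  specialize (H1' h ltac:(lra)). specialize (H2' h ltac:(lra)). specialize (H3' h ltac:(lra)).
  set (g1 := g (Cplus z h)) in *. set (f1 := f (Cplus z h)) in *.
  match goal with |- Cmod ?x <= _ =>
    replace x with (Cplus (Cplus (Cmult (Cminus (Cminus f1 (f z)) (Cmult l h)) g1)
                          (Cmult (f z) (Cminus (Cminus g1 (g z)) (Cmult m h))))
                          (Cmult (Cmult l h) (Cminus g1 (g z)))) by ring end.
  eapply Rle_trans; [apply Cmod_triangle|].
  eapply Rle_trans; [apply Rplus_le_compat_r; apply Cmod_triangle|].
  rewrite !Cmod_mult.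
  assert (Hg1 : Cmod g1 <= A).
  { pose proof (Cmod_tri_rev g1 (g z)). pose proof (Rmin_l 1 e3). unfold A. lra. }
  pose proof (Rmin_r 1 e3). pose proof (Cmod_ge_0 h).
  assert (X1 : Cmod (Cminus (Cminus f1 (f z)) (Cmult l h)) * Cmod g1 <= eps / 3 * Cmod h).
  { apply Rle_trans with ((e1 * Cmod h) * A).
    - apply Rmult_le_compat; try lra; apply Cmod_ge_0.
    - unfold e1. right. field. lra. }
  assert (X2 : Cmod (f z) * Cmod (Cminus (Cminus g1 (g z)) (Cmult m h)) <= eps / 3 * Cmod h).
  { apply Rle_trans with (B * (e2 * Cmod h)).
    - apply Rmult_le_compat; try (unfold B; lra); apply Cmod_ge_0.
    - unfold e2. right. field. lra. }
  assert (X3 : Cmod l * Cmod h * Cmod (Cminus g1 (g z)) <= eps / 3 * Cmod h).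
  { apply Rle_trans with (D * Cmod h * e3).
    - apply Rmult_le_compat; [apply Rmult_le_pos; assumption | apply Cmod_ge_0 | | lra].
      apply Rmult_le_compat_r; [assumption | unfold D; lra].
    - unfold e3. right. field. lra. }
  lra.
Qed.

(** * The complex exponential *)

Definition cexp (w : C) : C := (exp (fst w) * cos (snd w), exp (fst w) * sin (snd w)).

Lemma cexp_plus a b : cexp (Cplus a b) = Cmult (cexp a) (cexp b).
Proof.
  unfold cexp, Cplus, Cmult; simpl. rewrite exp_plus, cos_plus, sin_plus. f_equal; ring.
Qed.

Lemma cexp_0 : cexp (RtoC 0) = RtoC 1.
Proof. unfold cexp, RtoC; simpl. rewrite exp_0, cos_0, sin_0. f_equal; ring. Qed.

Lemma Cmod_cexp w : Cmod (cexp w) = exp (fst w).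
Proof.
  unfold Cmod, cexp; simpl.
  replace (_ + _) with (Rsqr (exp (fst w)) * (Rsqr (sin (snd w)) + Rsqr (cos (snd w))))
    by (unfold Rsqr; ring).
  rewrite sin2_cos2, Rmult_1_r, sqrt_Rsqr; [reflexivity|]. left; apply exp_pos.
Qed.

Lemma cexp_neq_0 w : cexp w <> RtoC 0.
Proof.
  intros H. assert (E : Cmod (cexp w) = 0) by (rewrite H; apply Cmod_0).
  rewrite Cmod_cexp in E. pose proof (exp_pos (fst w)). lra.
Qed.

Lemma cexp_opp w : cexp (Copp w) = Cinv (cexp w).
Proof.
  assert (E : Cmult (cexp (Copp w)) (cexp w) = RtoC 1).
  { rewrite <- cexp_plus, <- cexp_0. f_equal. ring. }
  pose proof (@cexp_neq_0 w).
  replace (cexp (Copp w)) with (Cmult (Cmult (cexp (Copp w)) (cexp w)) (Cinv (cexp w))).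
  - rewrite E. ring.
  - field. assumption.
Qed.

Lemma cexp_period w : cexp (Cplus w (0, 2 * PI)) = cexp w.
Proof.
  unfold cexp, Cplus; simpl. rewrite Rplus_0_r, cos_plus, sin_plus, cos_2PI, sin_2PI.
  f_equal; ring.
Qed.

Lemma cexp_nat (k : nat) w : cexp (Cmult (INR k) w) = Cpow (cexp w) k.
Proof.
  induction k as [|k IH].
  - simpl. replace (Cmult (RtoC 0) w) with (RtoC 0) by ring. apply cexp_0.
  - rewrite Cpow_S, <- IH, <- cexp_plus, S_INR, RtoC_plus. f_equal. ring.
Qed.

(** Multiplying the difference quotient by h gives a form that also covers h = 0. *)
Lemma derivable_small f l : derivable_pt_lim f 0 l ->
  forall eps, 0 < eps -> exists d, 0 < d /\
    forall h, Rabs h < d -> Rabs (f h - f 0 - l * h) <= eps * Rabs h.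
Proof.
  intros H eps Heps. destruct (H eps Heps) as [d Hd].
  exists d. split; [apply cond_pos|]. intros h Hh.
  destruct (Req_dec h 0) as [->|Hn].
  - rewrite Rmult_0_r, Rminus_0_r, Rminus_diag, Rabs_R0. lra.
  - specialize (Hd h Hn Hh). rewrite Rplus_0_l in Hd.
    replace (f h - f 0 - l * h) with (((f h - f 0) / h - l) * h) by (field; exact Hn).
    rewrite Rabs_mult. apply Rmult_le_compat_r; [apply Rabs_pos | lra].
Qed.

Lemma Cderiv_cexp_0 : Cderiv cexp (RtoC 0) (RtoC 1).
Proof.
  intros eps Heps.
  (* The real and imaginary parts will contribute 4 e |h| and 5 e |h|; e <= 1 also keeps exp x below
     3. *)
  set (e := Rmin 1 (eps / 20)).
  assert (He : 0 < e) by (apply Rmin_pos; lra).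
  destruct (derivable_small (derivable_pt_lim_exp 0) He) as [d1 [Hd1 H1]].
  destruct (derivable_small (derivable_pt_lim_cos 0) He) as [d2 [Hd2 H2]].
  destruct (derivable_small (derivable_pt_lim_sin 0) He) as [d3 [Hd3 H3]].
  exists (Rmin (Rmin d1 d2) (Rmin d3 e)). split; [apply Rmin_pos; apply Rmin_pos; assumption|].
  intros [x y] Hh.
  pose proof (Rmin_l (Rmin d1 d2) (Rmin d3 e)). pose proof (Rmin_r (Rmin d1 d2) (Rmin d3 e)).
  pose proof (Rmin_l d1 d2). pose proof (Rmin_r d1 d2).
  pose proof (Rmin_l d3 e). pose proof (Rmin_r d3 e).
  assert (E1 : e <= 1) by apply Rmin_l. assert (E20 : e <= eps / 20) by apply Rmin_r.
  pose proof (Cabs_fst_le (x, y)) as Hx. pose proof (Cabs_snd_le (x, y)) as Hy.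
  simpl in Hx, Hy. set (m := Cmod (x, y)) in *.
  specialize (H1 x ltac:(lra)). specialize (H2 y ltac:(lra)). specialize (H3 y ltac:(lra)).
  rewrite exp_0 in *. rewrite cos_0, sin_0 in *.
  replace (exp x - 1 - 1 * x) with (exp x - 1 - x) in H1 by ring.
  replace (cos y - 1 - - 0 * y) with (cos y - 1) in H2 by ring.
  replace (sin y - 0 - 1 * y) with (sin y - y) in H3 by ring.
  pose proof (Rabs_pos x). pose proof (Rabs_pos y).
  assert (Ex : Rabs (exp x - 1) <= 2 * Rabs x).
  { replace (exp x - 1) with ((exp x - 1 - x) + x) by ring.
    eapply Rle_trans; [apply Rabs_triang|]. nra. }
  assert (Ep : Rabs (exp x) <= 3).
  { replace (exp x) with ((exp x - 1) + 1) by ring.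
    eapply Rle_trans; [apply Rabs_triang|]. rewrite Rabs_R1. lra. }
  eapply Rle_trans; [apply Cmod_le_abs|].
  replace (fst _) with ((exp x - 1 - x) + exp x * (cos y - 1))
    by (unfold cexp, Cminus, Cplus, Copp, Cmult, RtoC; simpl; rewrite !Rplus_0_l, exp_0, cos_0; ring).
  replace (snd _) with (exp x * (sin y - y) + (exp x - 1) * y)
    by (unfold cexp, Cminus, Cplus, Copp, Cmult, RtoC; simpl; rewrite !Rplus_0_l, sin_0; ring).
  assert (Y1 : Rabs (exp x - 1 - x + exp x * (cos y - 1)) <= e * m + 3 * (e * m)).
  { eapply Rle_trans; [apply Rabs_triang|]. rewrite Rabs_mult.
    apply Rplus_le_compat.
    - nra.
    - apply Rmult_le_compat; try apply Rabs_pos; [assumption|]. nra. }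
  assert (Y2 : Rabs (exp x * (sin y - y) + (exp x - 1) * y) <= 3 * (e * m) + 2 * (e * m)).
  { eapply Rle_trans; [apply Rabs_triang|]. rewrite !Rabs_mult.
    apply Rplus_le_compat.
    - apply Rmult_le_compat; try apply Rabs_pos; [assumption|]. nra.
    - apply Rle_trans with (2 * Rabs x * Rabs y).
      + apply Rmult_le_compat_r; assumption.
      + assert (Rabs x <= e) by lra. nra. }
  assert (Hm : 0 <= m) by apply Cmod_ge_0.
  pose proof (Rmult_le_compat_r m _ _ Hm E20).
  pose proof (Rmult_le_pos _ _ (Rlt_le _ _ Heps) Hm). lra.
Qed.

Lemma Cderiv_cexp w : Cderiv cexp w (cexp w).
Proof.
  intros eps Heps.
  pose proof (Cmod_ge_0 (cexp w)).
  destruct (Cderiv_cexp_0 (eps := eps / (1 + Cmod (cexp w)))) as [d [Hd Hh]];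
    [apply Rdiv_lt_0_compat; lra|].
  exists d; split; [exact Hd|]. intros h Hm. specialize (Hh h Hm).
  rewrite Cplus_0_l, cexp_0 in Hh.
  match goal with |- Cmod ?x <= _ =>
    replace x with (Cmult (cexp w) (Cminus (Cminus (cexp h) (RtoC 1)) (Cmult (RtoC 1) h)))
      by (rewrite cexp_plus; ring) end.
  rewrite Cmod_mult.
  apply Rle_trans with ((1 + Cmod (cexp w)) * (eps / (1 + Cmod (cexp w)) * Cmod h)).
  - apply Rmult_le_compat; try lra; apply Cmod_ge_0.
  - right. field. lra.
Qed.

Lemma Cderiv_cexp_scal c w : Cderiv (fun u => cexp (Cmult c u)) w (Cmult (cexp (Cmult c w)) c).
Proof.
  apply (Cderiv_comp (f := fun u => Cmult c u) (g := cexp)).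
  - intros eps Heps. destruct (Cderiv_affine (RtoC 0) c w Heps) as [d [Hd Hh]].
    exists d; split; [exact Hd|]. intros h Hm. specialize (Hh h Hm).
    rewrite !Cplus_0_l in Hh. exact Hh.
  - apply Cderiv_cexp.
Qed.

Lemma cexp_onto (z : C) : z <> RtoC 0 -> exists w, cexp w = z.
Proof.
  intros Hz. destruct z as [x y].
  assert (Hm : 0 < Cmod (x, y)) by (apply Cmod_gt_0; exact Hz).
  set (m := Cmod (x, y)) in *.
  assert (Hs : (x / m) * (x / m) + (y / m) * (y / m) = 1).
  { assert (m * m = x * x + y * y).
    { unfold m, Cmod; simpl. rewrite sqrt_sqrt; [ring | nra]. }
    replace (x / m * (x / m) + y / m * (y / m)) with ((x * x + y * y) / (m * m)) by (field; lra).
    rewrite <- H. field. lra. }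
  assert (Hb : -1 <= x / m <= 1) by (split; nra).
  assert (Hsin : sin (acos (x / m)) = Rabs (y / m)).
  { rewrite sin_acos by exact Hb.
    replace (1 - Rsqr (x / m)) with (Rsqr (y / m)) by (unfold Rsqr in *; lra).
    apply sqrt_Rsqr_abs. }
  (* [acos] yields an argument in [0, pi]; points below the real axis take its opposite. *)
  destruct (Rle_lt_dec 0 y) as [Hy|Hy].
  - exists (ln m, acos (x / m)). unfold cexp; simpl.
    rewrite exp_ln, cos_acos, Hsin by assumption.
    rewrite Rabs_pos_eq by (apply Rdiv_le_0_compat; lra).
    f_equal; field; lra.
  - exists (ln m, - acos (x / m)). unfold cexp; simpl.
    rewrite exp_ln, cos_neg, sin_neg, cos_acos, Hsin by assumption.
    rewrite Rabs_left.
    + f_equal; field; lra.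
    + apply Rmult_neg_pos; [exact Hy | apply Rinv_0_lt_compat; exact Hm].
Qed.

(** * Integrals of complex-valued functions of a real variable *)

Definition Cint (f : R -> C) (a b : R) : C := RInt (V := C_R_CompleteNormedModule) f a b.

Definition rcont (f : R -> C) (t : R) : Prop :=
  forall eps, 0 < eps -> exists d, 0 < d /\
    forall s, Rabs (s - t) < d -> Cmod (Cminus (f s) (f t)) < eps.

Lemma norm_C_R (x : C) : norm (V := C_R_NormedModule) x = Cmod x.
Proof.
  unfold Cmod. change (norm (V := C_R_NormedModule) x) with
    (sqrt (Rabs (fst x) ^ 2 + Rabs (snd x) ^ 2)).
  rewrite !pow2_abs. reflexivity.
Qed.

Lemma CI_Cint f a b l : CI f a b l -> Cint f a b = l.
Proof. intros H. apply (is_RInt_unique (V := C_R_CompleteNormedModule)). exact H. Qed.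

Lemma CI_unique f a b l m : CI f a b l -> CI f a b m -> l = m.
Proof. intros H1 H2. rewrite <- (CI_Cint H1). apply CI_Cint, H2. Qed.

Lemma CI_ext_all (f g : R -> C) a b l : (forall t, f t = g t) -> CI f a b l -> CI g a b l.
Proof. intros E. apply is_RInt_ext. intros t _. apply E. Qed.

Lemma CI_norm f a b l M : a <= b ->
  (forall t, a <= t <= b -> Cmod (f t) <= M) -> CI f a b l -> Cmod l <= (b - a) * M.
Proof.
  intros Hab HM H. rewrite <- norm_C_R.
  apply (norm_RInt_le_const (V := C_R_NormedModule) f a b l M Hab); [|exact H].
  intros t Ht. rewrite norm_C_R. apply HM, Ht.
Qed.

Lemma CI_plus f g a b l m : CI f a b l -> CI g a b m ->
  CI (fun t => Cplus (f t) (g t)) a b (Cplus l m).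
Proof. intros H1 H2. exact (is_RInt_plus (V := C_R_NormedModule) f g a b l m H1 H2). Qed.

Lemma CI_minus f g a b l m : CI f a b l -> CI g a b m ->
  CI (fun t => Cminus (f t) (g t)) a b (Cminus l m).
Proof. intros H1 H2. exact (is_RInt_minus (V := C_R_NormedModule) f g a b l m H1 H2). Qed.

(** The module structure has real scalars only, so for a complex factor the two components are
    integrated separately. *)
Lemma CI_mult c f a b l : CI f a b l -> CI (fun t => Cmult c (f t)) a b (Cmult c l).
Proof.
  intros H.
  pose proof (is_RInt_fct_extend_fst (U := R_NormedModule) (V := R_NormedModule) _ _ _ _ H) as H1.
  pose proof (is_RInt_fct_extend_snd (U := R_NormedModule) (V := R_NormedModule) _ _ _ _ H) as H2.
  unfold Cmult at 2.
  apply (is_RInt_fct_extend_pair (U := R_NormedModule) (V := R_NormedModule)); simpl.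
  - apply (is_RInt_minus (V := R_NormedModule));
      apply (is_RInt_scal (V := R_NormedModule)); assumption.
  - apply (is_RInt_plus (V := R_NormedModule));
      apply (is_RInt_scal (V := R_NormedModule)); assumption.
Qed.

Lemma CI_const c a b : CI (fun _ => c) a b (Cmult (b - a) c).
Proof.
  replace (Cmult (b - a) c) with (scal (V := C_R_NormedModule) (b - a) c).
  - apply (is_RInt_const (V := C_R_NormedModule)).
  - rewrite <- RtoC_minus. apply scal_R_Cmult.
Qed.

Lemma CI_id a b : CI (fun t => RtoC t) a b (RtoC ((b * b - a * a) / 2)).
Proof.
  apply (is_RInt_fct_extend_pair (U := R_NormedModule) (V := R_NormedModule)); simpl.
  - replace ((b * b - a * a) / 2) with (minus ((fun t => t * t / 2) b) ((fun t => t * t / 2) a))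
      by (unfold minus, plus, opp; simpl; field).
    apply (is_RInt_derive (V := R_CompleteNormedModule) (fun t => t * t / 2) (fun t => t)).
    + intros t _. auto_derive; [trivial | field].
    + intros t _. apply continuous_id.
  - pose proof (is_RInt_const (V := R_NormedModule) a b 0) as Q.
    change (scal (b - a) 0) with ((b - a) * 0) in Q. rewrite Rmult_0_r in Q. exact Q.
Qed.

Arguments CI_mult c {f a b l} _.
Arguments CI_const c a b : clear implicits.
Arguments CI_id a b : clear implicits.

Lemma rcont_continuous f t : rcont f t -> continuous (U := C_R_NormedModule) f t.
Proof.
  intros H. apply (filterlim_locally (U := C_R_NormedModule)). intros eps.
  destruct (H eps (cond_pos eps)) as [d [Hd Hs]].
  exists (mkposreal d Hd). intros s Hb.
  assert (Hb' : Rabs (s - t) < d) by exact Hb.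
  specialize (Hs s Hb').
  pose proof (Cabs_fst_le (Cminus (f s) (f t))). pose proof (Cabs_snd_le (Cminus (f s) (f t))).
  split.
  - change (Rabs (fst (f s) - fst (f t)) < eps). unfold Cminus, Cplus, Copp in *; simpl in *.
    unfold Rminus. lra.
  - change (Rabs (snd (f s) - snd (f t)) < eps). unfold Cminus, Cplus, Copp in *; simpl in *.
    unfold Rminus. lra.
Qed.

Lemma CI_Cint_cont f a b : a <= b ->
  (forall t, a <= t <= b -> rcont f t) -> CI f a b (Cint f a b).
Proof.
  intros Hab H. apply (RInt_correct (V := C_R_CompleteNormedModule)).
  apply (ex_RInt_continuous (V := C_R_CompleteNormedModule)).
  rewrite Rmin_left, Rmax_right by exact Hab.
  intros t Ht. apply rcont_continuous, H, Ht.
Qed.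

Lemma CI_Chasles f a b c l m : CI f a b l -> CI f b c m -> CI f a c (Cplus l m).
Proof. intros H1 H2. exact (is_RInt_Chasles (V := C_R_NormedModule) f a b c l m H1 H2). Qed.

Lemma CI_shift f v a b l : CI f (a + v) (b + v) l -> CI (fun t => f (t + v)) a b l.
Proof.
  intros H.
  apply (is_RInt_ext (V := C_R_NormedModule) (fun t => scal 1 (f (1 * t + v)))).
  - intros t _. rewrite Rmult_1_l. apply (scal_one (V := C_R_NormedModule)).
  - apply (is_RInt_comp_lin (V := C_R_NormedModule)). rewrite !Rmult_1_l. exact H.
Qed.

(** Going from v to 0 to T to T + v, the two outer integrals cancel by periodicity. Oriented
    integrals make this valid for either sign of v. *)
Lemma CI_periodic f T v l : 0 <= T -> (forall t, rcont f t) -> (forall t, f (t + T) = f t) ->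
  CI f 0 T l -> CI (fun t => f (t + v)) 0 T l.
Proof.
  intros HT Hc Hp H. apply CI_shift. rewrite Rplus_0_l.
  assert (Hex : forall a b, CI f a b (Cint f a b)).
  { intros a b. apply (RInt_correct (V := C_R_CompleteNormedModule)).
    apply (ex_RInt_continuous (V := C_R_CompleteNormedModule)).
    intros t _. apply rcont_continuous, Hc. }
  assert (H1 : CI f v 0 (Copp (Cint f 0 v))).
  { exact (is_RInt_swap (V := C_R_NormedModule) _ _ _ _ (Hex 0 v)). }
  assert (H2 : CI f T (T + v) (Cint f 0 v)).
  { replace T with (0 + T) at 1 by ring. replace (T + v) with (v + T) by ring.
    pose proof (Hex (0 + T) (v + T)) as Q.
    pose proof (CI_shift Q) as Q'.
    assert (E : Cint f (0 + T) (v + T) = Cint f 0 v).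
    { apply (CI_unique Q'). apply (is_RInt_ext (V := C_R_NormedModule) f).
      - intros t _. symmetry. apply Hp.
      - apply Hex. }
    rewrite E in Q. exact Q. }
  replace l with (Cplus (Cplus (Copp (Cint f 0 v)) l) (Cint f 0 v)) by ring.
  apply (CI_Chasles (b := T)); [|exact H2].
  apply (CI_Chasles (b := 0)); assumption.
Qed.

(** * Goursat's theorem for rectangles *)

(** Each left end lies below every right end, so the supremum of the left ends is in all the
    intervals. *)
Lemma nested_intervals (a : nat -> R) (w : R) : 0 <= w ->
  (forall m, a m <= a (S m) /\ a (S m) + w / 2 ^ (S m) <= a m + w / 2 ^ m) ->
  exists c, forall m, a m <= c <= a m + w / 2 ^ m.
Proof.
  intros Hw H.
  assert (Hp : forall m, 0 <= w / 2 ^ m).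
  { intros m. apply Rdiv_le_0_compat; [exact Hw | apply pow_lt; lra]. }
  assert (Hinc : forall m k, a m <= a (m + k)%nat).
  { intros m k. induction k as [|k IH]; [rewrite Nat.add_0_r; lra|].
    rewrite Nat.add_succ_r. destruct (H (m + k)%nat). lra. }
  assert (Hdec : forall m k, a (m + k)%nat + w / 2 ^ (m + k) <= a m + w / 2 ^ m).
  { intros m k. induction k as [|k IH]; [rewrite Nat.add_0_r; lra|].
    rewrite Nat.add_succ_r. destruct (H (m + k)%nat). lra. }
  assert (Hall : forall i j, a i <= a j + w / 2 ^ j).
  { intros i j. pose proof (Hinc i j). pose proof (Hdec j i). pose proof (Hp (j + i)%nat).
    rewrite (Nat.add_comm j i) in *. lra. }
  destruct (completeness (fun x => exists i, x = a i)) as [c [Hub Hlub]].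
  - exists (a O + w / 2 ^ 0). intros x [i ->]. apply Hall.
  - exists (a O), O. reflexivity.
  - exists c. intros m. split.
    + apply Hub. exists m. reflexivity.
    + apply Hlub. intros x [i ->]. apply Hall.
Qed.

Section Goursat.

Variable G : C -> C.
(** At boundary points of the half-plane [Cderiv] still refers to a full neighbourhood, so
    continuity along the imaginary axis needs no separate treatment. *)
Hypothesis HG : forall w, fst w <= 0 -> exists l, Cderiv G w l.

Lemma rcont_horizontal y t : t <= 0 -> rcont (fun s => G (s, y)) t.
Proof.
  intros Ht eps Heps. destruct (HG (t, y) Ht) as [l Hl].
  destruct (Cderiv_cont Hl Heps) as [d [Hd Hh]].
  exists d; split; [exact Hd|]. intros s Hs.
  replace (s, y) with (Cplus (t, y) (RtoC (s - t)))
    by (unfold Cplus, RtoC; simpl; f_equal; ring).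
  apply Hh. rewrite Cmod_R. exact Hs.
Qed.

Lemma rcont_vertical x t : x <= 0 -> rcont (fun s => G (x, s)) t.
Proof.
  intros Hx eps Heps. destruct (HG (x, t) Hx) as [l Hl].
  destruct (Cderiv_cont Hl Heps) as [d [Hd Hh]].
  exists d; split; [exact Hd|]. intros s Hs.
  replace (x, s) with (Cplus (x, t) (0, s - t))
    by (unfold Cplus; simpl; f_equal; ring).
  apply Hh. eapply Rle_lt_trans; [apply Cmod_le_abs|]. simpl. rewrite Rabs_R0. lra.
Qed.

Definition Hseg x h y := Cint (fun t => G (t, y)) x (x + h).
Definition Vseg x y k := Cint (fun t => G (x, t)) y (y + k).
(** The counterclockwise contour integral of G around the rectangle with lower left corner (x, y);
    the factor [Ci] comes from dw = i dt on vertical sides. *)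
Definition rect x y h k : C :=
  Cminus (Cminus (Cplus (Hseg x h y) (Cmult Ci (Vseg (x + h) y k))) (Hseg x h (y + k)))
         (Cmult Ci (Vseg x y k)).

Lemma Hseg_CI x h y : 0 <= h -> x + h <= 0 -> CI (fun t => G (t, y)) x (x + h) (Hseg x h y).
Proof. intros. apply CI_Cint_cont; [lra|]. intros t Ht. apply rcont_horizontal. lra. Qed.

Lemma Vseg_CI x y k : 0 <= k -> x <= 0 -> CI (fun t => G (x, t)) y (y + k) (Vseg x y k).
Proof. intros. apply CI_Cint_cont; [lra|]. intros t Ht. apply rcont_vertical. lra. Qed.

Lemma Hseg_split x h y : 0 <= h -> x + h <= 0 ->
  Hseg x h y = Cplus (Hseg x (h / 2) y) (Hseg (x + h / 2) (h / 2) y).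
Proof.
  intros Hh Hx. apply CI_Cint. eapply CI_Chasles.
  - apply Hseg_CI; lra.
  - replace (x + h) with (x + h / 2 + h / 2) by field. apply Hseg_CI; lra.
Qed.

Lemma Vseg_split x y k : 0 <= k -> x <= 0 ->
  Vseg x y k = Cplus (Vseg x y (k / 2)) (Vseg x (y + k / 2) (k / 2)).
Proof.
  intros Hh Hx. apply CI_Cint. eapply CI_Chasles.
  - apply Vseg_CI; lra.
  - replace (y + k) with (y + k / 2 + k / 2) by field. apply Vseg_CI; lra.
Qed.

(** The halves traverse their common side in opposite directions, so it cancels. *)
Lemma rect_split_h x y h k : 0 <= h -> 0 <= k -> x + h <= 0 ->
  rect x y h k = Cplus (rect x y (h / 2) k) (rect (x + h / 2) y (h / 2) k).
Proof.
  intros Hh Hk Hx. unfold rect.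
  rewrite (Hseg_split (x := x) (h := h) y), (Hseg_split (x := x) (h := h) (y + k)) by lra.
  replace (x + h / 2 + h / 2) with (x + h) by field. ring.
Qed.

Lemma rect_split_v x y h k : 0 <= h -> 0 <= k -> x + h <= 0 ->
  rect x y h k = Cplus (rect x y h (k / 2)) (rect x (y + k / 2) h (k / 2)).
Proof.
  intros Hh Hk Hx. unfold rect.
  rewrite (Vseg_split (x := x) y (k := k)), (Vseg_split (x := x + h) y (k := k)) by lra.
  replace (y + k / 2 + k / 2) with (y + k) by field. ring.
Qed.

(** Halve first in width, then in height, each time keeping the half with the larger integral: a
    factor 2 is lost twice. *)
Lemma rect_bisect x y h k : 0 <= h -> 0 <= k -> x + h <= 0 -> exists q : R * R,
  x <= fst q /\ fst q + h / 2 <= x + h /\ y <= snd q /\ snd q + k / 2 <= y + k /\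
  Cmod (rect x y h k) <= 4 * Cmod (rect (fst q) (snd q) (h / 2) (k / 2)).
Proof.
  intros Hh Hk Hx.
  assert (S1 : exists x', x <= x' /\ x' + h / 2 <= x + h /\
     Cmod (rect x y h k) <= 2 * Cmod (rect x' y (h / 2) k)).
  { pose proof (rect_split_h (x := x) y (h := h) (k := k) Hh Hk Hx) as E.
    pose proof (Cmod_triangle (rect x y (h / 2) k) (rect (x + h / 2) y (h / 2) k)) as T.
    rewrite <- E in T.
    destruct (Rle_lt_dec (Cmod (rect x y (h / 2) k)) (Cmod (rect (x + h / 2) y (h / 2) k))).
    - exists (x + h / 2). repeat split; lra.
    - exists x. repeat split; lra. }
  destruct S1 as [x' [A1 [A2 A3]]].
  assert (S2 : exists y', y <= y' /\ y' + k / 2 <= y + k /\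
     Cmod (rect x' y (h / 2) k) <= 2 * Cmod (rect x' y' (h / 2) (k / 2))).
  { pose proof (rect_split_v (x := x') y (h := h / 2) (k := k) ltac:(lra) Hk ltac:(lra)) as E.
    pose proof (Cmod_triangle (rect x' y (h / 2) (k / 2)) (rect x' (y + k / 2) (h / 2) (k / 2))) as T.
    rewrite <- E in T.
    destruct (Rle_lt_dec (Cmod (rect x' y (h / 2) (k / 2)))
                         (Cmod (rect x' (y + k / 2) (h / 2) (k / 2)))).
    - exists (y + k / 2). repeat split; lra.
    - exists y. repeat split; lra. }
  destruct S2 as [y' [B1 [B2 B3]]].
  exists (x', y'). simpl. repeat split; lra.
Qed.

(** A total choice; its specification is guaranteed only for rectangles in the half-plane, where
    [rect_bisect] provides a quarter. *)
Definition bisect (p : R * R) (h k : R) : R * R :=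
  epsilon (inhabits p) (fun q => fst p <= fst q /\ fst q + h / 2 <= fst p + h /\
    snd p <= snd q /\ snd q + k / 2 <= snd p + k /\
    Cmod (rect (fst p) (snd p) h k) <= 4 * Cmod (rect (fst q) (snd q) (h / 2) (k / 2))).

Fixpoint corner (p : R * R) (h k : R) (m : nat) : R * R :=
  match m with
  | O => p
  | S m => bisect (corner p h k m) (h / 2 ^ m) (k / 2 ^ m)
  end.

Lemma rect_local a b x y h k eps : 0 <= h -> 0 <= k -> x + h <= 0 ->
  (forall w, x <= fst w <= x + h -> y <= snd w <= y + k ->
     Cmod (Cminus (G w) (Cplus a (Cmult b w))) <= eps) ->
  Cmod (rect x y h k) <= 2 * (h + k) * eps.
Proof.
  intros Hh Hk Hx HE.
  (* [P] is a primitive of the affine part, whose contour integral therefore telescopes. *)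
  set (P := fun w => Cplus (Cmult a w) (Cdiv (Cmult b (Cmult w w)) 2)).
  assert (Two : RtoC 2 <> RtoC 0) by (intros Q; apply RtoC_inj in Q; lra).
  assert (Pair : forall u v : R, (u, v) = Cplus u (Cmult Ci v)).
  { intros u v. unfold Cplus, Cmult, Ci, RtoC; simpl. f_equal; ring. }
  assert (Sq : forall u v : R, RtoC ((v * v - u * u) / 2) =
     Cdiv (Cminus (Cmult v v) (Cmult u u)) 2).
  { intros u v. rewrite RtoC_div by lra. rewrite RtoC_minus, !RtoC_mult. reflexivity. }
  assert (AH : forall u v s : R, CI (fun t => Cplus a (Cmult b (t, s))) u v
                 (Cminus (P (v, s)) (P (u, s)))).
  { intros u v s.
    pose proof (CI_plus (CI_const (Cplus a (Cmult b (0, s))) u v) (CI_mult b (CI_id u v))) as Q.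
    replace (Cminus (P (v, s)) (P (u, s))) with
      (Cplus (Cmult (Cminus v u) (Cplus a (Cmult b (0, s)))) (Cmult b (RtoC ((v * v - u * u) / 2)))).
    - revert Q. apply CI_ext_all. intros t. rewrite (Pair t s), (Pair 0 s). ring.
    - rewrite Sq. unfold P. rewrite (Pair v s), (Pair u s), (Pair 0 s). field; exact Two. }
  assert (AV : forall u v s : R, CI (fun t => Cplus a (Cmult b (s, t))) u v
                 (Cmult (Copp Ci) (Cminus (P (s, v)) (P (s, u))))).
  { intros u v s.
    pose proof (CI_plus (CI_const (Cplus a (Cmult b s)) u v) (CI_mult (Cmult b Ci) (CI_id u v))) as Q.
    replace (Cmult (Copp Ci) (Cminus (P (s, v)) (P (s, u)))) with
      (Cplus (Cmult (Cminus v u) (Cplus a (Cmult b s)))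
         (Cmult (Cmult b Ci) (RtoC ((v * v - u * u) / 2)))).
    - revert Q. apply CI_ext_all. intros t. rewrite (Pair s t). ring.
    - rewrite Sq. unfold P. rewrite (Pair s v), (Pair s u).
      assert (I2 : Cmult Ci Ci = Copp 1)
        by (unfold Cmult, Ci, Copp, RtoC; simpl; f_equal; ring).
      (* The factor - i^2 = 1 is inserted because [field] treats [Ci] as an atom. *)
      match goal with |- ?l = ?r => transitivity (Cmult (Copp (Cmult Ci Ci)) l) end.
      + rewrite I2. ring.
      + field; exact Two. }
  set (D := fun w => Cminus (G w) (Cplus a (Cmult b w))).
  assert (N1 : forall s, y <= s <= y + k -> Cmod (Cminus (Hseg x h s)
      (Cminus (P (x + h, s)) (P (x, s)))) <= h * eps).
  { intros s Hs. replace (h * eps) with ((x + h - x) * eps) by ring.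
    eapply CI_norm; [lra | | apply CI_minus; [apply Hseg_CI; lra | apply AH]].
    intros t Ht. apply (HE (t, s)); simpl; lra. }
  assert (N2 : forall s, x <= s <= x + h -> Cmod (Cminus (Vseg s y k)
      (Cmult (Copp Ci) (Cminus (P (s, y + k)) (P (s, y))))) <= k * eps).
  { intros s Hs. replace (k * eps) with ((y + k - y) * eps) by ring.
    eapply CI_norm; [lra | | apply CI_minus; [apply Vseg_CI; lra | apply AV]].
    intros t Ht. apply (HE (s, t)); simpl; lra. }
  pose proof (N1 y ltac:(lra)) as A1. pose proof (N1 (y + k) ltac:(lra)) as A2.
  pose proof (N2 x ltac:(lra)) as A3. pose proof (N2 (x + h) ltac:(lra)) as A4.
  assert (I2 : Cmult Ci Ci = Copp 1)
    by (unfold Cmult, Ci, Copp, RtoC; simpl; f_equal; ring).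
  match type of A1 with Cmod ?u <= _ => match type of A2 with Cmod ?v <= _ =>
  match type of A3 with Cmod ?s <= _ => match type of A4 with Cmod ?t <= _ =>
    assert (E : rect x y h k = Cminus (Cminus (Cplus u (Cmult Ci t)) v) (Cmult Ci s));
    [ | pose proof (Cmod_triangle u (Cmult Ci t));
        pose proof (Cmod_tri_minus (Cplus u (Cmult Ci t)) v);
        pose proof (Cmod_tri_minus (Cminus (Cplus u (Cmult Ci t)) v) (Cmult Ci s)) ]
  end end end end.
  - unfold rect.
    (* The corner values of [P] cancel only modulo i^2 = -1, which [ring] does not know; the added
       multiple of 1 + i^2 makes up for it. *)
    match goal with |- ?l = ?r =>
      transitivity (Cplus r (Cmult (Cplus 1 (Cmult Ci Ci))
        (Cminus (Cplus (P (x + h, y)) (P (x, y + k))) (Cplus (P (x + h, y + k)) (P (x, y)))))) end.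
    + ring.
    + rewrite I2. ring.
  - rewrite E. rewrite !Cmod_mult, Cmod_Ci in *. lra.
Qed.

Theorem goursat x y h k : 0 <= h -> 0 <= k -> x + h <= 0 -> rect x y h k = RtoC 0.
Proof.
  intros Hh Hk Hx.
  set (q := corner (x, y) h k).
  assert (Hp : forall m, 0 < 2 ^ m) by (intros; apply pow_lt; lra).
  assert (Hpos : forall r m, 0 <= r -> 0 <= r / 2 ^ m)
    by (intros; apply Rdiv_le_0_compat; [assumption | apply Hp]).
  assert (Hhalf : forall r m, r / 2 ^ S m = r / 2 ^ m / 2).
  { intros r m. simpl. pose proof (Hp m). field. lra. }
  (* The next corner is meaningful only inside the half-plane; that premise is carried here and
     discharged by induction in [Left]. *)
  assert (Inv : forall m, fst (q m) + h / 2 ^ m <= 0 ->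
     (fst (q m) <= fst (q (S m)) /\ fst (q (S m)) + h / 2 ^ (S m) <= fst (q m) + h / 2 ^ m /\
      snd (q m) <= snd (q (S m)) /\ snd (q (S m)) + k / 2 ^ (S m) <= snd (q m) + k / 2 ^ m /\
      Cmod (rect (fst (q m)) (snd (q m)) (h / 2 ^ m) (k / 2 ^ m)) <=
      4 * Cmod (rect (fst (q (S m))) (snd (q (S m))) (h / 2 ^ S m) (k / 2 ^ S m)))).
  { intros m Hm. rewrite !Hhalf.
    change (q (S m)) with (bisect (q m) (h / 2 ^ m) (k / 2 ^ m)). unfold bisect.
    apply epsilon_spec.
    apply rect_bisect; [apply Hpos; exact Hh | apply Hpos; exact Hk | exact Hm]. }
  assert (Left : forall m, fst (q m) + h / 2 ^ m <= 0).
  { induction m as [|m IH].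
    - simpl. lra.
    - destruct (Inv m IH) as [_ [A _]]. lra. }
  destruct (nested_intervals (fun m => fst (q m)) Hh) as [cx Hcx].
  { intros m. destruct (Inv m (Left m)) as [A [B _]]. split; assumption. }
  destruct (nested_intervals (fun m => snd (q m)) Hk) as [cy Hcy].
  { intros m. destruct (Inv m (Left m)) as [_ [_ [A [B _]]]]. split; assumption. }
  assert (Grow : forall m, Cmod (rect x y h k) <=
     4 ^ m * Cmod (rect (fst (q m)) (snd (q m)) (h / 2 ^ m) (k / 2 ^ m))).
  { induction m as [|m IH].
    - simpl. rewrite !Rdiv_1_r. lra.
    - destruct (Inv m (Left m)) as [_ [_ [_ [_ B]]]].
      assert (0 < 4 ^ m) by (apply pow_lt; lra).
      simpl pow at 1. nra. }
  assert (Hc0 : cx <= 0) by (specialize (Hcx O); specialize (Left O); lra).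
  destruct (HG (cx, cy) Hc0) as [l Hl].
  (* With p = (h + k) / 2^N, the N-th rectangle contributes 2 p (eps p): perimeter times the error
     of the derivative. The factor 4^N from the bisections cancels the square of 2^N. *)
  apply (@Ceq_of_small _ _ (2 * (h + k) * (h + k))). intros eps Heps.
  replace (Cminus (rect x y h k) (RtoC 0)) with (rect x y h k) by ring.
  destruct (Hl eps Heps) as [d [Hd Hloc]].
  (* The summand 1 keeps the denominator positive when the rectangle is degenerate. *)
  destruct (pow_lt_1_zero (/ 2)) with (y := d / (h + k + 1)) as [N HN];
    [rewrite Rabs_pos_eq; lra | apply Rdiv_lt_0_compat; lra |].
  specialize (HN N (le_n N)). rewrite Rabs_pos_eq in HN by (apply pow_le; lra).
  rewrite pow_inv in HN.
  pose proof (Hp N) as HpN.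
  assert (Hsmall : h / 2 ^ N + k / 2 ^ N < d).
  { apply Rle_lt_trans with ((h + k + 1) * / 2 ^ N).
    - unfold Rdiv. pose proof (Rinv_0_lt_compat _ HpN). nra.
    - replace d with ((h + k + 1) * (d / (h + k + 1))) by (field; lra).
      apply Rmult_lt_compat_l; lra. }
  pose proof (Hpos h N Hh) as HhN. pose proof (Hpos k N Hk) as HkN.
  specialize (Grow N). specialize (Left N). specialize (Hcx N). specialize (Hcy N).
  simpl in Hcx, Hcy.
  assert (Loc := @rect_local (Cminus (G (cx, cy)) (Cmult l (cx, cy))) l (fst (q N)) (snd (q N))
     (h / 2 ^ N) (k / 2 ^ N) (eps * (h / 2 ^ N + k / 2 ^ N)) HhN HkN Left).
  assert (HL : Cmod (rect (fst (q N)) (snd (q N)) (h / 2 ^ N) (k / 2 ^ N)) <=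
     2 * (h / 2 ^ N + k / 2 ^ N) * (eps * (h / 2 ^ N + k / 2 ^ N))).
  { apply Loc. intros w Hw1 Hw2.
    assert (Hdist : Cmod (Cminus w (cx, cy)) <= h / 2 ^ N + k / 2 ^ N).
    { eapply Rle_trans; [apply Cmod_le_abs|]. unfold Cminus, Cplus, Copp; simpl.
      apply Rplus_le_compat; apply Rabs_le; lra. }
    specialize (Hloc (Cminus w (cx, cy)) ltac:(lra)).
    assert (Hw : forall u v : C, Cplus u (Cminus v u) = v) by (intros; ring).
    rewrite Hw in Hloc.
    replace (Cminus (G w) (Cplus (Cminus (G (cx, cy)) (Cmult l (cx, cy))) (Cmult l w)))
      with (Cminus (Cminus (G w) (G (cx, cy))) (Cmult l (Cminus w (cx, cy)))) by ring.
    eapply Rle_trans; [exact Hloc|]. apply Rmult_le_compat_l; lra. }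
  eapply Rle_trans; [exact Grow|].
  apply Rle_trans with (4 ^ N * (2 * (h / 2 ^ N + k / 2 ^ N) * (eps * (h / 2 ^ N + k / 2 ^ N)))).
  - apply Rmult_le_compat_l; [apply pow_le; lra | exact HL].
  - right. replace 4 with (2 * 2) at 1 by ring. rewrite Rpow_mult_distr. field. lra.
Qed.

(** On the rectangle [x, 0] by [0, 2 PI] periodicity cancels the horizontal sides, so Goursat
    equates the vertical ones. *)
Lemma vertical_integral_const (x : R) : x <= 0 ->
  (forall w, G (Cplus w (0, 2 * PI)) = G w) ->
  Cint (fun t => G (x, t)) 0 (2 * PI) = Cint (fun t => G (0, t)) 0 (2 * PI).
Proof.
  intros Hx Hper. pose proof PI_RGT_0.
  assert (E := goursat (x := x) 0 (h := - x) (k := 2 * PI) ltac:(lra) ltac:(lra) ltac:(lra)).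
  unfold rect in E. rewrite Rplus_opp_r in E.
  assert (E2 : Hseg x (- x) (0 + 2 * PI) = Hseg x (- x) 0).
  { unfold Hseg. f_equal. apply functional_extensionality. intros t.
    rewrite <- (Hper (t, 0)). unfold Cplus; simpl. rewrite Rplus_0_r. reflexivity. }
  rewrite E2 in E. unfold Vseg in E. rewrite Rplus_0_l in E.
  set (I0 := Cint (fun t => G (0, t)) 0 (2 * PI)) in *.
  set (Ix := Cint (fun t => G (x, t)) 0 (2 * PI)) in *.
  assert (E3 : Cmult Ci (Cminus I0 Ix) = RtoC 0) by (rewrite <- E; ring).
  apply (f_equal (Cmult (Copp Ci))) in E3.
  replace (Cmult (Copp Ci) (Cmult Ci (Cminus I0 Ix)))
    with (Cmult (Copp (Cmult Ci Ci)) (Cminus I0 Ix)) in E3 by ring.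
  replace (Copp (Cmult Ci Ci)) with (RtoC 1) in E3
    by (unfold Cmult, Ci, Copp, RtoC; simpl; f_equal; ring).
  symmetry. apply Ceq_minus. rewrite <- (Cmult_1_l (Cminus I0 Ix)), E3. ring.
Qed.

End Goursat.

(** * Cauchy's inequality and Taylor's estimate in one variable *)

(** The substitution z = a + r exp w carries the half-plane Re w <= 0 onto the punctured disc, which
    reduces circles to vertical segments. [M] bounds the oscillation about f(a), so the integrand
    stays bounded as z approaches a after division by exp w. *)
Lemma Cauchy_inequality (f : C -> C) (a l : C) (r M : R) : 0 < r ->
  (forall z, Cmod (Cminus z a) <= r -> exists m, Cderiv f z m) ->
  (forall z, Cmod (Cminus z a) <= r -> Cmod (Cminus (f z) (f a)) <= M) ->
  Cderiv f a l -> Cmod l <= M / r.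
Proof.
  intros Hr Hd HM Hl. pose proof PI_RGT_0 as Hpi.
  (* The integral of [G] over [{x} * [0, 2 PI]] does not depend on [x <= 0] and tends to
     [2 PI r l] as [x -> -oo]. *)
  set (G := fun w : C => Cmult (Cminus (f (Cplus a (Cmult r (cexp w)))) (f a)) (cexp (Cmult (-1) w))).
  assert (Hdist : forall w, fst w <= 0 -> Cmod (Cminus (Cplus a (Cmult r (cexp w))) a) <= r).
  { intros w Hw. replace (Cminus _ _) with (Cmult r (cexp w)) by ring.
    rewrite Cmod_mult, Cmod_R, Rabs_pos_eq, Cmod_cexp by lra.
    assert (exp (fst w) <= 1) by (rewrite <- exp_0; destruct Hw as [Hw|Hw];
      [left; apply exp_increasing; exact Hw | right; rewrite Hw; reflexivity]).
    nra. }
  assert (HG : forall w, fst w <= 0 -> exists m, Cderiv G w m).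
  { intros w Hw. destruct (Hd _ (Hdist w Hw)) as [m Hm].
    eexists. apply Cderiv_mult.
    - apply Cderiv_minus; [|apply Cderiv_const].
      apply (Cderiv_comp (f := fun w => Cplus a (Cmult r (cexp w))) (g := f)); [|exact Hm].
      apply (Cderiv_comp (f := cexp) (g := fun u => Cplus a (Cmult r u))).
      + apply Cderiv_cexp.
      + apply Cderiv_affine.
    - apply Cderiv_cexp_scal. }
  assert (Hper : forall w, G (Cplus w (0, 2 * PI)) = G w).
  { intros w. unfold G. rewrite cexp_period. f_equal.
    rewrite <- (cexp_period (Cmult (-1) (Cplus w (0, 2 * PI)))). f_equal.
    unfold Cmult, Cplus, RtoC; simpl. f_equal; ring. }
  assert (Hnorm : forall w, Cmod (cexp (Cmult (-1) w)) = exp (- fst w)).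
  { intros w. rewrite Cmod_cexp. f_equal. unfold Cmult, RtoC; simpl. ring. }
  set (I0 := Cint (fun t => G (0, t)) 0 (2 * PI)).
  assert (HI0 : Cmod I0 <= 2 * PI * M).
  { replace (2 * PI * M) with ((2 * PI - 0) * M) by ring.
    apply (CI_norm (f := fun t => G (0, t))); [lra | |].
    - intros t _. unfold G. rewrite Cmod_mult, Hnorm. simpl. rewrite Ropp_0, exp_0, Rmult_1_r.
      apply HM, Hdist. simpl; lra.
    - apply CI_Cint_cont; [lra|]. intros t _. apply (rcont_vertical HG). lra. }
  assert (Heps : forall eps, 0 < eps -> Cmod l * r <= M + eps * r).
  { intros eps He. destruct (Hl eps He) as [d [Hdp Hloc]].
    (* This makes the radius r exp x at most d / 2, inside the range where the derivative estimate
       at a applies. *)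
    set (x := Rmin 0 (ln (d / (2 * r)))).
    assert (Hx0 : x <= 0) by apply Rmin_l.
    assert (Hq : 0 < d / (2 * r)) by (apply Rdiv_lt_0_compat; lra).
    assert (Hxe : exp x <= d / (2 * r)).
    { rewrite <- (exp_ln (d / (2 * r))) by exact Hq.
      destruct (Rmin_r 0 (ln (d / (2 * r)))) as [H|H]; fold x in H.
      - left. apply exp_increasing. exact H.
      - right. rewrite H. reflexivity. }
    pose proof (vertical_integral_const HG Hx0 Hper) as E. fold I0 in E.
    assert (HC : CI (fun t => G (x, t)) 0 (2 * PI) I0).
    { rewrite <- E. apply CI_Cint_cont; [lra|]. intros t _. apply (rcont_vertical HG). lra. }
    assert (HB : Cmod (Cminus I0 (Cmult (Cminus (2 * PI) 0) (Cmult l r))) <= (2 * PI - 0) * (eps * r)).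
    { rewrite <- RtoC_mult.
      eapply CI_norm; [lra | | apply (CI_minus HC (CI_const (Cmult l r) 0 (2 * PI)))].
      intros t _. unfold G.
      (* Since l r = l k exp(-w), subtracting it from the integrand leaves the derivative remainder
         at k times exp(-w), of size eps |k| exp(-x) = eps r. *)
      set (k := Cmult r (cexp (x, t))).
      assert (Hk : Cmod k = r * exp x).
      { unfold k. rewrite Cmod_mult, Cmod_R, Rabs_pos_eq, Cmod_cexp by lra. reflexivity. }
      assert (Hkd : Cmod k < d).
      { rewrite Hk. apply Rle_lt_trans with (r * (d / (2 * r))).
        - apply Rmult_le_compat_l; lra.
        - replace (r * (d / (2 * r))) with (d / 2) by (field; lra). lra. }
      specialize (Hloc k Hkd).
      assert (Hinv : Cmult (cexp (x, t)) (cexp (Cmult (-1) (x, t))) = RtoC 1).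
      { rewrite <- cexp_plus, <- cexp_0. f_equal. ring. }
      replace (Cminus (Cmult (Cminus (f (Cplus a k)) (f a)) (cexp (Cmult (-1) (x, t)))) (Cmult l r))
        with (Cmult (Cminus (Cminus (f (Cplus a k)) (f a)) (Cmult l k)) (cexp (Cmult (-1) (x, t)))).
      - rewrite Cmod_mult, Hnorm. simpl.
        apply Rle_trans with (eps * Cmod k * exp (- x)).
        + apply Rmult_le_compat_r; [left; apply exp_pos | exact Hloc].
        + right. rewrite Hk. replace (eps * (r * exp x) * exp (- x))
            with (eps * r * (exp x * exp (- x))) by ring.
          rewrite <- exp_plus, Rplus_opp_r, exp_0. ring.
      - replace (Cmult (Cminus (Cminus (f (Cplus a k)) (f a)) (Cmult l k)) (cexp (Cmult (-1) (x, t))))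
          with (Cminus (Cmult (Cminus (f (Cplus a k)) (f a)) (cexp (Cmult (-1) (x, t))))
             (Cmult (Cmult l r) (Cmult (cexp (x, t)) (cexp (Cmult (-1) (x, t))))))
          by (unfold k; ring).
        rewrite Hinv. ring. }
    pose proof (Cmod_tri_rev (Cmult (Cminus (2 * PI) 0) (Cmult l r)) I0) as T.
    rewrite Cmod_minus_sym in T.
    rewrite <- RtoC_mult, <- RtoC_minus, !Cmod_mult, !Cmod_R, !(Rabs_pos_eq r), (Rabs_pos_eq (2 * PI - 0)) in T by lra.
    rewrite <- RtoC_mult, <- RtoC_minus in HB.
    apply Rmult_le_reg_l with (2 * PI); lra. }
  apply Rmult_le_reg_r with r; [exact Hr|].
  replace (M / r * r) with M by (field; lra).
  apply le_epsilon. intros eps He.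
  replace eps with (eps / r * r) by (field; lra). apply Heps.
  apply Rdiv_lt_0_compat; assumption.
Qed.

(** The components are separated because the mean value theorem concerns real-valued functions. *)
Lemma Cderiv_segment (f : C -> C) (a v l : C) (t : R) :
  Cderiv f (Cplus a (Cmult t v)) l ->
  is_derive (fun s : R => fst (f (Cplus a (Cmult s v)))) t (fst (Cmult l v)) /\
  is_derive (fun s : R => snd (f (Cplus a (Cmult s v)))) t (snd (Cmult l v)).
Proof.
  intros H.
  assert (Q : forall eps, 0 < eps -> exists d, 0 < d /\ forall h : R, h <> 0 -> Rabs h < d ->
     Cmod (Cminus (Cmult (Cminus (f (Cplus a (Cmult (t + h)%R v))) (f (Cplus a (Cmult t v)))) (/ h)%R)
       (Cmult l v)) < eps).
  { intros eps He. pose proof (Cmod_ge_0 v) as Hv.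
    destruct (H (eps / (1 + Cmod v)) ltac:(apply Rdiv_lt_0_compat; lra)) as [d [Hd Hh]].
    exists (d / (1 + Cmod v)). split; [apply Rdiv_lt_0_compat; lra|].
    intros h Hn Hs.
    assert (Hhv : Cmod (Cmult h v) = Rabs h * Cmod v) by (rewrite Cmod_mult, Cmod_R; reflexivity).
    pose proof (Rabs_pos_lt h Hn) as Hp.
    assert (Hsm : Cmod (Cmult h v) < d).
    { rewrite Hhv. apply Rle_lt_trans with (Rabs h * (1 + Cmod v)); [nra|].
      replace d with (d / (1 + Cmod v) * (1 + Cmod v)) by (field; lra).
      apply Rmult_lt_compat_r; lra. }
    specialize (Hh _ Hsm). rewrite Hhv in Hh.
    replace (Cplus (Cplus a (Cmult t v)) (Cmult h v)) with (Cplus a (Cmult (t + h)%R v)) in Hh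
      by (rewrite RtoC_plus; ring).
    match type of Hh with Cmod (Cminus ?u _) <= _ => set (D := u) in * end.
    assert (Hc : RtoC h <> RtoC 0) by (intros E; apply Hn, RtoC_inj, E).
    replace (Cminus (Cmult D (/ h)%R) (Cmult l v))
      with (Cmult (/ h)%R (Cminus D (Cmult l (Cmult h v)))).
    - rewrite Cmod_mult, Cmod_R, Rabs_inv.
      apply Rle_lt_trans with (/ Rabs h * (eps / (1 + Cmod v) * (Rabs h * Cmod v))).
      + apply Rmult_le_compat_l; [left; apply Rinv_0_lt_compat, Hp | exact Hh].
      + replace (/ Rabs h * (eps / (1 + Cmod v) * (Rabs h * Cmod v)))
          with (eps - eps / (1 + Cmod v)) by (field; lra).
        assert (0 < eps / (1 + Cmod v)) by (apply Rdiv_lt_0_compat; lra). lra.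
    - rewrite RtoC_inv by exact Hn. field. exact Hc. }
  split; apply is_derive_Reals; intros eps He; destruct (Q eps He) as [d [Hd Hh]];
    exists (mkposreal d Hd); intros h Hn Hs; specialize (Hh h Hn Hs);
    match type of Hh with Cmod ?u < _ =>
      pose proof (Cabs_fst_le u) as Q1; pose proof (Cabs_snd_le u) as Q2 end.
  - eapply Rle_lt_trans; [|exact Hh]. eapply Rle_trans; [|exact Q1]. right. f_equal.
    unfold Cminus, Cplus, Copp, Cmult, RtoC, Rdiv; simpl; ring.
  - eapply Rle_lt_trans; [|exact Hh]. eapply Rle_trans; [|exact Q2]. right. f_equal.
    unfold Cminus, Cplus, Copp, Cmult, RtoC, Rdiv; simpl; ring.
Qed.

(** The mean value theorem is applied to the real and to the imaginary part, at two different
    points; hence the factor 2. Nothing is integrated, so the derivative may be any pointwise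
    choice. *)
Lemma Cmean_value (f : C -> C) (a b : C) (D : R) :
  (forall t : R, 0 <= t <= 1 -> exists l, Cderiv f (Cplus a (Cmult t (Cminus b a))) l /\ Cmod l <= D) ->
  Cmod (Cminus (f b) (f a)) <= 2 * D * Cmod (Cminus b a).
Proof.
  intros H. set (v := Cminus b a) in *.
  set (df := fun t : R => epsilon (inhabits (RtoC 0)) (fun l => Cderiv f (Cplus a (Cmult t v)) l /\ Cmod l <= D)).
  assert (Hdf : forall t : R, 0 <= t <= 1 -> Cderiv f (Cplus a (Cmult t v)) (df t) /\ Cmod (df t) <= D).
  { intros t Ht. unfold df. apply epsilon_spec. apply H, Ht. }
  assert (E0 : Cplus a (Cmult 0 v) = a) by ring.
  assert (E1 : Cplus a (Cmult 1 v) = b) by (unfold v; ring).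
  assert (Hb : forall t : R, 0 <= t <= 1 -> Cmod (Cmult (df t) v) <= D * Cmod v).
  { intros t Ht. rewrite Cmod_mult. apply Rmult_le_compat_r; [apply Cmod_ge_0 | apply Hdf, Ht]. }
  assert (DS : forall t : R, 0 <= t <= 1 ->
     is_derive (fun s : R => fst (f (Cplus a (Cmult s v)))) t (fst (Cmult (df t) v)) /\
     is_derive (fun s : R => snd (f (Cplus a (Cmult s v)))) t (snd (Cmult (df t) v))).
  { intros t Ht. apply Cderiv_segment. exact (proj1 (Hdf t Ht)). }
  assert (P1 : Rabs (fst (f b) - fst (f a)) <= D * Cmod v).
  { destruct (MVT_gen (fun s : R => fst (f (Cplus a (Cmult s v)))) 0 1 (fun t => fst (Cmult (df t) v)))
      as [c [Hc E]].
    - rewrite Rmin_left, Rmax_right by lra. intros t Ht. exact (proj1 (DS t ltac:(lra))).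
    - rewrite Rmin_left, Rmax_right by lra. intros t Ht.
      apply continuity_pt_filterlim. apply (ex_derive_continuous (V := R_NormedModule)).
      eexists. exact (proj1 (DS t ltac:(lra))).
    - rewrite Rmin_left, Rmax_right in Hc by lra. cbv beta in E. rewrite E0, E1 in E.
      rewrite E, Rminus_0_r, Rmult_1_r.
      eapply Rle_trans; [apply Cabs_fst_le | apply Hb, Hc]. }
  assert (P2 : Rabs (snd (f b) - snd (f a)) <= D * Cmod v).
  { destruct (MVT_gen (fun s : R => snd (f (Cplus a (Cmult s v)))) 0 1 (fun t => snd (Cmult (df t) v)))
      as [c [Hc E]].
    - rewrite Rmin_left, Rmax_right by lra. intros t Ht. exact (proj2 (DS t ltac:(lra))).
    - rewrite Rmin_left, Rmax_right by lra. intros t Ht.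
      apply continuity_pt_filterlim. apply (ex_derive_continuous (V := R_NormedModule)).
      eexists. exact (proj2 (DS t ltac:(lra))).
    - rewrite Rmin_left, Rmax_right in Hc by lra. cbv beta in E. rewrite E0, E1 in E.
      rewrite E, Rminus_0_r, Rmult_1_r.
      eapply Rle_trans; [apply Cabs_snd_le | apply Hb, Hc]. }
  eapply Rle_trans; [apply Cmod_le_abs|].
  unfold Cminus at 1 2, Cplus, Copp; simpl. unfold Rminus in *. lra.
Qed.

(** The increment z -> f(z + b) - f(z) stands in for a second derivative: Cauchy bounds f' by 2M/r,
    hence the increment by 4M/r |b|; Cauchy applied to the increment bounds f'(b) - f'(0) by 8M/r^2
    |b|; the mean value estimate for f(z) - l z doubles this. Each use of Cauchy needs a margin r,
    which is why the disc has radius 4r. *)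
Lemma Taylor_estimate (f : C -> C) (l : C) (r M : R) : 0 < r ->
  (forall z, Cmod z <= 4 * r -> exists m, Cderiv f z m) ->
  (forall z, Cmod z <= 4 * r -> Cmod (f z) <= M) ->
  Cderiv f 0 l ->
  forall t, Cmod t <= r ->
    Cmod (Cminus (Cminus (f t) (f 0)) (Cmult l t)) <= 16 * M / (r * r) * (Cmod t * Cmod t).
Proof.
  intros Hr Hd HM Hl.
  assert (HM0 : 0 <= M).
  { eapply Rle_trans; [apply Cmod_ge_0 | apply (HM 0)]. rewrite Cmod_0; lra. }
  assert (Hscal : forall (s : R) z, 0 <= s <= 1 -> Cmod (Cmult s z) <= Cmod z).
  { intros s z Hs. rewrite Cmod_mult, Cmod_R, Rabs_pos_eq by lra. pose proof (Cmod_ge_0 z). nra. }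
  assert (B1 : forall z m, Cmod z <= 3 * r -> Cderiv f z m -> Cmod m <= 2 * M / r).
  { intros z m Hz Hm. apply (Cauchy_inequality (f := f) (a := z)); [exact Hr | | | exact Hm].
    - intros u Hu. apply Hd. pose proof (Cmod_tri_rev u z). lra.
    - intros u Hu. pose proof (Cmod_tri_rev u z). eapply Rle_trans; [apply Cmod_tri_minus|].
      pose proof (HM u ltac:(lra)). pose proof (HM z ltac:(lra)). lra. }
  assert (B2 : forall b m, Cmod b <= r -> Cderiv f b m ->
     Cmod (Cminus m l) <= 8 * M / (r * r) * Cmod b).
  { intros b m Hb Hm. pose proof (Cmod_ge_0 b) as Hb0.
    set (phi := fun z => Cminus (f (Cplus z b)) (f z)).
    assert (Hshift : forall z m, Cderiv f (Cplus z b) m -> Cderiv (fun u => f (Cplus u b)) z m).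
    { intros z m' Hm' eps He. destruct (Hm' eps He) as [d [Hdp Hh]].
      exists d; split; [exact Hdp|]. intros h Hs. specialize (Hh h Hs).
      replace (Cplus (Cplus z h) b) with (Cplus (Cplus z b) h) by ring. exact Hh. }
    assert (Hphi : forall z, Cmod z <= r -> Cmod (phi z) <= 2 * (2 * M / r) * Cmod b).
    { intros z Hz. unfold phi.
      replace (Cmod b) with (Cmod (Cminus (Cplus z b) z)) by (f_equal; ring).
      apply Cmean_value. intros t Ht.
      assert (Hloc : Cmod (Cplus z (Cmult t (Cminus (Cplus z b) z))) <= 3 * r).
      { eapply Rle_trans; [apply Cmod_triangle|].
        replace (Cminus (Cplus z b) z) with b by ring. pose proof (Hscal t b Ht). lra. }
      destruct (Hd _ ltac:(eapply Rle_trans; [exact Hloc | lra])) as [m' Hm'].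
      exists m'. split; [exact Hm'|]. apply (B1 _ _ Hloc Hm'). }
    replace (8 * M / (r * r) * Cmod b) with ((8 * M / r * Cmod b) / r) by (field; lra).
    apply (Cauchy_inequality (f := phi) (a := 0)); [exact Hr | | |].
    - intros z Hz. replace (Cminus z 0) with z in Hz by ring.
      destruct (Hd (Cplus z b)) as [m1 Hm1].
      { eapply Rle_trans; [apply Cmod_triangle | lra]. }
      destruct (Hd z) as [m2 Hm2]; [lra|].
      eexists. apply Cderiv_minus; [apply Hshift, Hm1 | exact Hm2].
    - intros z Hz. replace (Cminus z 0) with z in Hz by ring.
      eapply Rle_trans; [apply Cmod_tri_minus|].
      pose proof (Hphi z Hz). pose proof (Hphi 0 ltac:(rewrite Cmod_0; lra)).
      replace (8 * M / r * Cmod b) with (2 * (2 * (2 * M / r) * Cmod b)) by (field; lra). lra.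
    - apply Cderiv_minus; [|exact Hl]. apply Hshift. rewrite Cplus_0_l. exact Hm. }
  intros t Ht.
  set (g := fun z => Cminus (f z) (Cplus 0 (Cmult l z))).
  replace (Cminus (Cminus (f t) (f 0)) (Cmult l t)) with (Cminus (g t) (g 0)) by (unfold g; ring).
  replace (16 * M / (r * r) * (Cmod t * Cmod t)) with
    (2 * (8 * M / (r * r) * Cmod t) * Cmod (Cminus t 0)).
  - apply Cmean_value. intros s Hs.
    replace (Cplus 0 (Cmult s (Cminus t 0))) with (Cmult s t) by ring.
    pose proof (Hscal s t Hs) as Hst.
    destruct (Hd (Cmult s t)) as [m Hm]; [lra|].
    exists (Cminus m l). split.
    + apply Cderiv_minus; [exact Hm | apply Cderiv_affine].
    + eapply Rle_trans; [apply (B2 (Cmult s t)); [lra | exact Hm]|].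
      apply Rmult_le_compat_l; [|exact Hst].
      apply Rdiv_le_0_compat; [lra | nra].
  - replace (Cminus t 0) with t by ring. field. lra.
Qed.

(** * The normed space C^n *)

Lemma fun_choice {A B : Type} (P : A -> B -> Prop) :
  (forall x, exists y, P x y) -> exists f : A -> B, forall x, P x (f x).
Proof.
  intros H. exists (fun x => proj1_sig (constructive_indefinite_description _ (H x))).
  intros x. apply proj2_sig.
Qed.

Definition vzero {n} : Cn n := fun _ => RtoC 0.
Definition vscal {n} (c : C) (v : Cn n) : Cn n := fun i => Cmult c (v i).

Ltac vext := apply functional_extensionality; intro;
  unfold vadd, vsub, vscal, vzero; try ring.

Lemma fsumR_le n (f g : Fin.t n -> R) : (forall i, f i <= g i) -> fsumR n f <= fsumR n g.
Proof.
  induction n as [|n IH]; intros H; simpl; [lra|].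
  apply Rplus_le_compat; [apply H | apply IH; intros; apply H].
Qed.

Lemma fsumR_plus n (f g : Fin.t n -> R) : fsumR n (fun i => f i + g i) = fsumR n f + fsumR n g.
Proof. induction n as [|n IH]; simpl; [ring|]. rewrite IH. ring. Qed.

Lemma fsumR_scal n c (f : Fin.t n -> R) : fsumR n (fun i => c * f i) = c * fsumR n f.
Proof. induction n as [|n IH]; simpl; [ring|]. rewrite IH. ring. Qed.

Lemma fsumR_const n c : fsumR n (fun _ => c) = INR n * c.
Proof. induction n as [|n IH]; [simpl; ring|]. rewrite S_INR. simpl fsumR. rewrite IH. ring. Qed.

Lemma fsumR_ge_0 n (f : Fin.t n -> R) : (forall i, 0 <= f i) -> 0 <= fsumR n f.
Proof.
  intros H. apply Rle_trans with (fsumR n (fun _ => 0)); [rewrite fsumR_const; lra|].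
  apply fsumR_le, H.
Qed.

Lemma fsumR_ge_term n (f : Fin.t n -> R) i : (forall i, 0 <= f i) -> f i <= fsumR n f.
Proof.
  intros H. induction i as [n|n i IH]; simpl.
  - assert (0 <= fsumR n (fun i => f (Fin.FS i))) by (apply fsumR_ge_0; auto). lra.
  - pose proof (H Fin.F1). pose proof (IH (fun i => f (Fin.FS i)) (fun j => H (Fin.FS j))). simpl in *. lra.
Qed.

Lemma vnorm_ge_0 n (v : Cn n) : 0 <= vnorm v.
Proof. apply fsumR_ge_0. intros; apply Cmod_ge_0. Qed.

Lemma vnorm_comp n (v : Cn n) i : Cmod (v i) <= vnorm v.
Proof. apply (fsumR_ge_term (fun i => Cmod (v i))). intros; apply Cmod_ge_0. Qed.

Lemma vnorm_le_const n (v : Cn n) K : (forall i, Cmod (v i) <= K) -> vnorm v <= INR n * K.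
Proof. intros H. rewrite <- fsumR_const. apply fsumR_le, H. Qed.

Lemma vnorm_triangle n (u v : Cn n) : vnorm (vadd u v) <= vnorm u + vnorm v.
Proof.
  unfold vnorm. rewrite <- fsumR_plus. apply fsumR_le. intros; apply Cmod_triangle.
Qed.

Lemma vnorm_scal n c (v : Cn n) : vnorm (vscal c v) = Cmod c * vnorm v.
Proof.
  unfold vnorm, vscal. rewrite <- fsumR_scal. f_equal.
  apply functional_extensionality. intros i. apply Cmod_mult.
Qed.

Lemma vnorm_zero n : vnorm (@vzero n) = 0.
Proof.
  replace (@vzero n) with (vscal 0 (@vzero n)) by vext.
  rewrite vnorm_scal, Cmod_0. ring.
Qed.

Lemma vnorm_eq_0 n (v : Cn n) : vnorm v <= 0 -> v = vzero.
Proof.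
  intros H. apply functional_extensionality. intros i. apply Cmod_eq_0.
  pose proof (vnorm_comp v i). pose proof (Cmod_ge_0 (v i)). lra.
Qed.

Lemma vnorm_tri_sub n (u v : Cn n) : vnorm (vsub u v) <= vnorm u + vnorm v.
Proof.
  replace (vsub u v) with (vadd u (vscal (-1) v)) by vext.
  eapply Rle_trans; [apply vnorm_triangle|]. rewrite vnorm_scal, Cmod_R, (Rabs_left (-1)) by lra. lra.
Qed.

Lemma vnorm_sub_sym n (u v : Cn n) : vnorm (vsub u v) = vnorm (vsub v u).
Proof.
  replace (vsub u v) with (vscal (-1) (vsub v u)) by vext.
  rewrite vnorm_scal, Cmod_R, (Rabs_left (-1)) by lra. ring.
Qed.

Lemma vnorm_tri_rev n (u v : Cn n) : vnorm u <= vnorm v + vnorm (vsub u v).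
Proof.
  replace u with (vadd v (vsub u v)) at 1 by vext. apply vnorm_triangle.
Qed.

Lemma vadd_sub n (x y : Cn n) : vadd x (vsub y x) = y.
Proof. vext. Qed.

Lemma vadd_zero n (x : Cn n) : vadd x vzero = x.
Proof. vext. Qed.

Lemma vsub_zero n (x : Cn n) : vsub x vzero = x.
Proof. vext. Qed.

Lemma vsub_add n (x h : Cn n) : vsub (vadd x h) x = h.
Proof. vext. Qed.

(** * Complex-linear maps and derivatives *)

Definition linear {m n} (L : Cn m -> Cn n) : Prop :=
  (forall u v, L (vadd u v) = vadd (L u) (L v)) /\ (forall c v, L (vscal c v) = vscal c (L v)).

Definition linear1 {m} (L : Cn m -> C) : Prop :=
  (forall u v, L (vadd u v) = Cplus (L u) (L v)) /\ (forall c v, L (vscal c v) = Cmult c (L v)).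

Lemma linear_comp_coord m n (L : Cn m -> Cn n) i : linear L -> linear1 (fun v => L v i).
Proof. intros [H1 H2]. split; intros; [rewrite H1 | rewrite H2]; reflexivity. Qed.

Lemma linear_sub m n (L : Cn m -> Cn n) u v : linear L -> L (vsub u v) = vsub (L u) (L v).
Proof.
  intros [H1 H2]. replace (vsub u v) with (vadd u (vscal (-1) v)) by vext.
  rewrite H1, H2. vext.
Qed.

Lemma linear_zero m n (L : Cn m -> Cn n) : linear L -> L vzero = vzero.
Proof.
  intros [_ H2]. replace (@vzero m) with (vscal 0 (@vzero m)) by vext. rewrite H2. vext.
Qed.

Lemma linear_compose m k n (K : Cn k -> Cn n) (L : Cn m -> Cn k) :
  linear K -> linear L -> linear (fun v => K (L v)).
Proof. intros [A1 A2] [B1 B2]. split; intros; [rewrite B1, A1 | rewrite B2, A2]; reflexivity. Qed.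

Definition vcons {n} (c : C) (v : Cn n) : Cn (S n) :=
  fun i => Fin.caseS' i (fun _ => C) c v.

(** Induction on the dimension, splitting off the first basis vector. *)
Lemma linear1_repr n (L : Cn n -> C) : linear1 L ->
  exists a : Cn n, forall v, L v = fsumC n (fun j => Cmult (a j) (v j)).
Proof.
  induction n as [|n IH]; intros [H1 H2].
  - exists vzero. intros v. simpl. replace v with (vscal 0 v).
    + rewrite H2. ring.
    + apply functional_extensionality. intros i. inversion i.
  - destruct (IH (fun v => L (vcons 0 v))) as [a Ha].
    { split; intros.
      - rewrite <- H1. f_equal. apply functional_extensionality. intros i.
        apply (Fin.caseS' i); intros; unfold vadd; simpl; ring.
      - rewrite <- H2. f_equal. apply functional_extensionality. intros i.
        apply (Fin.caseS' i); intros; unfold vscal; simpl; ring. }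
    exists (vcons (L (vcons 1 vzero)) a). intros v.
    change (L v = Cplus (Cmult (L (vcons 1 vzero)) (v Fin.F1))
      (fsumC n (fun j => Cmult (a j) (vtail v j)))).
    rewrite <- (Ha (vtail v)).
    replace (Cmult (L (vcons 1 vzero)) (v Fin.F1)) with (L (vscal (v Fin.F1) (vcons 1 vzero)))
      by (rewrite H2; ring).
    rewrite <- H1. f_equal. apply functional_extensionality. intros i.
    apply (Fin.caseS' i); intros; unfold vadd, vscal, vtail, vzero; simpl; ring.
Qed.

Lemma fsumC_bound n (a v : Cn n) :
  Cmod (fsumC n (fun j => Cmult (a j) (v j))) <= vnorm a * vnorm v.
Proof.
  induction n as [|n IH]; simpl; [rewrite Cmod_0; unfold vnorm; simpl; lra|].
  eapply Rle_trans; [apply Cmod_triangle|]. rewrite Cmod_mult.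
  specialize (IH (vtail a) (vtail v)).
  change (vnorm a) with (Cmod (a Fin.F1) + vnorm (vtail a)).
  change (vnorm v) with (Cmod (v Fin.F1) + vnorm (vtail v)).
  unfold vtail in IH at 1 2.
  pose proof (Cmod_ge_0 (a Fin.F1)). pose proof (Cmod_ge_0 (v Fin.F1)).
  pose proof (vnorm_ge_0 (vtail a)). pose proof (vnorm_ge_0 (vtail v)). nra.
Qed.

Lemma fsumC_plus n (f g : Fin.t n -> C) :
  fsumC n (fun i => Cplus (f i) (g i)) = Cplus (fsumC n f) (fsumC n g).
Proof. induction n as [|n IH]; simpl; [ring|]. rewrite IH. ring. Qed.

Lemma fsumC_scal n c (f : Fin.t n -> C) :
  fsumC n (fun i => Cmult c (f i)) = Cmult c (fsumC n f).
Proof. induction n as [|n IH]; simpl; [ring|]. rewrite IH. ring. Qed.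

Lemma linear_matvec m n (A : Cmat m n) : linear (matvec A).
Proof.
  split; intros; apply functional_extensionality; intros i; unfold matvec, vadd, vscal.
  - rewrite <- fsumC_plus. f_equal. apply functional_extensionality; intros; ring.
  - rewrite <- fsumC_scal. f_equal. apply functional_extensionality; intros; ring.
Qed.

Lemma linear_repr m n (L : Cn n -> Cn m) : linear L -> exists A : Cmat m n, L = matvec A.
Proof.
  intros H.
  destruct (fun_choice (fun (i : Fin.t m) (a : Cn n) =>
     forall v, L v i = fsumC n (fun j => Cmult (a j) (v j)))) as [A HA].
  { intros i. apply linear1_repr. apply linear_comp_coord, H. }
  exists A. apply functional_extensionality. intros v. apply functional_extensionality. intros i.
  apply HA.
Qed.

Lemma linear_bounded m n (L : Cn m -> Cn n) : linear L ->
  exists K, 0 < K /\ forall v, vnorm (L v) <= K * vnorm v.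
Proof.
  intros H. destruct (linear_repr H) as [A ->].
  exists (1 + fsumR n (fun i => vnorm (A i))).
  assert (0 <= fsumR n (fun i => vnorm (A i))) by (apply fsumR_ge_0; intros; apply vnorm_ge_0).
  split; [lra|]. intros v. pose proof (vnorm_ge_0 v).
  apply Rle_trans with (fsumR n (fun i => vnorm v * vnorm (A i))).
  - apply fsumR_le. intros i. unfold matvec. rewrite Rmult_comm. apply fsumC_bound.
  - rewrite fsumR_scal. nra.
Qed.

(** The derivative is kept as a linear map, so that the chain rule is plain composition;
    [linear_repr] turns it back into a Jacobian matrix. *)
Definition vderiv {m n} (f : Cn m -> Cn n) (x : Cn m) (L : Cn m -> Cn n) : Prop :=
  linear L /\ forall eps, 0 < eps -> exists delta, 0 < delta /\
    forall h, vnorm h < delta ->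
      vnorm (vsub (vsub (f (vadd x h)) (f x)) (L h)) <= eps * vnorm h.

Definition vderiv1 {m} (f : Cn m -> C) (x : Cn m) (L : Cn m -> C) : Prop :=
  linear1 L /\ forall eps, 0 < eps -> exists delta, 0 < delta /\
    forall h, vnorm h < delta ->
      Cmod (Cminus (Cminus (f (vadd x h)) (f x)) (L h)) <= eps * vnorm h.

Lemma has_jacobian_vderiv m n (f : Cn m -> Cn n) x J :
  has_jacobian f x J -> vderiv f x (matvec J).
Proof. intros H. split; [apply linear_matvec | exact H]. Qed.

Lemma vderiv_has_jacobian m n (f : Cn m -> Cn n) x L :
  vderiv f x L -> exists J, has_jacobian f x J.
Proof. intros [HL H]. destruct (linear_repr HL) as [J ->]. exists J. exact H. Qed.

Lemma vderiv_coord m n (f : Cn m -> Cn n) x L i :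
  vderiv f x L -> vderiv1 (fun y => f y i) x (fun h => L h i).
Proof.
  intros [HL H]. split; [apply linear_comp_coord, HL|].
  intros eps He. destruct (H eps He) as [d [Hd Hh]]. exists d; split; [exact Hd|].
  intros h Hs. eapply Rle_trans; [|apply (Hh h Hs)].
  apply (vnorm_comp (vsub (vsub (f (vadd x h)) (f x)) (L h)) i).
Qed.

(** A property inherited by smaller thresholds holds at the minimum of finitely many of them; for an
    empty index set 1 serves. *)
Lemma fin_min_pos n (P : Fin.t n -> R -> Prop) :
  (forall i d d', 0 < d' <= d -> P i d -> P i d') ->
  (forall i, exists d, 0 < d /\ P i d) -> exists d, 0 < d /\ forall i, P i d.
Proof.
  induction n as [|n IH]; intros Hm H.
  - exists 1. split; [lra|]. intros i; inversion i.
  - destruct (IH (fun i => P (Fin.FS i))) as [d1 [Hd1 H1]].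
    + intros i; apply Hm.
    + intros i; apply H.
    + destruct (H Fin.F1) as [d2 [Hd2 H2]].
      pose proof (Rmin_l d1 d2). pose proof (Rmin_r d1 d2). pose proof (Rmin_pos _ _ Hd1 Hd2).
      exists (Rmin d1 d2). split; [assumption|].
      intros i. apply (Fin.caseS' i).
      * apply (Hm _ d2); [lra | exact H2].
      * intros j. apply (Hm _ d1); [lra | apply H1].
Qed.

Lemma vderiv_of_coords m n (f : Cn m -> Cn n) x L :
  (forall i, vderiv1 (fun y => f y i) x (fun h => L h i)) -> vderiv f x L.
Proof.
  intros H. split.
  - split; intros; apply functional_extensionality; intros i; destruct (H i) as [[H1 H2] _];
      [apply H1 | apply H2].
  - intros eps He. pose proof (pos_INR n) as Hn.
    destruct (fin_min_pos (fun i d => forall h, vnorm h < d ->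
      Cmod (Cminus (Cminus (f (vadd x h) i) (f x i)) (L h i)) <= eps / (1 + INR n) * vnorm h))
      as [d [Hd Hh]].
    + intros i d d' Hd Hi h Hs. apply Hi. lra.
    + intros i. destruct (H i) as [_ Hi]. apply Hi. apply Rdiv_lt_0_compat; lra.
    + exists d; split; [exact Hd|]. intros h Hs. pose proof (vnorm_ge_0 h).
      eapply Rle_trans; [apply vnorm_le_const; intros i; apply (Hh i h Hs)|].
      rewrite <- Rmult_assoc. apply Rmult_le_compat_r; [assumption|].
      apply Rmult_le_reg_r with (1 + INR n); [lra|].
      replace (INR n * (eps / (1 + INR n)) * (1 + INR n)) with (INR n * eps) by (field; lra). nra.
Qed.

(** Needed for maps defined through a choice, such as [Tglobal] and [Tinverse], which agree with an
    explicit composite only near each point. *)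
Lemma vderiv_local m n (f g : Cn m -> Cn n) x L r : 0 < r ->
  (forall y, vnorm (vsub y x) < r -> f y = g y) -> vderiv f x L -> vderiv g x L.
Proof.
  intros Hr E [HL H]. split; [exact HL|]. intros eps He.
  destruct (H eps He) as [d [Hd Hh]]. pose proof (Rmin_l d r). pose proof (Rmin_r d r).
  exists (Rmin d r). split; [apply Rmin_pos; assumption|]. intros h Hs.
  rewrite <- !E.
  - apply Hh. lra.
  - replace (vsub x x) with (@vzero m) by vext. rewrite vnorm_zero. lra.
  - rewrite vsub_add. lra.
Qed.

Lemma vderiv_lipschitz m n (f : Cn m -> Cn n) x L : vderiv f x L ->
  exists K d, 0 < K /\ 0 < d /\ forall h, vnorm h < d -> vnorm (vsub (f (vadd x h)) (f x)) <= K * vnorm h.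
Proof.
  intros [HL H]. destruct (linear_bounded HL) as [K [HK HB]].
  destruct (H 1 Rlt_0_1) as [d [Hd Hh]].
  exists (1 + K), d. repeat split; [lra | exact Hd |]. intros h Hs.
  eapply Rle_trans; [apply (vnorm_tri_rev _ (L h))|].
  specialize (Hh h Hs). specialize (HB h). lra.
Qed.

Lemma vderiv_cont m n (f : Cn m -> Cn n) x L : vderiv f x L ->
  forall eps, 0 < eps -> exists d, 0 < d /\
    forall y, vnorm (vsub y x) < d -> vnorm (vsub (f y) (f x)) < eps.
Proof.
  intros H eps He. destruct (vderiv_lipschitz H) as [K [d [HK [Hd Hh]]]].
  exists (Rmin d (eps / K)). split; [apply Rmin_pos; [exact Hd | apply Rdiv_lt_0_compat; assumption]|].
  intros y Hy. pose proof (Rmin_l d (eps / K)). pose proof (Rmin_r d (eps / K)).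
  rewrite <- (vadd_sub x y) at 1.
  eapply Rle_lt_trans; [apply Hh; lra|].
  replace eps with (K * (eps / K)) by (field; lra). apply Rmult_lt_compat_l; lra.
Qed.

Lemma vderiv_comp m k n (f : Cn m -> Cn k) (g : Cn k -> Cn n) x L K :
  vderiv f x L -> vderiv g (f x) K -> vderiv (fun y => g (f y)) x (fun h => K (L h)).
Proof.
  intros Hf Hg. destruct (vderiv_lipschitz Hf) as [B [d0 [HB [Hd0 HBh]]]].
  destruct Hf as [HL Hf]. destruct Hg as [HK Hg].
  split; [apply linear_compose; assumption|]. intros eps He.
  destruct (linear_bounded HK) as [M [HM HMb]].
  destruct (Hf (eps / (2 * M))) as [d1 [Hd1 H1]]; [apply Rdiv_lt_0_compat; lra|].
  destruct (Hg (eps / (2 * B))) as [d2 [Hd2 H2]]; [apply Rdiv_lt_0_compat; lra|].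
  pose proof (Rmin_l d0 (Rmin d1 (d2 / B))). pose proof (Rmin_r d0 (Rmin d1 (d2 / B))).
  pose proof (Rmin_l d1 (d2 / B)). pose proof (Rmin_r d1 (d2 / B)).
  exists (Rmin d0 (Rmin d1 (d2 / B))). split.
  { repeat apply Rmin_pos; try assumption. apply Rdiv_lt_0_compat; assumption. }
  intros h Hs. specialize (HBh h ltac:(lra)). specialize (H1 h ltac:(lra)).
  set (q := vsub (f (vadd x h)) (f x)) in *.
  assert (Hq : vnorm q < d2).
  { eapply Rle_lt_trans; [exact HBh|]. replace d2 with (B * (d2 / B)) by (field; lra).
    apply Rmult_lt_compat_l; lra. }
  specialize (H2 q Hq). unfold q in H2 at 1. rewrite vadd_sub in H2.
  replace (vsub (vsub (g (f (vadd x h))) (g (f x))) (K (L h))) with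
    (vadd (vsub (vsub (g (f (vadd x h))) (g (f x))) (K q)) (K (vsub q (L h))))
    by (rewrite (linear_sub _ _ HK); vext).
  eapply Rle_trans; [apply vnorm_triangle|].
  specialize (HMb (vsub q (L h))).
  assert (A1 : eps / (2 * B) * vnorm q <= eps / 2 * vnorm h).
  { apply Rle_trans with (eps / (2 * B) * (B * vnorm h)).
    - apply Rmult_le_compat_l; [left; apply Rdiv_lt_0_compat; lra | exact HBh].
    - right. field. lra. }
  assert (A2 : M * vnorm (vsub q (L h)) <= eps / 2 * vnorm h).
  { apply Rle_trans with (M * (eps / (2 * M) * vnorm h)).
    - apply Rmult_le_compat_l; lra.
    - right. field. lra. }
  lra.
Qed.

Lemma vderiv_linear m n (L : Cn m -> Cn n) x : linear L -> vderiv L x L.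
Proof.
  intros HL. split; [exact HL|]. intros eps He. exists 1. split; [lra|]. intros h _.
  replace (vsub (vsub (L (vadd x h)) (L x)) (L h)) with (@vzero n)
    by (rewrite (proj1 HL); vext).
  rewrite vnorm_zero. pose proof (vnorm_ge_0 h). nra.
Qed.

Lemma vderiv_translate m (a x : Cn m) : vderiv (fun y => vsub y a) x (fun h => h).
Proof.
  split; [split; reflexivity|]. intros eps He. exists 1. split; [lra|]. intros h _.
  match goal with |- vnorm ?u <= _ => replace u with (@vzero m) by vext end.
  rewrite vnorm_zero. pose proof (vnorm_ge_0 h). nra.
Qed.

Lemma vderiv_translate_r m (a x : Cn m) : vderiv (fun y => vadd a y) x (fun h => h).
Proof.
  split; [split; reflexivity|]. intros eps He. exists 1. split; [lra|]. intros h _.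
  match goal with |- vnorm ?u <= _ => replace u with (@vzero m) by vext end.
  rewrite vnorm_zero. pose proof (vnorm_ge_0 h). nra.
Qed.

(** Restriction to a complex line, the passage by which the one-variable estimates reach several
    variables. *)
Lemma vderiv1_line m (f : Cn m -> C) x v (t : C) L :
  vderiv1 f (vadd x (vscal t v)) L -> Cderiv (fun s => f (vadd x (vscal s v))) t (L v).
Proof.
  intros [[_ HL] H] eps He. pose proof (vnorm_ge_0 v) as Hv.
  destruct (H (eps / (1 + vnorm v))) as [d [Hd Hh]]; [apply Rdiv_lt_0_compat; lra|].
  exists (d / (1 + vnorm v)). split; [apply Rdiv_lt_0_compat; lra|]. intros h Hs.
  pose proof (Cmod_ge_0 h) as Hh0.
  assert (Hsm : vnorm (vscal h v) < d).
  { rewrite vnorm_scal. apply Rle_lt_trans with (Cmod h * (1 + vnorm v)); [nra|].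
    replace d with (d / (1 + vnorm v) * (1 + vnorm v)) by (field; lra).
    apply Rmult_lt_compat_r; lra. }
  specialize (Hh _ Hsm). rewrite HL, vnorm_scal in Hh.
  replace (vadd (vadd x (vscal t v)) (vscal h v)) with (vadd x (vscal (Cplus t h) v)) in Hh by vext.
  rewrite (Cmult_comm (L v)). eapply Rle_trans; [exact Hh|].
  apply Rle_trans with (eps / (1 + vnorm v) * (Cmod h * (1 + vnorm v))).
  - apply Rmult_le_compat_l; [left; apply Rdiv_lt_0_compat; lra | nra].
  - right. field. lra.
Qed.

Lemma vTaylor m (f : Cn m -> C) x L r M : 0 < r ->
  (forall y, vnorm (vsub y x) <= 4 * r -> exists K, vderiv1 f y K) ->
  (forall y, vnorm (vsub y x) <= 4 * r -> Cmod (f y) <= M) ->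
  vderiv1 f x L ->
  forall h, vnorm h <= r ->
    Cmod (Cminus (Cminus (f (vadd x h)) (f x)) (L h)) <= 16 * M / (r * r) * (vnorm h * vnorm h).
Proof.
  intros Hr Hd HM HL h Hh.
  assert (HM0 : 0 <= M).
  { eapply Rle_trans; [apply Cmod_ge_0 | apply (HM x)].
    replace (vsub x x) with (@vzero m) by vext. rewrite vnorm_zero. lra. }
  destruct (Rle_lt_dec (vnorm h) 0) as [H0|H0].
  - rewrite (vnorm_eq_0 _ H0), vadd_zero.
    assert (E : L vzero = RtoC 0).
    { replace (@vzero m) with (vscal 0 (@vzero m)) by vext. rewrite (proj2 (proj1 HL)). ring. }
    rewrite E. replace (Cminus (Cminus (f x) (f x)) 0) with (RtoC 0) by ring.
    rewrite Cmod_0, vnorm_zero. lra.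
  - set (g := fun s => f (vadd x (vscal s h))).
    (* The line s -> x + s h sends the disc of radius 4 r' into the ball of radius 4 r, and s = 1
       lies in the disc of radius r'. *)
    set (r' := r / vnorm h).
    assert (Hr' : 0 < r') by (apply Rdiv_lt_0_compat; assumption).
    assert (Hloc : forall s, Cmod s <= 4 * r' -> vnorm (vsub (vadd x (vscal s h)) x) <= 4 * r).
    { intros s Hs. rewrite vsub_add, vnorm_scal.
      replace (4 * r) with (4 * r' * vnorm h) by (unfold r'; field; lra).
      apply Rmult_le_compat_r; lra. }
    assert (Q := Taylor_estimate (f := g) (l := L h) (r := r') (M := M) Hr').
    replace (vadd x h) with (vadd x (vscal 1 h)) by vext.
    assert (E0 : vadd x (vscal 0 h) = x) by vext.
    change (f (vadd x (vscal 1 h))) with (g 1).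
    replace (f x) with (g 0) by (unfold g; rewrite E0; reflexivity).
    replace (L h) with (Cmult (L h) 1) by ring.
    replace (16 * M / (r * r) * (vnorm h * vnorm h)) with (16 * M / (r' * r') * (Cmod 1 * Cmod 1)).
    + apply Q.
      * intros z Hz. destruct (Hd _ (Hloc z Hz)) as [K HK]. exists (K h).
        apply vderiv1_line. exact HK.
      * intros z Hz. apply HM, Hloc, Hz.
      * apply vderiv1_line. rewrite E0. exact HL.
      * rewrite Cmod_1. apply Rmult_le_reg_r with (vnorm h); [exact H0|].
        unfold r'. replace (r / vnorm h * vnorm h) with r by (field; lra). lra.
    + rewrite Cmod_1. unfold r'. field. lra.
Qed.

(** Here [M] bounds |f| itself, so the oscillation required by [Cauchy_inequality] is at most 2M. *)
Lemma vCauchy m (f : Cn m -> C) x L r M : 0 < r ->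
  (forall y, vnorm (vsub y x) <= r -> exists K, vderiv1 f y K) ->
  (forall y, vnorm (vsub y x) <= r -> Cmod (f y) <= M) ->
  vderiv1 f x L ->
  forall h, Cmod (L h) <= 2 * M / r * vnorm h.
Proof.
  intros Hr Hd HM HL h.
  assert (E0 : vadd x (vscal 0 h) = x) by vext.
  destruct (Rle_lt_dec (vnorm h) 0) as [H0|H0].
  - rewrite (vnorm_eq_0 _ H0).
    assert (E : L vzero = RtoC 0).
    { replace (@vzero m) with (vscal 0 (@vzero m)) by vext. rewrite (proj2 (proj1 HL)). ring. }
    rewrite E, Cmod_0, vnorm_zero. lra.
  - set (r' := r / vnorm h).
    assert (Hr' : 0 < r') by (apply Rdiv_lt_0_compat; assumption).
    assert (Hloc : forall s, Cmod s <= r' -> vnorm (vsub (vadd x (vscal s h)) x) <= r).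
    { intros s Hs. rewrite vsub_add, vnorm_scal.
      replace r with (r' * vnorm h) by (unfold r'; field; lra).
      apply Rmult_le_compat_r; lra. }
    replace (2 * M / r * vnorm h) with (2 * M / r') by (unfold r'; field; lra).
    assert (Z : forall z, Cminus z 0 = z) by (intros; ring).
    apply (Cauchy_inequality (f := fun s => f (vadd x (vscal s h))) (a := 0)); [exact Hr' | | |].
    + intros z Hz. rewrite Z in Hz. destruct (Hd _ (Hloc z Hz)) as [K HK]. exists (K h).
      apply vderiv1_line. exact HK.
    + intros z Hz. rewrite Z in Hz. eapply Rle_trans; [apply Cmod_tri_minus|].
      pose proof (HM _ (Hloc z Hz)). pose proof (HM _ (Hloc 0 ltac:(rewrite Cmod_0; lra))). lra.
    + apply vderiv1_line. rewrite E0. exact HL.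
Qed.

Lemma vmean_value m (f : Cn m -> C) x y D :
  (forall t : R, 0 <= t <= 1 -> exists L, vderiv1 f (vadd x (vscal t (vsub y x))) L /\
     Cmod (L (vsub y x)) <= D) ->
  Cmod (Cminus (f y) (f x)) <= 2 * D.
Proof.
  intros H. set (g := fun s => f (vadd x (vscal s (vsub y x)))).
  replace (f y) with (g 1).
  - replace (f x) with (g 0).
    + replace (2 * D) with (2 * D * Cmod (Cminus 1 0)).
      * apply Cmean_value. intros t Ht. destruct (H t Ht) as [L [HL HD]].
        exists (L (vsub y x)). split; [|exact HD].
        replace (Cplus 0 (Cmult t (Cminus 1 0))) with (RtoC t) by ring.
        apply vderiv1_line. exact HL.
      * replace (Cminus 1 0) with (RtoC 1) by ring. rewrite Cmod_1. ring.
    + unfold g. f_equal. vext.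
  - unfold g. f_equal. vext.
Qed.

(** * The holomorphic inverse function theorem *)

Lemma le_of_geometric (x a B : R) : (forall k, x <= a + B / 2 ^ k) -> x <= a.
Proof.
  intros H. apply le_epsilon. intros eps He.
  destruct (Rle_lt_dec B 0) as [HB|HB].
  - specialize (H O). simpl in H. lra.
  - destruct (pow_lt_1_zero (/ 2)) with (y := eps / B) as [N HN];
      [rewrite Rabs_pos_eq; lra | apply Rdiv_lt_0_compat; lra |].
    specialize (HN N (le_n N)). rewrite Rabs_pos_eq in HN by (apply pow_le; lra).
    rewrite pow_inv in HN. specialize (H N).
    assert (B / 2 ^ N <= eps).
    { replace eps with (B * (eps / B)) by (field; lra). unfold Rdiv at 1.
      apply Rmult_le_compat_l; lra. }
    lra.
Qed.

Lemma half_pow_S c k : c / 2 ^ S k = c / 2 ^ k / 2.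
Proof. simpl. field. apply pow_nonzero. lra. Qed.

(** The tail of the steps after index k is at most 2c / 2^k, so the intervals of that radius about x
    k are nested. *)
Lemma geometric_limit_R (x : nat -> R) c : 0 <= c ->
  (forall k, Rabs (x (S k) - x k) <= c / 2 ^ k) ->
  exists l, forall k, Rabs (l - x k) <= 2 * c / 2 ^ k.
Proof.
  intros Hc H.
  destruct (@nested_intervals (fun m => x m - 2 * c / 2 ^ m) (4 * c)) as [l Hl]; [lra| |].
  - intros m. specialize (H m). apply Rabs_le_between in H.
    rewrite !half_pow_S.
    replace (2 * c / 2 ^ m) with (2 * (c / 2 ^ m)) by (field; apply pow_nonzero; lra).
    replace (4 * c / 2 ^ m) with (4 * (c / 2 ^ m)) by (field; apply pow_nonzero; lra). lra.
  - exists l. intros k. specialize (Hl k). simpl in Hl. apply Rabs_le_between.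
    replace (4 * c / 2 ^ k) with (2 * (2 * c / 2 ^ k)) in Hl by (field; apply pow_nonzero; lra). lra.
Qed.

Lemma geometric_limit n (u : nat -> Cn n) c : 0 <= c ->
  (forall k, vnorm (vsub (u (S k)) (u k)) <= c / 2 ^ k) ->
  exists l, forall k, vnorm (vsub l (u k)) <= INR n * (4 * c) / 2 ^ k.
Proof.
  intros Hc H.
  destruct (fun_choice (fun (i : Fin.t n) (z : C) =>
    forall k, Cmod (Cminus z (u k i)) <= 4 * c / 2 ^ k)) as [l Hl].
  - intros i.
    assert (Hi : forall k, Cmod (Cminus (u (S k) i) (u k i)) <= c / 2 ^ k).
    { intros k. eapply Rle_trans; [apply (vnorm_comp (vsub (u (S k)) (u k)) i) | apply H]. }
    destruct (@geometric_limit_R (fun k => fst (u k i)) c Hc) as [a Ha].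
    { intros k. eapply Rle_trans; [|apply (Hi k)]. eapply Rle_trans; [|apply Cabs_fst_le].
      right; reflexivity. }
    destruct (@geometric_limit_R (fun k => snd (u k i)) c Hc) as [b Hb].
    { intros k. eapply Rle_trans; [|apply (Hi k)]. eapply Rle_trans; [|apply Cabs_snd_le].
      right; reflexivity. }
    exists (a, b). intros k. eapply Rle_trans; [apply Cmod_le_abs|].
    specialize (Ha k). specialize (Hb k).
    unfold Cminus, Cplus, Copp; simpl. unfold Rminus in *.
    replace (4 * c / 2 ^ k) with (2 * c / 2 ^ k + 2 * c / 2 ^ k)
      by (field; apply pow_nonzero; lra). lra.
  - exists l. intros k.
    replace (INR n * (4 * c) / 2 ^ k) with (INR n * (4 * c / 2 ^ k))
      by (field; apply pow_nonzero; lra).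
    apply vnorm_le_const. intros i. apply Hl.
Qed.

(** Banach iteration of u -> y - N u from 0. Since N halves norms, the ball of radius 2 |y| is
    preserved and the steps shrink like |y| / 2^k. *)
Lemma contraction_solve n (N : Cn n -> Cn n) (y : Cn n) (rho : R) : 2 * vnorm y <= rho ->
  (forall u v, vnorm u <= rho -> vnorm v <= rho ->
     vnorm (vsub (N u) (N v)) <= / 2 * vnorm (vsub u v)) ->
  N vzero = vzero ->
  exists u, vnorm u <= 2 * vnorm y /\ vadd u (N u) = y.
Proof.
  intros Hy HN H0. pose proof (vnorm_ge_0 y) as Hy0.
  set (u := fix u (k : nat) : Cn n := match k with O => vzero | S k => vsub y (N (u k)) end).
  assert (HNb : forall v, vnorm v <= rho -> vnorm (N v) <= / 2 * vnorm v).
  { intros v Hv. specialize (HN v vzero Hv). rewrite H0, !vsub_zero, vnorm_zero in HN.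
    apply HN. lra. }
  assert (Hu : forall k, vnorm (u k) <= 2 * vnorm y).
  { induction k as [|k IH]; simpl; [rewrite vnorm_zero; lra|].
    eapply Rle_trans; [apply vnorm_tri_sub|]. specialize (HNb (u k) ltac:(lra)). lra. }
  assert (Hd : forall k, vnorm (vsub (u (S k)) (u k)) <= vnorm y / 2 ^ k).
  { induction k as [|k IH].
    - simpl. rewrite H0, !vsub_zero. lra.
    - change (u (S (S k))) with (vsub y (N (u (S k)))).
      change (u (S k)) with (vsub y (N (u k))) at 2.
      replace (vsub (vsub y (N (u (S k)))) (vsub y (N (u k)))) with (vsub (N (u k)) (N (u (S k)))) by vext.
      rewrite half_pow_S. rewrite vnorm_sub_sym.
      eapply Rle_trans; [apply HN; (eapply Rle_trans; [apply Hu | lra])|]. lra. }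
  destruct (geometric_limit u Hy0 Hd) as [l Hl].
  set (B := INR n * (4 * vnorm y)) in *.
  assert (Hl2 : vnorm l <= 2 * vnorm y).
  { apply le_of_geometric with B. intros k. pose proof (vnorm_tri_rev l (u k)).
    specialize (Hl k). specialize (Hu k). lra. }
  exists l. split; [exact Hl2|].
  assert (E : vnorm (vsub (vadd l (N l)) y) <= 0).
  { apply le_of_geometric with B. intros k.
    replace (vsub (vadd l (N l)) y) with (vadd (vsub l (u (S k))) (vsub (N l) (N (u k))))
      by (change (u (S k)) with (vsub y (N (u k))); vext).
    eapply Rle_trans; [apply vnorm_triangle|].
    assert (Q : vnorm (vsub (N l) (N (u k))) <= / 2 * vnorm (vsub l (u k))).
    { apply HN; [lra|]. specialize (Hu k). lra. }
    pose proof (Hl k) as A1. pose proof (Hl (S k)) as A2. rewrite half_pow_S in A2. lra. }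
  apply vnorm_eq_0 in E.
  apply functional_extensionality. intros i.
  pose proof (f_equal (fun w => w i) E) as Ei. unfold vsub, vzero in Ei.
  apply Ceq_minus. exact Ei.
Qed.

Definition vdifferentiable {m n} (f : Cn m -> Cn n) (x : Cn m) : Prop := exists L, vderiv f x L.

(** The substitute for continuity of the derivative: Taylor gives |N u| <= K |u|^2 coordinatewise
    near 0, and Cauchy on the ball of radius rho about u turns this into a derivative bound of order
    K rho, small with rho. *)
Lemma near_identity n (N : Cn n -> Cn n) (R M : R) : 0 < R ->
  (forall u, vnorm u < R -> vdifferentiable N u) ->
  (forall u i, vnorm u < R -> Cmod (N u i) <= M) ->
  N vzero = vzero -> vderiv N vzero (fun _ => vzero) ->
  exists rho, 0 < rho < R /\
    (forall u v, vnorm u <= rho -> vnorm v <= rho ->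
      vnorm (vsub (N u) (N v)) <= / 2 * vnorm (vsub u v)) /\
    (forall u L, vnorm u <= rho -> vderiv N u L -> forall h, vnorm (L h) <= / 2 * vnorm h).
Proof.
  intros HR Hd HM H0 HD.
  pose proof (pos_INR n) as Hn.
  set (r := R / 8).
  (* For n = 0 the bound on coordinates is vacuous and [M] could be negative; the maximum keeps K >=
     0. *)
  set (K := 16 * (Rmax 0 M) / (r * r)).
  assert (Hr : 0 < r) by (unfold r; lra).
  pose proof (Rmax_l 0 M) as HM0. pose proof (Rmax_r 0 M) as HM1.
  assert (HK : 0 <= K) by (apply Rdiv_le_0_compat; nra).
  assert (Quad : forall u i, vnorm u <= r -> Cmod (N u i) <= K * (vnorm u * vnorm u)).
  { intros u i Hu.
    assert (Q := @vTaylor n (fun y => N y i) vzero (fun _ => RtoC 0) r (Rmax 0 M) Hr).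
    cbv beta in Q. rewrite H0 in Q.
    assert (E : forall h, Cminus (Cminus (N (vadd vzero h) i) (vzero i)) 0 = N h i).
    { intros h. replace (vadd vzero h) with h by vext. unfold vzero. ring. }
    rewrite <- (E u). apply Q; [| | |exact Hu].
    - intros y Hy. rewrite vsub_zero in Hy. destruct (Hd y) as [L HL]; [unfold r in Hy; lra|].
      exists (fun h => L h i). apply vderiv_coord. exact HL.
    - intros y Hy. rewrite vsub_zero in Hy. eapply Rle_trans; [apply HM; unfold r in Hy; lra | exact HM1].
    - apply (vderiv_coord i HD). }
  (* Chosen so that n * 16 K rho <= 1/2: n coordinates, a derivative bound 8 K rho, and the factor 2
     of the mean value estimate. *)
  set (c := / (32 * (INR n + 1) * (K + 1))).
  assert (Hden : 0 < 32 * (INR n + 1) * (K + 1)) by nra.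
  assert (Hc : 0 < c) by (apply Rinv_0_lt_compat; exact Hden).
  set (rho := Rmin (r / 2) c).
  assert (Hrho : 0 < rho) by (apply Rmin_pos; lra).
  assert (Hrr : rho <= r / 2) by apply Rmin_l.
  assert (Hrc : rho <= c) by apply Rmin_r.
  assert (Hsmall : INR n * (16 * K * rho) <= / 2).
  { apply Rle_trans with (INR n * (16 * K * c)).
    - apply Rmult_le_compat_l; [exact Hn|]. apply Rmult_le_compat_l; lra.
    - apply Rmult_le_reg_r with (32 * (INR n + 1) * (K + 1)); [exact Hden|].
      replace (INR n * (16 * K * c) * (32 * (INR n + 1) * (K + 1))) with (INR n * (16 * K))
        by (unfold c; field; split; lra). nra. }
  assert (DB : forall u L i h, vnorm u <= rho -> vderiv N u L -> Cmod (L h i) <= 8 * K * rho * vnorm h).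
  { intros u L i h Hu HL.
    replace (8 * K * rho) with (2 * (4 * K * (rho * rho)) / rho) by (field; lra).
    apply (@vCauchy n (fun y => N y i) u (fun h => L h i) rho); [exact Hrho | | |].
    - intros y Hy. pose proof (vnorm_tri_rev y u).
      destruct (Hd y) as [L' HL']; [unfold r in Hrr; lra|].
      exists (fun h => L' h i). apply vderiv_coord. exact HL'.
    - intros y Hy. pose proof (vnorm_tri_rev y u). pose proof (vnorm_ge_0 y).
      eapply Rle_trans; [apply Quad; lra|].
      replace (4 * K * (rho * rho)) with (K * ((2 * rho) * (2 * rho))) by ring.
      apply Rmult_le_compat_l; [exact HK|]. apply Rmult_le_compat; lra.
    - apply (vderiv_coord i HL). }
  exists rho. split; [unfold r in Hrr; lra|]. split.
  - intros u v Hu Hv. pose proof (vnorm_ge_0 (vsub u v)) as Huv.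
    apply Rle_trans with (INR n * (2 * (8 * K * rho * vnorm (vsub u v)))).
    + apply vnorm_le_const. intros i. unfold vsub at 1.
      apply (@vmean_value n (fun y => N y i)). intros t Ht.
      assert (Hw : vnorm (vadd v (vscal t (vsub u v))) <= rho).
      { replace (vadd v (vscal t (vsub u v))) with (vadd (vscal (1 - t)%R v) (vscal t u))
          by (rewrite RtoC_minus; vext).
        eapply Rle_trans; [apply vnorm_triangle|]. rewrite !vnorm_scal, !Cmod_R, !Rabs_pos_eq by lra.
        pose proof (Rmult_le_compat_l (1 - t) _ _ ltac:(lra) Hv).
        pose proof (Rmult_le_compat_l t _ _ ltac:(lra) Hu). lra. }
      destruct (Hd (vadd v (vscal t (vsub u v)))) as [L HL]; [unfold r in Hrr; lra|].
      exists (fun h => L h i). split; [apply (vderiv_coord i HL)|]. apply (DB _ _ _ _ Hw HL).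
    + replace (INR n * (2 * (8 * K * rho * vnorm (vsub u v))))
        with (INR n * (16 * K * rho) * vnorm (vsub u v)) by ring.
      apply Rmult_le_compat_r; assumption.
  - intros u L Hu HL h. pose proof (vnorm_ge_0 h).
    eapply Rle_trans; [apply vnorm_le_const; intros i; apply (DB u L i h Hu HL)|].
    apply Rle_trans with (INR n * (16 * K * rho) * vnorm h).
    + replace (INR n * (8 * K * rho * vnorm h)) with (INR n * (16 * K * rho) * vnorm h / 2) by field.
      assert (0 <= INR n * (16 * K * rho) * vnorm h) by (apply Rmult_le_pos; [apply Rmult_le_pos; [lra|]; apply Rmult_le_pos; lra | lra]). lra.
    + apply Rmult_le_compat_r; assumption.
Qed.

Lemma vderiv_minus_id n (T : Cn n -> Cn n) x L :
  vderiv T x L -> vderiv (fun u => vsub (T u) u) x (fun h => vsub (L h) h).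
Proof.
  intros [[H1 H2] H]. split.
  - split; intros; [rewrite H1 | rewrite H2]; vext.
  - intros eps He. destruct (H eps He) as [d [Hd Hh]]. exists d; split; [exact Hd|].
    intros h Hs. specialize (Hh h Hs).
    replace (vsub (vsub (vsub (T (vadd x h)) (vadd x h)) (vsub (T x) x)) (vsub (L h) h))
      with (vsub (vsub (T (vadd x h)) (T x)) (L h)) by vext. exact Hh.
Qed.

(** With T = id + N and N a half-contraction, T expands distances by at least 1/2. This gives
    injectivity and makes the inverse Lipschitz, which is what its differentiability rests on. *)
Theorem inverse_function n (T : Cn n -> Cn n) (R M : R) : 0 < R ->
  (forall u, vnorm u < R -> vdifferentiable T u) ->
  (forall u i, vnorm u < R -> Cmod (T u i) <= M) ->
  T vzero = vzero -> vderiv T vzero (fun h => h) ->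
  exists rho (S : Cn n -> Cn n), 0 < rho < R /\
    (forall u v, vnorm u < rho -> vnorm v < rho -> T u = T v -> u = v) /\
    (forall y, vnorm y < rho / 2 -> vnorm (S y) < rho /\ T (S y) = y /\ vdifferentiable S y).
Proof.
  intros HR Hd HM H0 HD.
  set (N := fun u => vsub (T u) u).
  destruct (@near_identity n N R (M + R)) as [rho [Hrho [Hlip HL]]].
  - exact HR.
  - intros u Hu. destruct (Hd u Hu) as [L Hu']. eexists. apply vderiv_minus_id. exact Hu'.
  - intros u i Hu. eapply Rle_trans; [apply Cmod_tri_minus|].
    apply Rplus_le_compat; [apply HM, Hu|]. pose proof (vnorm_comp u i). lra.
  - unfold N. rewrite H0. vext.
  - replace (fun _ : Cn n => @vzero n) with (fun h : Cn n => vsub h h)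
      by (apply functional_extensionality; intros h; vext).
    apply (vderiv_minus_id HD).
  - assert (N0 : N vzero = vzero) by (unfold N; rewrite H0; vext).
    assert (Hexp : forall u v, vnorm u <= rho -> vnorm v <= rho ->
       vnorm (vsub u v) <= 2 * vnorm (vsub (T u) (T v))).
    { intros u v Hu Hv. pose proof (Hlip u v Hu Hv) as Q.
      replace (vsub (N u) (N v)) with (vsub (vsub (T u) (T v)) (vsub u v)) in Q by (unfold N; vext).
      pose proof (vnorm_tri_rev (vsub u v) (vsub (T u) (T v))) as Q'.
      rewrite vnorm_sub_sym in Q. lra. }
    destruct (fun_choice (fun y u => vnorm y < rho / 2 -> vnorm u <= 2 * vnorm y /\ T u = y)) as [S HS].
    { intros y. destruct (Rlt_le_dec (vnorm y) (rho / 2)) as [Hy|Hy].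
      - destruct (@contraction_solve n N y rho ltac:(lra) Hlip N0) as [u [Hu1 Hu2]].
        exists u. intros _. split; [exact Hu1|]. rewrite <- Hu2. unfold N. vext.
      - exists vzero. intros. lra. }
    exists rho, S. split; [exact Hrho|]. split.
    + intros u v Hu Hv E. pose proof (Hexp u v ltac:(lra) ltac:(lra)) as Q.
      rewrite E in Q. replace (vsub (T v) (T v)) with (@vzero n) in Q by vext.
      rewrite vnorm_zero in Q. assert (Q0 : vnorm (vsub u v) <= 0) by lra. apply vnorm_eq_0 in Q0.
      apply functional_extensionality. intros i. apply Ceq_minus.
      exact (f_equal (fun w => w i) Q0).
    + intros y0 Hy0. destruct (HS y0 Hy0) as [Hu0 Tu0].
      split; [lra|]. split; [exact Tu0|].
      set (u0 := S y0) in *.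
      destruct (Hd u0 ltac:(lra)) as [L HLd].
      assert (Hclose : forall h, vnorm (vsub (L h) h) <= / 2 * vnorm h).
      { apply (HL u0 _ ltac:(lra) (vderiv_minus_id HLd)). }
      destruct HLd as [Llin Lest].
      assert (Linj : forall h, L h = vzero -> h = vzero).
      { intros h E. specialize (Hclose h). rewrite E in Hclose.
        rewrite vnorm_sub_sym, vsub_zero in Hclose. apply vnorm_eq_0. pose proof (vnorm_ge_0 h). lra. }
      assert (Linj2 : forall g h, L g = L h -> g = h).
      { intros g h E. assert (Z : vsub g h = vzero).
        { apply Linj. rewrite (linear_sub _ _ Llin), E. vext. }
        apply functional_extensionality. intros i. apply Ceq_minus. exact (f_equal (fun w => w i) Z). }
      (* [L] is within 1/2 of the identity, so [contraction_solve] inverts it as well. *)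
      destruct (fun_choice (fun y h => vnorm h <= 2 * vnorm y /\ L h = y)) as [Li HLi].
      { intros y. destruct (@contraction_solve n (fun h => vsub (L h) h) y (2 * vnorm y)) as [h [Hh1 Hh2]].
        - lra.
        - intros g h _ _. replace (vsub (vsub (L g) g) (vsub (L h) h)) with
            (vsub (L (vsub g h)) (vsub g h)) by (rewrite (linear_sub _ _ Llin); vext).
          apply Hclose.
        - rewrite (linear_zero Llin). vext.
        - exists h. split; [exact Hh1|]. rewrite <- Hh2. vext. }
      exists Li. split.
      { split; intros; apply Linj2.
        - rewrite (proj1 Llin), !(fun y => proj2 (HLi y)). reflexivity.
        - rewrite (proj2 Llin), !(fun y => proj2 (HLi y)). reflexivity. }
      (* One factor 2 is lost to the inverse [Li] of L, another to |u - u0| <= 2 |h|. *)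
      intros eps He. destruct (Lest (eps / 4) ltac:(lra)) as [d [Hdp Hh]].
      exists (Rmin (d / 2) (rho / 2 - vnorm y0)). split; [apply Rmin_pos; lra|].
      intros h Hs. pose proof (Rmin_l (d / 2) (rho / 2 - vnorm y0)).
      pose proof (Rmin_r (d / 2) (rho / 2 - vnorm y0)).
      pose proof (vnorm_triangle y0 h) as Htri.
      destruct (HS (vadd y0 h) ltac:(lra)) as [Hu Tu].
      set (u := S (vadd y0 h)) in *.
      pose proof (Hexp u u0 ltac:(lra) ltac:(lra)) as Hq.
      rewrite Tu, Tu0, vsub_add in Hq.
      specialize (Hh (vsub u u0) ltac:(lra)). rewrite vadd_sub, Tu, Tu0, vsub_add in Hh.
      assert (E : vsub (vsub u u0) (Li h) = Li (vsub (L (vsub u u0)) h)).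
      { apply Linj2. rewrite (linear_sub _ _ Llin), !(fun y => proj2 (HLi y)). reflexivity. }
      fold u0. rewrite E. eapply Rle_trans; [apply (proj1 (HLi _))|]. rewrite vnorm_sub_sym.
      pose proof (Rmult_le_compat_l (eps / 4) _ _ ltac:(lra) Hq). lra.
Qed.

(** * Holomorphic dependence on a parameter under the integral sign *)

(** The Taylor constant depends only on M and r, so the quadratic remainder is uniform in t and can
    be integrated directly. *)
Lemma vderiv1_integral n (F : R -> Cn n -> C) (L : R -> Cn n -> C) x r M a b :
  a <= b -> 0 < r ->
  (forall t y, vnorm (vsub y x) <= 4 * r -> exists K, vderiv1 (F t) y K) ->
  (forall t y, vnorm (vsub y x) <= 4 * r -> Cmod (F t y) <= M) ->
  (forall t y, vnorm (vsub y x) <= 4 * r -> rcont (fun s => F s y) t) ->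
  (forall t, vderiv1 (F t) x (L t)) ->
  vderiv1 (fun y => Cint (fun t => F t y) a b) x (fun h => Cint (fun t => L t h) a b) /\
  forall h, CI (fun t => L t h) a b (Cint (fun t => L t h) a b).
Proof.
  intros Hab Hr Hd HM Hc HL.
  assert (Hxx : vnorm (vsub x x) <= 4 * r).
  { replace (vsub x x) with (@vzero n) by vext. rewrite vnorm_zero. lra. }
  assert (HM0 : 0 <= M) by (eapply Rle_trans; [apply Cmod_ge_0 | apply (HM a x Hxx)]).
  set (K := 16 * M / (r * r)).
  assert (HK : 0 <= K) by (apply Rdiv_le_0_compat; nra).
  assert (Tay : forall t h, vnorm h <= r ->
     Cmod (Cminus (Cminus (F t (vadd x h)) (F t x)) (L t h)) <= K * (vnorm h * vnorm h)).
  { intros t. apply vTaylor; [exact Hr | apply Hd | apply HM | apply HL]. }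
  (* By [Tay], [L] is a uniform limit of difference quotients, hence continuous in [t]. *)
  assert (Lc : forall h t, rcont (fun s => L s h) t).
  { intros h t eps He. pose proof (vnorm_ge_0 h) as Hh.
    (* The step of the difference quotient: the first bound keeps s h where [Tay] applies, the
       second makes the two Taylor errors, divided by s, at most eps / 2. Continuity of F in t pays
       the other half. *)
    set (s := Rmin (r / (1 + vnorm h)) (eps / (4 * (1 + K * (vnorm h * vnorm h))))).
    assert (HKh : 0 <= K * (vnorm h * vnorm h)) by (apply Rmult_le_pos; [exact HK | apply Rmult_le_pos; assumption]).
    assert (Hs : 0 < s) by (apply Rmin_pos; apply Rdiv_lt_0_compat; lra).
    assert (Hs1 : s * vnorm h <= r).
    { apply Rle_trans with (r / (1 + vnorm h) * (1 + vnorm h)).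
      - apply Rmult_le_compat; try lra. apply Rmin_l.
      - right. field. lra. }
    assert (Hs2 : 2 * K * s * (vnorm h * vnorm h) <= eps / 2).
    { apply Rle_trans with (2 * (s * (1 + K * (vnorm h * vnorm h)))); [nra|].
      apply Rle_trans with (2 * (eps / (4 * (1 + K * (vnorm h * vnorm h))) * (1 + K * (vnorm h * vnorm h)))).
      - apply Rmult_le_compat_l; [lra|]. apply Rmult_le_compat_r; [lra | apply Rmin_r].
      - right. field. lra. }
    assert (Hsh : vnorm (vscal s h) = s * vnorm h).
    { rewrite vnorm_scal, Cmod_R, Rabs_pos_eq; lra. }
    set (q := fun t' => Cminus (F t' (vadd x (vscal s h))) (F t' x)).
    assert (Hes : 0 < eps * s / 4) by (apply Rdiv_lt_0_compat; [apply Rmult_lt_0_compat; assumption | lra]).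
    destruct (Hc t (vadd x (vscal s h)) ltac:(rewrite vsub_add; lra) _ Hes) as [d1 [Hd1 H1]].
    destruct (Hc t x Hxx _ Hes) as [d2 [Hd2 H2]].
    exists (Rmin d1 d2). split; [apply Rmin_pos; assumption|].
    intros t' Ht'. pose proof (Rmin_l d1 d2). pose proof (Rmin_r d1 d2).
    specialize (H1 t' ltac:(lra)). specialize (H2 t' ltac:(lra)).
    assert (E : forall t', Cmod (Cminus (q t') (Cmult s (L t' h))) <= K * s * (s * (vnorm h * vnorm h))).
    { intros t1. rewrite <- (proj2 (proj1 (HL t1))).
      eapply Rle_trans; [apply Tay; lra|]. rewrite Hsh. right. ring. }
    pose proof (E t) as E1. pose proof (E t') as E2.
    apply Rmult_lt_reg_l with s; [exact Hs|].
    replace (s * Cmod (Cminus (L t' h) (L t h))) with (Cmod (Cmult s (Cminus (L t' h) (L t h))))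
      by (rewrite Cmod_mult, Cmod_R, Rabs_pos_eq; lra).
    replace (Cmult s (Cminus (L t' h) (L t h))) with
      (Cminus (Cplus (Cminus (Cminus (F t' (vadd x (vscal s h))) (F t (vadd x (vscal s h))))
                     (Cminus (F t' x) (F t x))) (Cminus (q t) (Cmult s (L t h))))
              (Cminus (q t') (Cmult s (L t' h)))) by (unfold q; ring).
    eapply Rle_lt_trans; [apply Cmod_tri_minus|].
    eapply Rle_lt_trans; [apply Rplus_le_compat_r, Cmod_triangle|].
    pose proof (Cmod_tri_minus (Cminus (F t' (vadd x (vscal s h))) (F t (vadd x (vscal s h))))
                     (Cminus (F t' x) (F t x))).
    assert (2 * (K * s * (s * (vnorm h * vnorm h))) <= s * (eps / 2)).
    { replace (2 * (K * s * (s * (vnorm h * vnorm h)))) with (s * (2 * K * s * (vnorm h * vnorm h))) by ring.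
      apply Rmult_le_compat_l; lra. }
    lra. }
  assert (HI : forall h, CI (fun t => L t h) a b (Cint (fun t => L t h) a b)).
  { intros h. apply CI_Cint_cont; [exact Hab|]. intros t _. apply Lc. }
  split; [|exact HI]. split.
  - split.
    + intros u v. apply CI_Cint. apply (CI_ext_all (f := fun t => Cplus (L t u) (L t v))).
      * intros t. symmetry. apply (proj1 (proj1 (HL t))).
      * apply CI_plus; apply HI.
    + intros c v. apply CI_Cint. apply (CI_ext_all (f := fun t => Cmult c (L t v))).
      * intros t. symmetry. apply (proj2 (proj1 (HL t))).
      * apply CI_mult. apply HI.
  - intros eps He.
    set (B := (b - a) * K).
    assert (HB : 0 <= B) by (apply Rmult_le_pos; lra).
    exists (Rmin r (eps / (1 + B))). split; [apply Rmin_pos; [exact Hr | apply Rdiv_lt_0_compat; lra]|].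
    intros h Hs. pose proof (Rmin_l r (eps / (1 + B))). pose proof (Rmin_r r (eps / (1 + B))).
    pose proof (vnorm_ge_0 h) as Hh.
    assert (HF : forall y, vnorm (vsub y x) <= 4 * r -> CI (fun t => F t y) a b (Cint (fun t => F t y) a b)).
    { intros y Hy. apply CI_Cint_cont; [exact Hab|]. intros t _. apply Hc, Hy. }
    apply Rle_trans with ((b - a) * (K * (vnorm h * vnorm h))).
    + eapply CI_norm; [exact Hab | | apply CI_minus; [apply CI_minus|]].
      2: apply (HF (vadd x h)); rewrite vsub_add; lra.
      2: apply (HF x Hxx).
      2: apply HI.
      intros t _. apply Tay. lra.
    + replace ((b - a) * (K * (vnorm h * vnorm h))) with (B * vnorm h * vnorm h) by (unfold B; ring).
      apply Rmult_le_compat_r; [exact Hh|].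
      apply Rle_trans with ((1 + B) * (eps / (1 + B))); [|right; field; lra].
      apply Rmult_le_compat; lra.
Qed.

(** * Linearization of a local flow by averaging *)

Lemma cexp_int_inv (k : nat) w : Cmult (cexp (Cmult (RtoC (- INR k)) w)) (cexp (Cmult (INR k) w)) = RtoC 1.
Proof. rewrite <- cexp_plus, <- cexp_0. f_equal. rewrite RtoC_opp. ring. Qed.

Lemma cexp_nat_period (k : nat) w :
  cexp (Cmult (INR k) (Cplus w (0, 2 * PI))) = cexp (Cmult (INR k) w).
Proof. rewrite !cexp_nat, cexp_period. reflexivity. Qed.

Lemma cexp_opp_nat_period (k : nat) w :
  cexp (Cmult (RtoC (- INR k)) (Cplus w (0, 2 * PI))) = cexp (Cmult (RtoC (- INR k)) w).
Proof.
  assert (E : forall u, cexp (Cmult (RtoC (- INR k)) u) = Cinv (cexp (Cmult (INR k) u))).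
  { intros u. rewrite <- cexp_opp. f_equal. rewrite RtoC_opp. ring. }
  rewrite !E, cexp_nat_period. reflexivity.
Qed.

Lemma vderiv1_scal n (f : Cn n -> C) x L c :
  vderiv1 f x L -> vderiv1 (fun y => Cmult c (f y)) x (fun h => Cmult c (L h)).
Proof.
  intros [[H1 H2] H]. split.
  - split; intros; [rewrite H1 | rewrite H2]; ring.
  - intros eps He. pose proof (Cmod_ge_0 c).
    destruct (H (eps / (1 + Cmod c))) as [d [Hd Hh]]; [apply Rdiv_lt_0_compat; lra|].
    exists d; split; [exact Hd|]. intros h Hs. specialize (Hh h Hs).
    replace (Cminus (Cminus (Cmult c (f (vadd x h))) (Cmult c (f x))) (Cmult c (L h)))
      with (Cmult c (Cminus (Cminus (f (vadd x h)) (f x)) (L h))) by ring.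
    rewrite Cmod_mult.
    apply Rle_trans with ((1 + Cmod c) * (eps / (1 + Cmod c) * vnorm h)); [|right; field; lra].
    apply Rmult_le_compat; try lra; apply Cmod_ge_0.
Qed.

Definition diag_flow {n} (m : Fin.t n -> nat) (w : C) (v : Cn n) : Cn n :=
  fun i => Cmult (cexp (Cmult (INR (m i)) w)) (v i).

Lemma diag_flow_linear n (m : Fin.t n -> nat) w : linear (diag_flow m w).
Proof.
  split; intros; apply functional_extensionality; intros i; unfold diag_flow, vadd, vscal; ring.
Qed.

Lemma diag_flow_add n (m : Fin.t n -> nat) w w' v :
  diag_flow m (Cplus w w') v = diag_flow m w (diag_flow m w' v).
Proof.
  apply functional_extensionality; intros i; unfold diag_flow.
  replace (Cmult (INR (m i)) (Cplus w w')) with (Cplus (Cmult (INR (m i)) w) (Cmult (INR (m i)) w')) by ring.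
  rewrite cexp_plus. ring.
Qed.

Lemma diag_flow_0 n (m : Fin.t n -> nat) v : diag_flow m 0 v = v.
Proof.
  apply functional_extensionality; intros i; unfold diag_flow.
  rewrite Cmult_0_r, cexp_0. ring.
Qed.

(** The slowest possible weight is 1, so exp(-s) bounds every factor. *)
Lemma diag_flow_contracts n (m : Fin.t n -> nat) (s : R) v :
  (forall i, (1 <= m i)%nat) -> 0 <= s -> vnorm (diag_flow m (RtoC (- s)) v) <= exp (- s) * vnorm v.
Proof.
  intros Hm Hs. unfold vnorm. rewrite <- fsumR_scal. apply fsumR_le. intros i.
  unfold diag_flow. rewrite Cmod_mult. apply Rmult_le_compat_r; [apply Cmod_ge_0|].
  rewrite Cmod_cexp. rewrite <- RtoC_mult. simpl.
  assert (Hi : 1 <= INR (m i)) by (apply (le_INR 1), Hm).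
  assert (Hle : INR (m i) * - s <= - s) by nra.
  destruct Hle as [Hle|Hle]; [left; apply exp_increasing; exact Hle | right; rewrite Hle; reflexivity].
Qed.

Section LocalLinearization.

(** Two radii are needed: starting points range over the ball of radius [eta], while their orbits
    are only known to stay in the ball of radius [delta]. *)
Variables (n : nat) (m : Fin.t n -> nat) (F : C -> Cn n -> Cn n) (delta eta : R).
Hypothesis Heta : 0 < eta.
Hypothesis F_bound : forall w v, fst w <= 0 -> vnorm v < eta -> vnorm (F w v) < delta.
Hypothesis F_space : forall w v, fst w <= 0 -> vnorm v < eta -> vdifferentiable (F w) v.
Hypothesis F_time : forall w v i, fst w <= 0 -> vnorm v < eta ->
  exists l, Cderiv (fun u => F u v i) w l.
Hypothesis F_period : forall w v, F (Cplus w (0, 2 * PI)) v = F w v.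
Hypothesis F_flow : forall w w' v, fst w <= 0 -> fst w' <= 0 -> vnorm v < eta ->
  vnorm (F w' v) < eta -> F w (F w' v) = F (Cplus w w') v.
Hypothesis F_zero : forall w, F w vzero = vzero.
Hypothesis F_linear_part : forall w, fst w <= 0 -> vderiv (F w) vzero (diag_flow m w).

(** For the linear model flow this would be constant in w, equal to the i-th coordinate of v. *)
Definition twisted (v : Cn n) (i : Fin.t n) (w : C) : C :=
  Cmult (cexp (Cmult (RtoC (- INR (m i))) w)) (F w v i).

(** The Fourier coefficient of frequency [m i] of the i-th coordinate along the circle orbit of
    v. *)
Definition average (v : Cn n) : Cn n := fun i =>
  Cmult (/ (2 * PI))%R (Cint (fun t => twisted v i (0, t)) 0 (2 * PI)).

Lemma twisted_deriv v i w : fst w <= 0 -> vnorm v < eta -> exists l, Cderiv (twisted v i) w l.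
Proof.
  intros Hw Hv. destruct (@F_time w v i Hw Hv) as [l Hl].
  eexists. apply Cderiv_mult; [apply Cderiv_cexp_scal | exact Hl].
Qed.

(** Integrality of the weights is what makes the exponential factor periodic. *)
Lemma twisted_period v i w : twisted v i (Cplus w (0, 2 * PI)) = twisted v i w.
Proof. unfold twisted. rewrite cexp_opp_nat_period, F_period. reflexivity. Qed.

(** The translation by w = x + i y is done in two stages: by x through Goursat, by i y through
    periodicity. The twist then releases the factor exp(m_i w). *)
Lemma average_equivariant w v : fst w <= 0 -> vnorm v < eta -> vnorm (F w v) < eta ->
  average (F w v) = diag_flow m w (average v).
Proof.
  intros Hw Hv HF. pose proof PI_RGT_0 as Hpi.
  apply functional_extensionality. intros i. unfold average, diag_flow.
  assert (HG : forall u, fst u <= 0 -> exists l, Cderiv (twisted v i) u l)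
    by (intros; apply twisted_deriv; assumption).
  destruct w as [x y]. simpl in Hw.
  assert (HI : CI (fun t => twisted v i (x, t)) 0 (2 * PI)
                  (Cint (fun t => twisted v i (0, t)) 0 (2 * PI))).
  { rewrite <- (vertical_integral_const HG Hw (twisted_period v i)).
    apply CI_Cint_cont; [lra|]. intros t _. apply (rcont_vertical HG); exact Hw. }
  assert (HS : CI (fun t => twisted v i (x, t + y)) 0 (2 * PI)
                  (Cint (fun t => twisted v i (0, t)) 0 (2 * PI))).
  { apply (@CI_periodic (fun t => twisted v i (x, t)) (2 * PI) y).
    - lra.
    - intros t. apply (rcont_vertical HG); exact Hw.
    - intros t. rewrite <- (twisted_period v i (x, t)). f_equal. unfold Cplus; simpl. f_equal. ring.
    - exact HI. }
  rewrite (CI_Cint (f := fun t => twisted (F (x, y) v) i (0, t))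
    (l := Cmult (cexp (Cmult (INR (m i)) (x, y))) (Cint (fun t => twisted v i (0, t)) 0 (2 * PI)))).
  - ring.
  - apply (CI_mult (cexp (Cmult (INR (m i)) (x, y)))) in HS.
    revert HS. apply CI_ext_all. intros t. unfold twisted.
    rewrite F_flow by (simpl; lra || assumption).
    replace (x, t + y) with (Cplus (0, t) (x, y)) by (unfold Cplus; simpl; f_equal; ring).
    rewrite Cmult_assoc. f_equal. rewrite <- cexp_plus. f_equal.
    rewrite RtoC_opp. ring.
Qed.

Lemma average_vderiv1 v i (L : R -> Cn n -> C) : vnorm v < eta ->
  (forall t, vderiv1 (fun y => F (0, t) y i) v (L t)) ->
  vderiv1 (fun y => average y i) v
    (fun h => Cmult (/ (2 * PI))%R
       (Cint (fun t => Cmult (cexp (Cmult (RtoC (- INR (m i))) (0, t))) (L t h)) 0 (2 * PI))).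
Proof.
  intros Hv HL. pose proof PI_RGT_0 as Hpi.
  assert (Hin : forall y, vnorm (vsub y v) <= 4 * ((eta - vnorm v) / 8) -> vnorm y < eta).
  { intros y Hy. pose proof (vnorm_tri_rev y v). lra. }
  unfold average. apply vderiv1_scal.
  (* Four times this radius is half the distance from v to the sphere of radius [eta]. *)
  apply (@vderiv1_integral n (fun t y => twisted y i (0, t)) _ v ((eta - vnorm v) / 8) delta).
  - lra.
  - lra.
  - intros t y Hy. destruct (@F_space (0, t) y) as [K HK]; [simpl; lra | apply Hin, Hy |].
    eexists. apply vderiv1_scal. apply (vderiv_coord i HK).
  - intros t y Hy. unfold twisted. rewrite Cmod_mult, Cmod_cexp.
    replace (fst (Cmult (RtoC (- INR (m i))) (0, t))) with 0 by (unfold Cmult, RtoC; simpl; ring).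
    rewrite exp_0, Rmult_1_l. eapply Rle_trans; [apply vnorm_comp|].
    left. apply F_bound; [simpl; lra | apply Hin, Hy].
  - intros t y Hy. apply (rcont_vertical (G := twisted y i)); [|lra].
    intros u Hu. apply twisted_deriv; [exact Hu | apply Hin, Hy].
  - intros t. apply vderiv1_scal. apply HL.
Qed.

Lemma average_differentiable v : vnorm v < eta -> vdifferentiable average v.
Proof.
  intros Hv.
  destruct (fun_choice (fun (t : R) L => vderiv (F (0, t)) v L)) as [L HL].
  { intros t. apply F_space; [simpl; lra | exact Hv]. }
  exists (fun h i => Cmult (/ (2 * PI))%R
       (Cint (fun t => Cmult (cexp (Cmult (RtoC (- INR (m i))) (0, t))) (L t h i)) 0 (2 * PI))).
  apply vderiv_of_coords. intros i.
  apply (@average_vderiv1 v i (fun t h => L t h i) Hv).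
  intros t. apply (vderiv_coord i (HL t)).
Qed.

(** The twist cancels the linear part of the flow, so the differentiated integrand is the constant
    h_i. *)
Lemma average_deriv_zero : vderiv average vzero (fun h => h).
Proof.
  pose proof PI_RGT_0 as Hpi.
  apply vderiv_of_coords. intros i.
  replace (fun h : Cn n => h i) with (fun h : Cn n => Cmult (/ (2 * PI))%R
       (Cint (fun t => Cmult (cexp (Cmult (RtoC (- INR (m i))) (0, t)))
                             (diag_flow m (0, t) h i)) 0 (2 * PI))).
  - apply (@average_vderiv1 vzero i (fun t h => diag_flow m (0, t) h i)).
    + rewrite vnorm_zero. exact Heta.
    + intros t. apply (vderiv_coord i). apply F_linear_part. simpl; lra.
  - apply functional_extensionality. intros h.
    rewrite (CI_Cint (l := Cmult (Cminus (2 * PI)%R 0) (h i))).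
    + replace (Cminus (2 * PI)%R 0) with (RtoC (2 * PI)) by ring.
      rewrite Cmult_assoc, <- RtoC_mult, Rinv_l by lra. ring.
    + apply (CI_ext_all (f := fun _ => h i)); [|apply CI_const].
      intros t. unfold diag_flow. rewrite Cmult_assoc, cexp_int_inv. ring.
Qed.

Lemma average_zero : average vzero = vzero.
Proof.
  apply functional_extensionality. intros i. unfold average.
  rewrite (CI_Cint (l := Cmult (Cminus (2 * PI)%R 0) 0)); [unfold vzero; ring|].
  apply (CI_ext_all (f := fun _ => RtoC 0)); [|apply CI_const].
  intros t. unfold twisted. rewrite F_zero. unfold vzero. ring.
Qed.

Lemma average_bound v i : vnorm v < eta -> Cmod (average v i) <= delta.
Proof.
  intros Hv. pose proof PI_RGT_0 as Hpi. unfold average.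
  rewrite Cmod_mult, Cmod_R, Rabs_pos_eq by (left; apply Rinv_0_lt_compat; lra).
  apply Rmult_le_reg_l with (2 * PI); [lra|].
  rewrite <- Rmult_assoc, Rinv_r, Rmult_1_l by lra.
  replace (2 * PI * delta) with ((2 * PI - 0) * delta) by ring.
  apply (CI_norm (f := fun t => twisted v i (0, t))); [lra | |].
  - intros t _. unfold twisted. rewrite Cmod_mult, Cmod_cexp.
    replace (fst (Cmult (RtoC (- INR (m i))) (0, t))) with 0 by (unfold Cmult, RtoC; simpl; ring).
    rewrite exp_0, Rmult_1_l. eapply Rle_trans; [apply vnorm_comp|].
    left. apply F_bound; [simpl; lra | exact Hv].
  - apply CI_Cint_cont; [lra|]. intros t _.
    apply (rcont_vertical (G := twisted v i)); [|lra].
    intros u Hu. apply twisted_deriv; assumption.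
Qed.

Theorem local_linearization : exists rho (T S : Cn n -> Cn n), 0 < rho < eta /\
  (forall v, vnorm v < eta -> vdifferentiable T v) /\
  (forall w v, fst w <= 0 -> vnorm v < eta -> vnorm (F w v) < eta ->
     T (F w v) = diag_flow m w (T v)) /\
  (forall u v, vnorm u < rho -> vnorm v < rho -> T u = T v -> u = v) /\
  (forall y, vnorm y < rho / 2 -> vnorm (S y) < rho /\ T (S y) = y /\ vdifferentiable S y).
Proof.
  destruct (@inverse_function n average eta delta Heta) as [rho [S [H1 [H2 H3]]]].
  - apply average_differentiable.
  - intros u i. apply average_bound.
  - apply average_zero.
  - apply average_deriv_zero.
  - exists rho, average, S. repeat split; try apply H1; try apply H3; try assumption.
    + apply average_differentiable.
    + apply average_equivariant.
Qed.

End LocalLinearization.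

(** * Contracting flows on a complex manifold *)

Lemma opn_of_local M (tau : topology M) (U : M -> Prop) :
  (forall x, U x -> exists W, opn tau W /\ W x /\ forall y, W y -> U y) -> opn tau U.
Proof.
  intros H.
  set (I := {W : M -> Prop | opn tau W /\ forall y, W y -> U y}).
  replace U with (fun x => exists i : I, proj1_sig i x).
  - apply opn_union. intros [W [HW1 HW2]]. exact HW1.
  - apply functional_extensionality. intros x. apply propositional_extensionality. split.
    + intros [[W [HW1 HW2]] Hx]. apply HW2, Hx.
    + intros Hx. destruct (H x Hx) as [W [H1 [H2 H3]]].
      exists (exist _ W (conj H1 H3)). exact H2.
Qed.

Lemma vderiv_vcons n (w : C) (u : Cn n) : vderiv (fun y => vcons w y) u (fun h => vcons 0 h).
Proof.
  split.
  - split; intros; apply functional_extensionality; intros i; apply (Fin.caseS' i); intros;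
      unfold vadd, vscal; simpl; ring.
  - intros eps He. exists 1. split; [lra|]. intros h _.
    match goal with |- vnorm ?v <= _ => replace v with (@vzero (S n)) end.
    + rewrite vnorm_zero. pose proof (vnorm_ge_0 h). nra.
    + apply functional_extensionality; intros i; apply (Fin.caseS' i); intros;
        unfold vadd, vsub, vzero; simpl; ring.
Qed.

Section Flow.

Variables (n : nat) (M : Type) (tau : topology M) (At : chart n M -> Prop).
Variables (Phi : C -> M -> M) (p : M) (xi : chart n M).
(** [P] passes to coordinates in which the linear part is diagonal, [Q] passes back. *)
Variables (P Q : Cn n -> Cn n) (m : Fin.t n -> nat).
Hypothesis HM : complex_manifold tau At.
Hypothesis Phi_0 : forall x, Phi 0 x = x.
Hypothesis Phi_add : forall w w' x, Phi (Cplus w w') x = Phi w (Phi w' x).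
Hypothesis Phi_period : forall w x, Phi (Cplus w (0, 2 * PI)) x = Phi w x.
Hypothesis Phi_cont : forall w0 x0 V, opn tau V -> V (Phi w0 x0) ->
  exists d W, 0 < d /\ opn tau W /\ W x0 /\
    forall w x, Cmod (Cminus w w0) < d -> W x -> V (Phi w x).
Hypothesis Phi_holo : forall zeta eta, At zeta -> At eta ->
  holo_on (fun w : Cn (S n) => cimg zeta (vtail w) /\ cdom eta (Phi (vhead w) (cinv zeta (vtail w))))
          (fun w => cmap eta (Phi (vhead w) (cinv zeta (vtail w)))).
Hypothesis Phi_fix : forall w, Phi w p = p.
Hypothesis xi_At : At xi.
Hypothesis xi_p : cdom xi p.
Hypothesis P_lin : linear P.
Hypothesis Q_lin : linear Q.
Hypothesis PQ : forall v, P (Q v) = v.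
Hypothesis QP : forall v, Q (P v) = v.
Hypothesis m_pos : forall i, (1 <= m i)%nat.
Hypothesis Phi_deriv : forall w,
  vderiv (fun u => cmap xi (Phi w (cinv xi u))) (cmap xi p) (fun h => Q (diag_flow m w (P h))).

Lemma At_chart zeta : At zeta -> is_chart tau zeta.
Proof. destruct HM as [_ [_ [H _]]]. apply H. Qed.

Lemma Phi_space zeta eta w u : At zeta -> At eta -> cimg zeta u ->
  cdom eta (Phi w (cinv zeta u)) ->
  vdifferentiable (fun v => cmap eta (Phi w (cinv zeta v))) u.
Proof.
  intros Hz He Hu Hd.
  destruct (@Phi_holo zeta eta Hz He (vcons w u) (conj Hu Hd)) as [J HJ].
  eexists.
  apply (vderiv_comp (f := fun v => vcons w v)
    (g := fun o : Cn (S n) => cmap eta (Phi (vhead o) (cinv zeta (vtail o))))).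
  - apply vderiv_vcons.
  - apply has_jacobian_vderiv. exact HJ.
Qed.

(** * Centred coordinates that diagonalize the linear part *)

Let c := cmap xi p.
Definition coord (x : M) : Cn n := P (vsub (cmap xi x) c).
Definition param (v : Cn n) : M := cinv xi (vadd c (Q v)).
(** A total function, meaningful as the flow in coordinates only while [v] lies in the image of the
    chart and the orbit point in its domain. *)
Definition flow_map (w : C) (v : Cn n) : Cn n := coord (Phi w (param v)).
Definition disc (r : R) (x : M) : Prop := cdom xi x /\ vnorm (coord x) < r.

Lemma coord_affine_deriv u : vderiv (fun y => P (vsub y c)) u P.
Proof. apply (vderiv_comp (vderiv_translate c u) (vderiv_linear (vsub u c) P_lin)). Qed.

Lemma param_affine_deriv v : vderiv (fun y => vadd c (Q y)) v Q.
Proof. apply (vderiv_comp (vderiv_linear v Q_lin) (vderiv_translate_r c (Q v))). Qed.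

Lemma affine_inverse u : vadd c (Q (P (vsub u c))) = u.
Proof. rewrite QP. apply vadd_sub. Qed.

Lemma param_coord x : cdom xi x -> param (coord x) = x.
Proof.
  intros Hx. unfold param, coord. rewrite affine_inverse.
  destruct (At_chart xi_At) as [_ [_ [H _]]]. apply H, Hx.
Qed.

Lemma coord_p : coord p = vzero.
Proof.
  unfold coord, c. replace (vsub (cmap xi p) (cmap xi p)) with (@vzero n) by vext.
  apply linear_zero, P_lin.
Qed.

Lemma param_zero : param vzero = p.
Proof. rewrite <- coord_p. apply param_coord, xi_p. Qed.

Lemma disc_le r s x : r <= s -> disc r x -> disc s x.
Proof. intros H [H1 H2]. split; [exact H1 | lra]. Qed.

Lemma disc_p r : 0 < r -> disc r p.
Proof. intros H. split; [exact xi_p|]. rewrite coord_p, vnorm_zero. exact H. Qed.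

Lemma disc_open r : opn tau (disc r).
Proof.
  destruct (At_chart xi_At) as [Hdom [_ [_ [_ [_ [Hcont _]]]]]].
  destruct (linear_bounded P_lin) as [K [HK HB]].
  apply opn_of_local. intros x [Hx Hr].
  destruct (Hcont x Hx ((r - vnorm (coord x)) / K)) as [W [HW1 [HW2 HW3]]];
    [apply Rdiv_lt_0_compat; lra|].
  exists (fun y => cdom xi y /\ W y). split; [apply opn_inter; assumption|].
  split; [split; assumption|]. intros y [Hy HWy]. split; [exact Hy|].
  specialize (HW3 y HWy Hy).
  pose proof (vnorm_tri_rev (coord y) (coord x)) as T.
  assert (E : vsub (coord y) (coord x) = P (vsub (cmap xi y) (cmap xi x))).
  { unfold coord. rewrite <- (linear_sub _ _ P_lin). f_equal. vext. }
  rewrite E in T. specialize (HB (vsub (cmap xi y) (cmap xi x))).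
  assert (K * vnorm (vsub (cmap xi y) (cmap xi x)) < r - vnorm (coord x)).
  { replace (r - vnorm (coord x)) with (K * ((r - vnorm (coord x)) / K)) by (field; lra).
    apply Rmult_lt_compat_l; lra. }
  lra.
Qed.

Lemma param_domain : exists d, 0 < d /\ forall v, vnorm v < d -> cimg xi (vadd c (Q v)).
Proof.
  destruct (At_chart xi_At) as [_ [Himg _]].
  destruct (linear_bounded Q_lin) as [K [HK HB]].
  destruct (Himg c) as [e [He H]]; [exists p; split; [exact xi_p | reflexivity]|].
  exists (e / K). split; [apply Rdiv_lt_0_compat; assumption|]. intros v Hv. apply H.
  rewrite vsub_add. eapply Rle_lt_trans; [apply HB|].
  replace e with (K * (e / K)) by (field; lra). apply Rmult_lt_compat_l; assumption.
Qed.

Section WithDomain.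

Variable d0 : R.
Hypothesis d0_pos : 0 < d0.
Hypothesis d0_img : forall v, vnorm v < d0 -> cimg xi (vadd c (Q v)).

Lemma coord_param v : vnorm v < d0 -> cdom xi (param v) /\ coord (param v) = v.
Proof.
  intros Hv. destruct (At_chart xi_At) as [_ [_ [_ [H1 [H2 _]]]]]. split.
  - apply H1, d0_img, Hv.
  - unfold coord, param. rewrite H2 by (apply d0_img, Hv). rewrite vsub_add. apply PQ.
Qed.

Lemma disc_param r v : r <= d0 -> vnorm v < r -> disc r (param v).
Proof. intros Hr Hv. destruct (@coord_param v ltac:(lra)) as [H1 H2]. split; [exact H1|]. rewrite H2; exact Hv. Qed.

(** Together with [disc_open], this makes the discs a neighbourhood base at [p]. *)
Lemma neighbourhood_disc V : opn tau V -> V p -> exists r, 0 < r <= d0 /\ forall x, disc r x -> V x.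
Proof.
  intros HV Hp. destruct (At_chart xi_At) as [_ [_ [_ [_ [_ [_ H]]]]]].
  destruct (linear_bounded Q_lin) as [K [HK HB]].
  assert (Z : vadd c (Q vzero) = c) by (rewrite (linear_zero Q_lin); vext).
  assert (Hc : cimg xi c) by (exists p; split; [exact xi_p | reflexivity]).
  destruct (H c Hc V HV) as [d [Hd Hw]].
  { rewrite <- Z. fold (param vzero). rewrite param_zero. exact Hp. }
  exists (Rmin d0 (d / K)). split.
  { split; [apply Rmin_pos; [assumption | apply Rdiv_lt_0_compat; assumption] | apply Rmin_l]. }
  intros x [Hx Hr]. pose proof (Rmin_l d0 (d / K)). pose proof (Rmin_r d0 (d / K)).
  rewrite <- (param_coord _ Hx). unfold param. apply Hw; [apply d0_img; lra|].
  rewrite vsub_add. eapply Rle_lt_trans; [apply HB|].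
  replace d with (K * (d / K)) by (field; lra). apply Rmult_lt_compat_l; lra.
Qed.

Lemma flow_map_space w v : vnorm v < d0 -> cdom xi (Phi w (param v)) -> vdifferentiable (flow_map w) v.
Proof.
  intros Hv Hd.
  destruct (Phi_space (zeta := xi) (eta := xi) w (u := vadd c (Q v)) xi_At xi_At (d0_img _ Hv) Hd) as [L HL].
  eexists. unfold flow_map, coord.
  apply (vderiv_comp (f := fun y => cmap xi (Phi w (param y))) (g := fun y => P (vsub y c)));
    [|apply coord_affine_deriv].
  apply (vderiv_comp (f := fun y => vadd c (Q y)) (g := fun y => cmap xi (Phi w (cinv xi y))));
    [apply param_affine_deriv | exact HL].
Qed.

(** Holomorphy in time is read off from joint holomorphy, on the complex line along the time
    coordinate. *)
Lemma flow_map_time w v i : vnorm v < d0 -> cdom xi (Phi w (param v)) ->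
  exists l, Cderiv (fun u => flow_map u v i) w l.
Proof.
  intros Hv Hd.
  destruct (@Phi_holo xi xi xi_At xi_At (vcons w (vadd c (Q v))) (conj (d0_img _ Hv) Hd)) as [J HJ].
  apply has_jacobian_vderiv in HJ.
  pose proof (vderiv_comp (g := fun y => P (vsub y c)) HJ (coord_affine_deriv _)) as HK.
  apply (vderiv_coord i) in HK.
  set (x := vcons 0 (vadd c (Q v))). set (e := vcons 1 (@vzero n)).
  assert (E : forall t, vadd x (vscal t e) = vcons t (vadd c (Q v))).
  { intros t. apply functional_extensionality; intros j; unfold x, e; apply (Fin.caseS' j); intros;
      unfold vadd, vscal, vzero; simpl; ring. }
  rewrite <- (E w) in HK. apply vderiv1_line in HK.
  eexists. revert HK. cbv beta.
  match goal with |- Cderiv ?f w _ -> _ => replace f with (fun u => flow_map u v i) end.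
  - intros HK. exact HK.
  - apply functional_extensionality. intros t. rewrite E. reflexivity.
Qed.

Lemma flow_map_zero w : flow_map w vzero = vzero.
Proof. unfold flow_map. rewrite param_zero, Phi_fix. apply coord_p. Qed.

Lemma flow_map_linear_part w : vderiv (flow_map w) vzero (diag_flow m w).
Proof.
  replace (diag_flow m w) with (fun h => P (Q (diag_flow m w (P (Q h))))).
  - unfold flow_map, coord.
    apply (vderiv_comp (f := fun y => cmap xi (Phi w (param y))) (g := fun y => P (vsub y c))
      (L := fun h => Q (diag_flow m w (P (Q h)))) (K := P)); [|apply coord_affine_deriv].
    apply (vderiv_comp (f := fun y => vadd c (Q y)) (g := fun y => cmap xi (Phi w (cinv xi y)))
      (L := Q) (K := fun h => Q (diag_flow m w (P h)))).
    + apply param_affine_deriv.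
    + rewrite (linear_zero Q_lin), vadd_zero. apply Phi_deriv.
  - apply functional_extensionality. intros h. rewrite !PQ. reflexivity.
Qed.

(** * Uniform contraction for times with nonpositive real part *)

Let s0 := ln 4.

Lemma s0_pos : 0 < s0.
Proof. unfold s0. rewrite <- ln_1. apply ln_increasing; lra. Qed.

Lemma contraction : exists delta, 0 < delta <= d0 /\ forall x, disc delta x ->
  cdom xi (Phi (RtoC (- s0)) x) /\ vnorm (coord (Phi (RtoC (- s0)) x)) <= vnorm (coord x) / 2.
Proof.
  pose proof s0_pos as Hs.
  (* At time -ln 4 the linear part contracts by 1/4; a nonlinear error of another 1/4 leaves the
     factor 1/2. *)
  destruct (proj2 (flow_map_linear_part (RtoC (- s0))) (/ 4) ltac:(lra)) as [d [Hd Hh]].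
  destruct (At_chart xi_At) as [Hdom _].
  destruct (@Phi_cont (RtoC (- s0)) p _ Hdom) as [d1 [W [Hd1 [HW1 [HW2 HW3]]]]];
    [rewrite Phi_fix; exact xi_p|].
  destruct (neighbourhood_disc _ HW1 HW2) as [r [Hr HWr]].
  pose proof (Rmin_l r d). pose proof (Rmin_r r d).
  exists (Rmin r d). split; [split; [apply Rmin_pos; lra | lra]|].
  intros x Hx. split.
  - apply HW3; [|apply HWr; apply (@disc_le (Rmin r d)); assumption].
    replace (Cminus (RtoC (- s0)) (RtoC (- s0))) with (RtoC 0) by ring. rewrite Cmod_0. exact Hd1.
  - destruct Hx as [Hx1 Hx2]. rewrite <- (param_coord _ Hx1) at 1.
    fold (flow_map (RtoC (- s0)) (coord x)). set (v := coord x) in *.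
    specialize (Hh v ltac:(lra)). rewrite flow_map_zero, vsub_zero in Hh.
    replace (vadd vzero v) with v in Hh by vext.
    pose proof (vnorm_tri_rev (flow_map (RtoC (- s0)) v) (diag_flow m (RtoC (- s0)) v)) as T.
    pose proof (diag_flow_contracts m (s := s0) v m_pos ltac:(lra)) as D.
    assert (E : exp (- s0) = / 4) by (unfold s0; rewrite exp_Ropp, exp_ln; lra).
    rewrite E in D. lra.
Qed.

Section WithContraction.

Variable delta : R.
Hypothesis delta_pos : 0 < delta <= d0.
Hypothesis delta_contraction : forall x, disc delta x ->
  cdom xi (Phi (RtoC (- s0)) x) /\ vnorm (coord (Phi (RtoC (- s0)) x)) <= vnorm (coord x) / 2.

Lemma iterated_contraction k x : disc delta x ->
  disc delta (Phi (RtoC (- (INR k * s0))) x) /\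
  vnorm (coord (Phi (RtoC (- (INR k * s0))) x)) <= delta / 2 ^ k.
Proof.
  intros Hx. induction k as [|k [IH1 IH2]].
  - simpl INR. rewrite Rmult_0_l, Ropp_0, Phi_0. split; [exact Hx|].
    simpl. destruct Hx. lra.
  - assert (E : Phi (RtoC (- (INR (S k) * s0))) x = Phi (RtoC (- s0)) (Phi (RtoC (- (INR k * s0))) x)).
    { rewrite <- Phi_add, <- RtoC_plus, S_INR. f_equal. f_equal. ring. }
    rewrite E, half_pow_S. destruct (delta_contraction IH1) as [C1 C2].
    pose proof (vnorm_ge_0 (coord (Phi (RtoC (- (INR k * s0))) x))). destruct IH1 as [I1 I2].
    repeat split; [exact C1 | lra | lra].
Qed.

(** Since [p] is fixed, continuity gives a suitable disc near each time; compactness of the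
    rectangle of times makes the disc uniform. *)
Lemma compact_window : exists eta, 0 < eta <= delta /\ forall x w, disc eta x ->
  - s0 <= fst w <= 0 -> 0 <= snd w <= 2 * PI -> disc delta (Phi w x).
Proof.
  (* The factor 2 lets each of the two coordinates of the time deviate by r. One radius serves for
     both time and space. *)
  assert (Loc : forall uv : R * R, exists r : posreal, forall w x,
     Cmod (Cminus w uv) < 2 * r -> disc r x -> disc delta (Phi w x)).
  { intros uv.
    destruct (@Phi_cont uv p _ (disc_open delta)) as [d [W [Hd [HW1 [HW2 HW3]]]]].
    { rewrite Phi_fix. apply disc_p. lra. }
    destruct (neighbourhood_disc _ HW1 HW2) as [r [Hr HWr]].
    assert (Hp : 0 < Rmin (d / 2) r) by (apply Rmin_pos; lra).
    pose proof (Rmin_l (d / 2) r). pose proof (Rmin_r (d / 2) r).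
    exists (mkposreal _ Hp). simpl. intros w x Hw Hx. apply HW3; [lra|].
    apply HWr. apply (disc_le (r := Rmin (d / 2) r)); assumption. }
  destruct (fun_choice _ Loc) as [rad Hrad].
  destruct (compactness_value_2d (- s0) 0 0 (2 * PI) (fun u v => rad (u, v))) as [d Hd].
  pose proof (Rmin_l d delta). pose proof (Rmin_r d delta). pose proof (cond_pos d).
  exists (Rmin d delta). split; [split; [apply Rmin_pos; lra | lra]|].
  intros x [a b] Hx Ha Hb. simpl in Ha, Hb.
  (* The compactness statement provides the nearby centre only under a double negation. *)
  apply NNPP. intros Hn. apply (Hd a b Ha Hb). intros [u [v [_ [_ [Hu [Hv Hduv]]]]]].
  apply Hn. apply (Hrad (u, v)).
  - eapply Rle_lt_trans; [apply Cmod_le_abs|]. unfold Cminus, Cplus, Copp; simpl.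
    unfold Rminus in *. lra.
  - apply (disc_le (r := Rmin d delta)); [lra | exact Hx].
Qed.

Lemma Phi_period_nat (k : nat) a b x : Phi (a, b + INR k * (2 * PI)) x = Phi (a, b) x.
Proof.
  induction k as [|k IH].
  - simpl INR. rewrite Rmult_0_l, Rplus_0_r. reflexivity.
  - rewrite <- IH, <- (Phi_period (a, b + INR k * (2 * PI))), S_INR. f_equal.
    unfold Cplus; simpl. f_equal; ring.
Qed.

Lemma Phi_reduce_angle a b x : exists t, 0 <= t <= 2 * PI /\ Phi (a, b) x = Phi (a, t) x.
Proof.
  pose proof PI_RGT_0 as Hpi.
  assert (Pos : forall b, 0 <= b -> exists t, 0 <= t <= 2 * PI /\ Phi (a, b) x = Phi (a, t) x).
  { intros b' Hb'. destruct (nfloor_ex (b' / (2 * PI))) as [k [Hk1 Hk2]];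
      [apply Rdiv_le_0_compat; lra|].
    exists (b' - INR k * (2 * PI)). split.
    - assert (E : b' / (2 * PI) * (2 * PI) = b') by (field; lra).
      pose proof (Rmult_le_compat_r (2 * PI) _ _ ltac:(lra) Hk1).
      pose proof (Rmult_lt_compat_r (2 * PI) _ _ ltac:(lra) Hk2). lra.
    - rewrite <- (Phi_period_nat k a (b' - INR k * (2 * PI))). f_equal. f_equal. ring. }
  destruct (Rle_lt_dec 0 b) as [Hb|Hb]; [apply Pos, Hb|].
  (* A negative angle becomes nonnegative after k + 1 full turns, which reduces it to [Pos]. *)
  destruct (nfloor_ex (- b / (2 * PI))) as [k [Hk1 Hk2]]; [apply Rdiv_le_0_compat; lra|].
  destruct (Pos (b + INR (S k) * (2 * PI))) as [t [Ht E]].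
  - rewrite S_INR.
    assert (E : - b / (2 * PI) * (2 * PI) = - b) by (field; lra).
    pose proof (Rmult_lt_compat_r (2 * PI) _ _ ltac:(lra) Hk2). lra.
  - exists t. split; [exact Ht|]. rewrite <- E. symmetry. apply Phi_period_nat.
Qed.

Section WithWindow.

Variable eta : R.
Hypothesis eta_pos : 0 < eta <= delta.
Hypothesis eta_window : forall x w, disc eta x ->
  - s0 <= fst w <= 0 -> 0 <= snd w <= 2 * PI -> disc delta (Phi w x).

(** The time is split into one in the compact window, applied first, and k steps of -s0. The last
    inequality makes k grow as Re w decreases. *)
Lemma flow_decomposition (w : C) x : disc eta x -> fst w <= 0 -> exists (k : nat) y,
  disc delta y /\ Phi w x = Phi (RtoC (- (INR k * s0))) y /\ - fst w < (INR k + 1) * s0.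
Proof.
  intros Hx Hw. pose proof s0_pos as Hs. destruct w as [a b]. simpl in *.
  destruct (nfloor_ex (- a / s0)) as [k [Hk1 Hk2]]; [apply Rdiv_le_0_compat; lra|].
  assert (E : - a / s0 * s0 = - a) by (field; lra).
  pose proof (Rmult_le_compat_r s0 _ _ ltac:(lra) Hk1) as H1.
  pose proof (Rmult_lt_compat_r s0 _ _ ltac:(lra) Hk2) as H2. rewrite E in H1, H2.
  destruct (Phi_reduce_angle (a + INR k * s0) b x) as [t [Ht Et]].
  exists k, (Phi (a + INR k * s0, t) x). split; [|split].
  - apply eta_window; [exact Hx | simpl; lra | simpl; lra].
  - rewrite <- Et, <- Phi_add. f_equal. unfold Cplus, RtoC; simpl. f_equal; ring.
  - exact H2.
Qed.

Lemma flow_stays (w : C) x : disc eta x -> fst w <= 0 -> disc delta (Phi w x).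
Proof.
  intros Hx Hw. destruct (@flow_decomposition w x Hx Hw) as [k [y [Hy [-> _]]]].
  apply iterated_contraction, Hy.
Qed.

(** Below B = - N s0 the decomposition contains at least N contraction steps, whatever the imaginary
    part of w. *)
Lemma flow_decays eps : 0 < eps -> exists B, B <= 0 /\ forall (w : C) x, disc eta x ->
  fst w <= B -> disc eps (Phi w x).
Proof.
  intros He. pose proof s0_pos as Hs.
  destruct (pow_lt_1_zero (/ 2)) with (y := eps / delta) as [N HN];
    [rewrite Rabs_pos_eq; lra | apply Rdiv_lt_0_compat; lra |].
  exists (- (INR N * s0)). pose proof (pos_INR N). split; [nra|].
  intros w x Hx Hw. destruct (@flow_decomposition w x Hx) as [k [y [Hy [-> Hk]]]]; [nra|].
  destruct (iterated_contraction k Hy) as [[H1 _] H2]. split; [exact H1|].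
  assert (Hkn : (N <= k)%nat).
  { assert (INR N < INR k + 1) by (apply Rmult_lt_reg_r with s0; lra).
    rewrite <- S_INR in *. apply INR_lt in H0. lia. }
  specialize (HN k Hkn). rewrite Rabs_pos_eq, pow_inv in HN by (apply pow_le; lra).
  eapply Rle_lt_trans; [exact H2|].
  replace eps with (delta * (eps / delta)) by (field; lra). unfold Rdiv at 1.
  apply Rmult_lt_compat_l; lra.
Qed.

Lemma flow_map_linearization : exists rho (T S : Cn n -> Cn n), 0 < rho < eta /\
  (forall v, vnorm v < eta -> vdifferentiable T v) /\
  (forall w v, fst w <= 0 -> vnorm v < eta -> vnorm (flow_map w v) < eta ->
     T (flow_map w v) = diag_flow m w (T v)) /\
  (forall u v, vnorm u < rho -> vnorm v < rho -> T u = T v -> u = v) /\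
  (forall y, vnorm y < rho / 2 -> vnorm (S y) < rho /\ T (S y) = y /\ vdifferentiable S y).
Proof.
  assert (Hin : forall w v, fst w <= 0 -> vnorm v < eta -> disc delta (Phi w (param v))).
  { intros w v Hw Hv. apply flow_stays; [|exact Hw]. apply disc_param; lra. }
  apply (@local_linearization n m flow_map delta eta).
  - lra.
  - intros w v Hw Hv. apply (Hin w v Hw Hv).
  - intros w v Hw Hv. apply flow_map_space; [lra | apply (Hin w v Hw Hv)].
  - intros w v i Hw Hv. apply flow_map_time; [lra | apply (Hin w v Hw Hv)].
  - intros w v. unfold flow_map. rewrite Phi_period. reflexivity.
  - intros w w' v Hw Hw' Hv _. unfold flow_map at 1 2.
    rewrite param_coord by (apply (Hin w' v Hw' Hv)). rewrite <- Phi_add. reflexivity.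
  - apply flow_map_zero.
  - intros w _. apply flow_map_linear_part.
Qed.

(** * Extension of the linearization to the basin *)

Section WithLinearization.

Variables (rho : R) (T0 S0 : Cn n -> Cn n).
Hypothesis rho_pos : 0 < rho < eta.
Hypothesis T0_diff : forall v, vnorm v < eta -> vdifferentiable T0 v.
Hypothesis T0_flow : forall w v, fst w <= 0 -> vnorm v < eta -> vnorm (flow_map w v) < eta ->
     T0 (flow_map w v) = diag_flow m w (T0 v).
Hypothesis T0_inj : forall u v, vnorm u < rho -> vnorm v < rho -> T0 u = T0 v -> u = v.
Hypothesis S0_spec : forall y, vnorm y < rho / 2 ->
  vnorm (S0 y) < rho /\ T0 (S0 y) = y /\ vdifferentiable S0 y.

(** One time in the disc suffices: by [basin_absorbed] the orbit is then in it for all sufficiently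
    negative Re w. *)
Definition basin (x : M) : Prop := exists w, disc rho (Phi w x).

(** Flow into the disc, linearize there, undo the time with the linear flow, and return to the
    original linear coordinates. *)
Definition T_at (w : C) (x : M) : Cn n := Q (diag_flow m (Copp w) (T0 (coord (Phi w x)))).

Definition Tglobal (x : M) : Cn n :=
  T_at (epsilon (inhabits (RtoC 0)) (fun w => disc rho (Phi w x))) x.

(** Local equivariance is known only for times with nonpositive real part, so one goes from w to the
    more contracting w'. [Tglobal_eq] orders the two times to obtain independence of the choice. *)
Lemma T_at_le (w w' : C) x : fst w' <= fst w -> disc rho (Phi w x) -> disc rho (Phi w' x) ->
  T_at w' x = T_at w x.
Proof.
  intros Hle [H1 H2] [H3 H4]. unfold T_at. f_equal.
  assert (E : coord (Phi w' x) = flow_map (Cminus w' w) (coord (Phi w x))).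
  { unfold flow_map. rewrite (param_coord _ H1), <- Phi_add. f_equal. f_equal. ring. }
  rewrite E, T0_flow.
  - rewrite <- diag_flow_add. f_equal. ring.
  - unfold Cminus, Cplus, Copp; simpl. lra.
  - lra.
  - rewrite <- E. lra.
Qed.

Lemma Tglobal_eq w x : disc rho (Phi w x) -> Tglobal x = T_at w x.
Proof.
  intros H. unfold Tglobal.
  assert (H' : disc rho (Phi (epsilon (inhabits (RtoC 0)) (fun w => disc rho (Phi w x))) x)).
  { apply (epsilon_spec (inhabits (RtoC 0)) (fun w => disc rho (Phi w x))). exists w. exact H. }
  set (w' := epsilon _ _) in *.
  destruct (Rle_lt_dec (fst w') (fst w)) as [Hl|Hl].
  - apply T_at_le; assumption.
  - symmetry. apply T_at_le; [lra | assumption | assumption].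
Qed.

Lemma basin_Phi w x : basin x -> basin (Phi w x).
Proof.
  intros [w1 H]. exists (Cminus w1 w). rewrite <- Phi_add.
  replace (Cplus (Cminus w1 w) w) with w1 by ring. exact H.
Qed.

Lemma Tglobal_Phi w x : basin x -> Tglobal (Phi w x) = Q (diag_flow m w (P (Tglobal x))).
Proof.
  intros [w1 H].
  assert (E : Phi (Cminus w1 w) (Phi w x) = Phi w1 x).
  { rewrite <- Phi_add. f_equal. ring. }
  rewrite (@Tglobal_eq (Cminus w1 w) (Phi w x)) by (rewrite E; exact H).
  rewrite (Tglobal_eq H). unfold T_at. rewrite E, PQ, <- diag_flow_add.
  f_equal. f_equal. ring.
Qed.

Lemma basin_open : opn tau basin.
Proof.
  apply opn_of_local. intros x [w Hx].
  destruct (@Phi_cont w x _ (disc_open rho) Hx) as [d [W [Hd [H1 [H2 H3]]]]].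
  exists W. split; [exact H1|]. split; [exact H2|]. intros y Hy. exists w. apply H3; [|exact Hy].
  replace (Cminus w w) with (RtoC 0) by ring. rewrite Cmod_0. exact Hd.
Qed.

Lemma basin_absorbed x : basin x -> exists B, forall w : C, fst w <= B -> disc rho (Phi w x).
Proof.
  intros [w1 H]. destruct (@flow_decays rho ltac:(lra)) as [B [HB HF]].
  exists (B + fst w1). intros w Hw.
  replace w with (Cplus (Cminus w w1) w1) by ring. rewrite Phi_add. apply HF.
  - apply (disc_le (r := rho)); [lra | exact H].
  - unfold Cminus, Cplus, Copp; simpl. lra.
Qed.

(** A sufficiently negative time brings both points into the disc, where [T0] is injective;
    everything else in [T_at] at that time is invertible. *)
Lemma Tglobal_inj x y : basin x -> basin y -> Tglobal x = Tglobal y -> x = y.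
Proof.
  intros Hx Hy E.
  destruct (basin_absorbed Hx) as [B1 H1]. destruct (basin_absorbed Hy) as [B2 H2].
  set (w := RtoC (Rmin B1 B2)).
  assert (D1 : disc rho (Phi w x)) by (apply H1, Rmin_l).
  assert (D2 : disc rho (Phi w y)) by (apply H2, Rmin_r).
  rewrite (Tglobal_eq D1), (Tglobal_eq D2) in E. unfold T_at in E.
  apply (f_equal P) in E. rewrite !PQ in E.
  apply (f_equal (diag_flow m w)) in E. rewrite <- !diag_flow_add in E.
  replace (Cplus w (Copp w)) with (RtoC 0) in E by ring. rewrite !diag_flow_0 in E.
  destruct D1 as [D1 D1']. destruct D2 as [D2 D2'].
  apply T0_inj in E; try assumption.
  apply (f_equal param) in E. rewrite !param_coord in E by assumption.
  apply (f_equal (Phi (Copp w))) in E. rewrite <- !Phi_add in E.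
  replace (Cplus (Copp w) w) with (RtoC 0) in E by ring. rewrite !Phi_0 in E. exact E.
Qed.

(** * The inverse on all of C^n *)

Definition preimage (w : C) (y : Cn n) : M := Phi (Copp w) (param (S0 (diag_flow m w (P y)))).

(** The linear flow at time w brings y into the ball on which [S0] inverts [T0]. *)
Definition scale_ok (y : Cn n) (w : C) : Prop := vnorm (diag_flow m w (P y)) < rho / 2.

Lemma scale_ok_exists y : exists w, scale_ok y w.
Proof.
  (* With this time, exp(-s) |P y| = rho |P y| / (rho + 2 |P y|) < rho / 2. *)
  set (s := ln (1 + 2 * vnorm (P y) / rho)).
  pose proof (vnorm_ge_0 (P y)) as Hy.
  assert (H1 : 0 <= 2 * vnorm (P y) / rho) by (apply Rdiv_le_0_compat; lra).
  assert (Hs : 0 <= s).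
  { unfold s. rewrite <- ln_1. destruct H1 as [H1|H1].
    - left. apply ln_increasing; lra.
    - right. rewrite <- H1, Rplus_0_r. reflexivity. }
  exists (RtoC (- s)). unfold scale_ok.
  eapply Rle_lt_trans; [apply (diag_flow_contracts m (P y) m_pos Hs)|].
  rewrite exp_Ropp. unfold s. rewrite exp_ln by lra.
  apply Rmult_lt_reg_l with (1 + 2 * vnorm (P y) / rho); [lra|].
  rewrite <- Rmult_assoc, Rinv_r, Rmult_1_l by lra.
  replace ((1 + 2 * vnorm (P y) / rho) * (rho / 2)) with (rho / 2 + vnorm (P y)) by (field; lra).
  lra.
Qed.

Lemma preimage_spec w y : scale_ok y w -> disc rho (Phi w (preimage w y)) /\
  Tglobal (preimage w y) = y.
Proof.
  intros H. destruct (S0_spec _ H) as [H1 [H2 _]].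
  assert (E : Phi w (preimage w y) = param (S0 (diag_flow m w (P y)))).
  { unfold preimage. rewrite <- Phi_add. replace (Cplus w (Copp w)) with (RtoC 0) by ring. apply Phi_0. }
  assert (D : disc rho (Phi w (preimage w y))) by (rewrite E; apply disc_param; lra).
  split; [exact D|]. rewrite (Tglobal_eq D). unfold T_at. rewrite E.
  rewrite (proj2 (@coord_param (S0 (diag_flow m w (P y))) ltac:(lra))), H2, <- diag_flow_add.
  replace (Cplus (Copp w) w) with (RtoC 0) by ring. rewrite diag_flow_0. apply QP.
Qed.

Definition Tinverse (y : Cn n) : M := preimage (epsilon (inhabits (RtoC 0)) (scale_ok y)) y.

Lemma Tinverse_spec y : basin (Tinverse y) /\ Tglobal (Tinverse y) = y.
Proof.
  destruct (@preimage_spec (epsilon (inhabits (RtoC 0)) (scale_ok y)) y) as [H1 H2].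
  - apply epsilon_spec, scale_ok_exists.
  - split; [eexists; exact H1 | exact H2].
Qed.

(** Injectivity of [Tglobal] removes the dependence on the time, so that a single w can be used
    throughout a neighbourhood of y. *)
Lemma Tinverse_eq w y : scale_ok y w -> Tinverse y = preimage w y.
Proof.
  intros H. destruct (preimage_spec H) as [H1 H2]. destruct (Tinverse_spec y) as [H3 H4].
  apply Tglobal_inj; [exact H3 | exists w; exact H1 | congruence].
Qed.

(** Being in the disc at time w and being admissible for w are open conditions; with w frozen, both
    maps are locally composites of differentiable ones. *)
Lemma Tglobal_biholomorphism : biholomorphism tau At basin (fun _ => True) Tglobal.
Proof.
  split; [trivial|]. exists Tinverse.
  split; [intros y _; apply Tinverse_spec|].
  split. { intros x Hx. apply Tglobal_inj; [apply Tinverse_spec | exact Hx | apply Tinverse_spec]. }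
  split; [intros y _; apply Tinverse_spec|].
  split.
  - intros zeta Hz u [Hu [w Hw]].
    destruct (At_chart Hz) as [_ [Himg [_ [_ [_ [_ Hci]]]]]].
    destruct (@Phi_cont w (cinv zeta u) _ (disc_open rho) Hw) as [d [W [Hd [H1 [H2 H3]]]]].
    destruct (Hci u Hu W H1 H2) as [e1 [He1 HW]].
    destruct (Himg u Hu) as [e2 [He2 Hi]].
    (* One radius keeps y in the chart image, the other keeps its orbit in the disc at the same time
       w. *)
    assert (Hnear : forall y, vnorm (vsub y u) < Rmin e1 e2 -> disc rho (Phi w (cinv zeta y))).
    { intros y Hy. pose proof (Rmin_l e1 e2). pose proof (Rmin_r e1 e2).
      apply H3; [replace (Cminus w w) with (RtoC 0) by ring; rewrite Cmod_0; exact Hd|].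
      apply HW; [apply Hi; lra | lra]. }
    destruct (Phi_space w Hz xi_At Hu (proj1 Hw)) as [L HL].
    destruct (@T0_diff (coord (Phi w (cinv zeta u)))) as [L' HL']; [destruct Hw; lra|].
    pose proof (vderiv_comp (g := fun y => P (vsub y c)) HL (coord_affine_deriv _)) as HK.
    pose proof (vderiv_comp (g := T0) HK HL') as HK2.
    pose proof (vderiv_comp (g := fun y => Q (diag_flow m (Copp w) y)) HK2
      (vderiv_linear _ (linear_compose Q_lin (diag_flow_linear m (Copp w))))) as HK3.
    apply (vderiv_has_jacobian (L := fun h => Q (diag_flow m (Copp w) (L' (P (L h)))))).
    revert HK3. apply (@vderiv_local n n _ _ u _ (Rmin e1 e2)); [apply Rmin_pos; assumption|].
    intros y Hy. symmetry. apply (Tglobal_eq (Hnear y Hy)).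
  - intros zeta Hz y [_ Hy].
    destruct (scale_ok_exists y) as [w Hw].
    pose proof (Tinverse_eq Hw) as E. rewrite E in Hy.
    destruct (S0_spec _ Hw) as [H1 [H2 [LS HLS]]].
    assert (Hlin : linear (fun v => diag_flow m w (P v)))
      by (apply (linear_compose (diag_flow_linear m w) P_lin)).
    pose proof (vderiv_linear y Hlin) as HA.
    destruct (vderiv_cont HA (eps := rho / 2 - vnorm (diag_flow m w (P y)))) as [r [Hr Hnear]];
      [unfold scale_ok in Hw; lra|].
    pose proof (vderiv_comp (g := S0) HA HLS) as HB.
    pose proof (vderiv_comp (g := fun v => vadd c (Q v)) HB (param_affine_deriv _)) as HC.
    destruct (Phi_space (zeta := xi) (eta := zeta) (Copp w)
      (u := vadd c (Q (S0 (diag_flow m w (P y))))) xi_At Hz) as [L HL].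
    + apply d0_img. lra.
    + exact Hy.
    + pose proof (vderiv_comp (g := fun v => cmap zeta (Phi (Copp w) (cinv xi v))) HC HL) as HD.
      apply (vderiv_has_jacobian (L := fun h => L (Q (LS (diag_flow m w (P h)))))).
      revert HD. apply (@vderiv_local n n _ _ y _ r); [exact Hr|].
      intros y' Hy'. specialize (Hnear y' Hy').
      rewrite (@Tinverse_eq w y'); [reflexivity|]. unfold scale_ok.
      pose proof (vnorm_tri_rev (diag_flow m w (P y')) (diag_flow m w (P y))). lra.
Qed.

End WithLinearization.
End WithWindow.
End WithContraction.
End WithDomain.

Theorem flow_linearization : exists (A : M -> Prop) (T : M -> Cn n),
  opn tau A /\ A p /\ (forall w x, A x -> A (Phi w x)) /\
  biholomorphism tau At A (fun _ => True) T /\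
  (forall w x, A x -> T (Phi w x) = Q (diag_flow m w (P (T x)))).
Proof.
  destruct param_domain as [d0 [Hd0 Himg]].
  destruct (contraction Hd0 Himg) as [delta [Hdelta Hcon]].
  destruct (compact_window Hd0 Himg Hdelta) as [eta [Heta Hwin]].
  destruct (flow_map_linearization Himg Hdelta Hcon Heta Hwin)
    as [rho [T0 [S0 [Hrho [HT [Hflow [Hinj HS]]]]]]].
  exists (basin rho), (Tglobal rho T0).
  split; [apply basin_open|].
  split; [exists (RtoC 0); rewrite Phi_0; apply disc_p; lra|].
  split; [intros w x; apply basin_Phi|].
  split.
  - eapply Tglobal_biholomorphism; eassumption.
  - intros w x. eapply Tglobal_Phi; eassumption.
Qed.

End Flow.

(** * From the multiplicative action to an additive flow *)

Lemma fsumC_exchange m n (f : Fin.t m -> Fin.t n -> C) :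
  fsumC m (fun i => fsumC n (fun j => f i j)) = fsumC n (fun j => fsumC m (fun i => f i j)).
Proof.
  induction m as [|m IH]; simpl.
  - induction n as [|n IHn]; simpl; [reflexivity|].
    rewrite <- (IHn (fun i j => f i (Fin.FS j))). ring.
  - rewrite IH, <- fsumC_plus. reflexivity.
Qed.

Lemma matvec_matmul m k n (A : Cmat m k) (B : Cmat k n) v :
  matvec (matmul A B) v = matvec A (matvec B v).
Proof.
  apply functional_extensionality. intros i. unfold matvec, matmul.
  transitivity (fsumC n (fun j => fsumC k (fun l => Cmult (v j) (Cmult (A i l) (B l j))))).
  - f_equal. apply functional_extensionality. intros j. rewrite fsumC_scal. ring.
  - rewrite fsumC_exchange. f_equal. apply functional_extensionality. intros l.
    rewrite <- fsumC_scal. f_equal. apply functional_extensionality. intros j. ring.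
Qed.

Lemma fsumC_delta n (i : Fin.t n) (f : Fin.t n -> C) :
  fsumC n (fun j => if Fin.eqb i j then f j else 0) = f i.
Proof.
  assert (Z : forall k, fsumC k (fun _ => RtoC 0) = 0).
  { induction k as [|k IH]; simpl; [reflexivity|]. rewrite IH. ring. }
  induction i as [n|n i IH]; simpl.
  - rewrite Nat.eqb_refl, Z. ring.
  - rewrite (IH (fun j => f (Fin.FS j))). ring.
Qed.

Lemma matvec_diagmat n (d v : Cn n) : matvec (diagmat d) v = fun i => Cmult (d i) (v i).
Proof.
  apply functional_extensionality. intros i. unfold matvec, diagmat.
  rewrite <- (fsumC_delta i (fun j => Cmult (d i) (v j))). f_equal.
  apply functional_extensionality. intros j. destruct (Fin.eqb i j); ring.
Qed.

Lemma matvec_idmat n (v : Cn n) : matvec idmat v = v.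
Proof.
  change (@idmat n) with (@diagmat n (fun _ => RtoC 1)). rewrite matvec_diagmat. vext.
Qed.

Lemma Cderiv_vderiv1 n (f : C -> C) (x : Cn n) i l :
  Cderiv f (x i) l -> vderiv1 (fun y => f (y i)) x (fun h => Cmult l (h i)).
Proof.
  intros H. split.
  - split; intros; unfold vadd, vscal; ring.
  - intros eps He. destruct (H eps He) as [d [Hd Hh]]. exists d; split; [exact Hd|].
    intros h Hs. pose proof (vnorm_comp h i).
    eapply Rle_trans; [apply Hh; lra|]. apply Rmult_le_compat_l; lra.
Qed.

(** The substitution z = exp(s w) in the time coordinate, used to pull back the joint holomorphy of
    the action. *)
Lemma vderiv_exp_head n (s : C) (x : Cn (S n)) :
  vderiv (fun y => vcons (cexp (Cmult s (vhead y))) (vtail y)) x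
    (fun h => vcons (Cmult (Cmult (cexp (Cmult s (vhead x))) s) (vhead h)) (vtail h)).
Proof.
  apply vderiv_of_coords. intros i. apply (Fin.caseS' i); simpl.
  - apply (@Cderiv_vderiv1 (S n) (fun u => cexp (Cmult s u)) x Fin.F1). apply Cderiv_cexp_scal.
  - intros j. unfold vtail. split; [split; reflexivity|]. intros eps He.
    exists 1. split; [lra|]. intros h _.
    replace (Cminus (Cminus (vadd x h (Fin.FS j)) (x (Fin.FS j))) (h (Fin.FS j))) with (RtoC 0)
      by (unfold vadd; ring).
    rewrite Cmod_0. pose proof (vnorm_ge_0 h). nra.
Qed.

Section Action.

Variables (n : nat) (M : Type) (tau : topology M) (At : chart n M -> Prop).
Variables (phi : C -> M -> M) (sigma : R).
Hypothesis Hphi : holo_Cstar_action tau At phi.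
Hypothesis Hsigma : sigma = 1 \/ sigma = -1.

(** The sign [sigma] is that of the weights, so that decreasing Re w always contracts. *)
Definition additive_flow (w : C) (x : M) : M := phi (cexp (Cmult sigma w)) x.

Lemma additive_flow_0 x : additive_flow 0 x = x.
Proof. unfold additive_flow. rewrite Cmult_0_r, cexp_0. apply Hphi. Qed.

Lemma additive_flow_add w w' x : additive_flow (Cplus w w') x = additive_flow w (additive_flow w' x).
Proof.
  unfold additive_flow. rewrite Cmult_plus_distr_l, cexp_plus.
  destruct Hphi as [_ [H _]]. apply H; apply cexp_neq_0.
Qed.

Lemma additive_flow_period w x : additive_flow (Cplus w (0, 2 * PI)) x = additive_flow w x.
Proof.
  unfold additive_flow. f_equal. destruct Hsigma as [-> | ->].
  - replace (Cmult 1 (Cplus w (0, 2 * PI))) with (Cplus (Cmult 1 w) (0, 2 * PI)) by ring.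
    apply cexp_period.
  - rewrite <- (cexp_period (Cmult (-1) (Cplus w (0, 2 * PI)))). f_equal.
    unfold Cmult, Cplus, RtoC; simpl. f_equal; ring.
Qed.

Lemma additive_flow_cont w0 x0 V : opn tau V -> V (additive_flow w0 x0) ->
  exists d W, 0 < d /\ opn tau W /\ W x0 /\
    forall w x, Cmod (Cminus w w0) < d -> W x -> V (additive_flow w x).
Proof.
  intros HV H0. destruct Hphi as [_ [_ [Hc _]]].
  destruct (Hc (cexp (Cmult sigma w0)) x0 (@cexp_neq_0 _) V HV H0) as [d [W [Hd [H1 [H2 H3]]]]].
  destruct (Cderiv_cont (Cderiv_cexp_scal sigma w0) Hd) as [d' [Hd' Hexp]].
  exists d', W. repeat split; try assumption. intros w x Hw Hx.
  apply H3; [apply cexp_neq_0 | | exact Hx].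
  specialize (Hexp _ Hw). replace (Cplus w0 (Cminus w w0)) with w in Hexp by ring. exact Hexp.
Qed.

Lemma additive_flow_holo zeta eta : At zeta -> At eta ->
  holo_on (fun w : Cn (S n) => cimg zeta (vtail w) /\ cdom eta (additive_flow (vhead w) (cinv zeta (vtail w))))
          (fun w => cmap eta (additive_flow (vhead w) (cinv zeta (vtail w)))).
Proof.
  intros Hz He w [H1 H2]. destruct Hphi as [_ [_ [_ Hh]]].
  destruct (Hh zeta eta Hz He (vcons (cexp (Cmult sigma (vhead w))) (vtail w))) as [J HJ].
  { split; [apply cexp_neq_0|]. split; [exact H1 | exact H2]. }
  apply (vderiv_has_jacobian
    (vderiv_comp (g := fun w => cmap eta (phi (vhead w) (cinv zeta (vtail w))))
      (vderiv_exp_head sigma w) (has_jacobian_vderiv HJ))).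
Qed.

End Action.

(** In this lemma and the next, the sign in the exponent absorbs that of k, leaving the natural
    weight |k|. *)
Lemma Cpowz_cexp_pos w k : (0 < k)%Z ->
  Cpowz (cexp (Cmult (RtoC 1) w)) k = cexp (Cmult (INR (Z.abs_nat k)) w).
Proof.
  intros Hk. destruct k as [|q|q]; try lia. simpl. rewrite cexp_nat, Cmult_1_l. reflexivity.
Qed.

Lemma Cpowz_cexp_neg w k : (k < 0)%Z ->
  Cpowz (cexp (Cmult (RtoC (-1)) w)) k = cexp (Cmult (INR (Z.abs_nat k)) w).
Proof.
  intros Hk. destruct k as [|q|q]; try lia. simpl.
  rewrite <- cexp_nat, <- cexp_opp. f_equal. ring.
Qed.

Theorem theoremB :
  forall (n : nat) (M : Type) (tau : topology M) (At : chart n M -> Prop)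
         (phi : C -> M -> M) (p : M),
    complex_manifold tau At ->
    holo_Cstar_action tau At phi ->
    isolated_fixed_point tau phi p ->
    forall (xi : chart n M) (J : C -> Cmat n n),
      At xi -> cdom xi p ->
      derivative_action_matrices xi phi p J ->
      dicritical J ->
      let psi := fun (z : C) (x : Cn n) => matvec (J z) x in
      exists (A : M -> Prop) (B : Cn n -> Prop) (T : M -> Cn n),
        opn tau A /\ A p /\ (forall z x, z <> RtoC 0 -> A x -> A (phi z x)) /\
        open_Cn B /\ B (fun _ => RtoC 0) /\
        (forall z y, z <> RtoC 0 -> B y -> B (psi z y)) /\
        biholomorphism tau At A B T /\
        (forall z x, z <> RtoC 0 -> A x -> psi z (T x) = T (phi z x)).
Proof.
  intros n M tau At phi p HM Hphi [Hfix _] xi J Hxi Hp HJ [P [Q [lam [HPQ [HQP [Hsign HJdiag]]]]]] psi.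
  assert (Hs : exists sigma : R, (sigma = 1 \/ sigma = -1) /\ forall w j,
     Cpowz (cexp (Cmult sigma w)) (lam j) = cexp (Cmult (INR (Z.abs_nat (lam j))) w)).
  { destruct Hsign as [H|H].
    - exists 1. split; [left; reflexivity|]. intros; apply Cpowz_cexp_pos, H.
    - exists (-1). split; [right; reflexivity|]. intros; apply Cpowz_cexp_neg, H. }
  destruct Hs as [sigma [Hsigma Hpow]].
  set (m := fun j => Z.abs_nat (lam j)) in *.
  assert (Hpsi : forall w v, psi (cexp (Cmult sigma w)) v = matvec Q (diag_flow m w (matvec P v))).
  { intros w v. unfold psi. rewrite HJdiag by apply cexp_neq_0.
    rewrite !matvec_matmul, matvec_diagmat. f_equal.
    apply functional_extensionality. intros j. rewrite Hpow. reflexivity. }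
  (* A logarithm multiplied by [sigma] works because [sigma] squares to 1; thus statements about all
     w give those about all nonzero z. *)
  assert (Hlog : forall z, z <> RtoC 0 -> exists w, z = cexp (Cmult sigma w)).
  { intros z Hz. destruct (cexp_onto Hz) as [w <-]. exists (Cmult sigma w). f_equal.
    destruct Hsigma as [-> | ->]; ring. }
  destruct (@flow_linearization n M tau At (additive_flow phi sigma) p xi (matvec P) (matvec Q) m)
    as [A [T [HA [Hp' [Hinv [Hbi Heq]]]]]]; try assumption.
  - intros; eapply additive_flow_0; eassumption.
  - intros; eapply additive_flow_add; eassumption.
  - intros; apply additive_flow_period; assumption.
  - intros; eapply additive_flow_cont; eassumption.
  - intros; eapply additive_flow_holo; eassumption.
  - intros w. apply Hfix, cexp_neq_0.
  - apply linear_matvec.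
  - apply linear_matvec.
  - intros v. rewrite <- matvec_matmul, HPQ. apply matvec_idmat.
  - intros v. rewrite <- matvec_matmul, HQP. apply matvec_idmat.
  - intros j. unfold m. destruct Hsign as [H|H]; specialize (H j); lia.
  - intros w. pose proof (has_jacobian_vderiv (HJ _ (@cexp_neq_0 (Cmult sigma w)))) as HD.
    replace (fun h => matvec Q (diag_flow m w (matvec P h))) with (matvec (J (cexp (Cmult sigma w)))).
    + exact HD.
    + apply functional_extensionality. intros v. apply Hpsi.
  (* The image of the basin is the whole space, so openness and invariance of B are immediate. *)
  - exists A, (fun _ => True), T. repeat split; try assumption.
    + intros z x Hz Hx. destruct (Hlog z Hz) as [w ->]. apply (Hinv w x Hx).
    + intros x _. exists 1. split; [lra | trivial].
    + apply Hbi.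
    + intros z x Hz Hx. destruct (Hlog z Hz) as [w ->]. rewrite Hpsi. symmetry. apply (Heq w x Hx).
Qed.
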